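(* We have $$\overline{C^1_3}\leq 40, \quad \overline{C^2_3}\leq 2625, \quad \overline{P^1_3}\leq 156, \quad \text{and} \quad \overline{P^2_3}\leq 10350.$$
   Context: Graphs are finite and simple. For positive integers $i,k$, $\overline{C^i_k}$ (respectively $\overline{P^i_k}$) denotes the smallest order (number of vertices) of a planar $k$-connected graph $G$ such that every set of $i$ vertices of $G$ is disjoint from some longest cycle (respectively, some longest path) of $G$. *)

(* Defs.v *)
From HB Require Import structures.
From mathcomp Require Import all_boot all_order all_algebra.
From mathcomp Require Import all_classical all_reals all_analysis.

Set Implicit Arguments.
Unset Strict Implicit.
Unset Printing Implicit Defensive.

Import Order.TTheory GRing.Theory Num.Theory.
Import numFieldNormedType.Exports.

Local Open Scope classical_set_scope.
Local Open Scope ring_scope.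

Record sgraph : Type := SGraph {
  vertex :> finType;
  adj : rel vertex;
  adj_sym : symmetric adj;
  adj_irrefl : irreflexive adj
}.

Definition gorder (G : sgraph) : nat := #|G|.

(* [c] lists the vertices of a cycle in cyclic order; its length is [size c]. *)
Definition is_cycle (G : sgraph) (c : seq G) : bool :=
  (3 <= size c)%N && ucycleb (@adj G) c.

(* [p] lists the vertices of a path in order; its length is [(size p).-1], so
   that comparing lengths amounts to comparing sizes. A single vertex is a
   path, the empty sequence is not. *)
Definition is_path (G : sgraph) (p : seq G) : bool :=
  [&& (1 <= size p)%N, uniq p & sorted (@adj G) p].

Definition longest_cycle (G : sgraph) (c : seq G) : Prop :=
  is_cycle c /\ forall c' : seq G, is_cycle c' -> (size c' <= size c)%N.

Definition longest_path (G : sgraph) (p : seq G) : Prop :=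
  is_path p /\ forall p' : seq G, is_path p' -> (size p' <= size p)%N.

(* Connectedness of G - X. It is only used for X with fewer vertices than G, so
   that G - X is nonempty. *)
Definition connected_without (G : sgraph) (X : {set G}) : Prop :=
  forall x y : G, x \notin X -> y \notin X ->
    connect [rel u v : G | [&& u \notin X, v \notin X & adj u v]] x y.

Definition k_connected (k : nat) (G : sgraph) : Prop :=
  (k < gorder G)%N /\
  forall X : {set G}, (#|X| < k)%N -> connected_without X.

(* [A] is an arc in the plane with endpoints [p] and [q]: a homeomorphic image
   of [0, 1], i.e. (by compactness) a continuous injective one. *)
Definition is_arc (R : realType) (p q : R * R) (A : set (R * R)) : Prop :=
  exists g : R -> R * R,
    [/\ {within `[0, 1], continuous g},
        {in `[0, 1] &, injective g},
        g 0 = p, g 1 = q & A = g @` `[0, 1]].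

(* Vertices are drawn as distinct points and edges as arcs; [draw] is indexed
   by unordered pairs, its values on non-edges being irrelevant. The interior
   of an edge contains no vertex and no point of any other edge. *)
Definition plane_drawing (R : realType) (G : sgraph)
    (pos : G -> R * R) (draw : {set G} -> set (R * R)) : Prop :=
  let edge_interior u v := draw [set u; v]%SET `\` [set pos u; pos v] in
  [/\ injective pos,
      forall u v : G, adj u v -> is_arc (pos u) (pos v) (draw [set u; v]%SET),
      forall u v w : G, adj u v -> ~ edge_interior u v (pos w) &
      forall u v x y : G, adj u v -> adj x y ->
        [set u; v]%SET <> [set x; y]%SET ->
        edge_interior u v `&` draw [set x; y]%SET = set0].

Definition planar (R : realType) (G : sgraph) : Prop :=
  exists (pos : G -> R * R) (draw : {set G} -> set (R * R)),
    plane_drawing pos draw.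

Definition cycles_avoid (i : nat) (G : sgraph) : Prop :=
  forall S : {set G}, #|S| = i ->
    exists c : seq G, longest_cycle c /\ {in S, forall v, v \notin c}.

Definition paths_avoid (i : nat) (G : sgraph) : Prop :=
  forall S : {set G}, #|S| = i ->
    exists p : seq G, longest_path p /\ {in S, forall v, v \notin p}.

Definition smallest_order (P : sgraph -> Prop) (n : nat) : Prop :=
  (exists G : sgraph, P G /\ gorder G = n) /\
  (forall G : sgraph, P G -> (n <= gorder G)%N).

(* [Cbar R i k n] says that the number \overline{C^i_k} exists and equals n;
   similarly for [Pbar] and \overline{P^i_k}. *)
Definition Cbar (R : realType) (i k n : nat) : Prop :=
  smallest_order
    (fun G => [/\ planar R G, k_connected k G & cycles_avoid i G]) n.

Definition Pbar (R : realType) (i k n : nat) : Prop :=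
  smallest_order
    (fun G => [/\ planar R G, k_connected k G & paths_avoid i G]) n.

(* Main.v *)
(* A planar hypohamiltonian graph on 40 vertices gives the first bound. For the other
   ones, let Q be a suitable planar nonhamiltonian graph on 36 vertices minus a cubic
   vertex. The three neighbours of this vertex are the terminals of Q: a path of Q
   between two of them has at most 34 of the 35 vertices, and every vertex of Q is
   missed by such a path on 34 vertices, joining a prescribed pair of terminals.
   Substitute copies of Q for the vertices of a cubic planar graph. A copy has three
   exits, so a long path or cycle passes through it only once, apart from the end
   points of the path, and its length is bounded in terms of the cubic graph.
   Conversely, a cycle of the cubic graph which misses a prescribed edge at each of
   one or two vertices expands to a long cycle missing prescribed vertices of the
   corresponding copies.

   Let H be a cubic planar hypohamiltonian graph on 70 vertices in which any two edges
   are missed by a common cycle on 69 vertices. Its composite H[Q] has 2450 vertices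
   and longest cycles on 69 * 34 of them, any two vertices being missed by one of
   these. In K4[Q], with 140 vertices, a longest path visits all four copies of Q and
   contains both copies where it ends completely. Finally R := (H - v)[Q] is itself a
   piece with three terminals, on 69 * 35 vertices, and K4[R] has 9660 vertices.

   All drawings are straight-line drawings with rational coordinates. Copies of a piece
   are drawn in pairwise disjoint triangles, with the terminals at the corners. The
   composites are 3-connected since the base graphs have no edge cuts of size at most
   2, which a flow with pairwise distinct nonzero absolute values on the edges
   certifies: such a cut would carry two opposite values. Nonhamiltonicity is checked
   by a verified backtracking search. *)

From HB Require Import structures.
From Stdlib Require Import ZArith PArith NArith FMapPositive.
Require Import Defs.
From mathcomp Require Import all_boot all_order all_algebra.
From mathcomp Require Import ssrZ zify ring lra.

Set Implicit Arguments.
Unset Strict Implicit.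
Unset Printing Implicit Defensive.

(** The bounds 34 and 68 * 34 have one source. A pass of Q through all 35 vertices, closed through
    the deleted cubic vertex, would be a Hamiltonian cycle; a pass of R meeting all 69 blocks would
    likewise yield one of H. A block is traversed only once because two traversals would use four
    distinct ports out of three.

    So missing x in a block becomes missing one edge of the base graph, and two vertices become two
    edges. Two vertices of the same block may impose conflicting demands; the block is then skipped
    altogether, by asking the base cycle to miss two of the three edges at it. This decides the
    order in which the four copies are visited. *)

Lemma pos_eqP : Equality.axiom Pos.eqb.
Proof. by move=> x y; apply: (iffP idP) => /Pos.eqb_eq. Qed.

HB.instance Definition _ := hasDecEq.Build positive pos_eqP.

Module PM := PositiveMap.

Lemma next_neq_prev (T : eqType) (c : seq T) x : uniq c -> 2 < size c -> x \in c ->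
  next c x != prev c x.
Proof.
move=> uc sc xc; have [i c' e] := rot_to xc.
have uc' : uniq (x :: c') by rewrite -e rot_uniq.
have sz : 2 < size (x :: c') by rewrite -e size_rot.
have nr z : next c z = next (x :: c') z by rewrite -e next_rot.
apply/eqP => h; move: sz; have := next_prev uc x; rewrite -h !nr.
move: uc'; case: c' {e h nr} => [|y [|z s]] //= /and3P[xn yn zn] + _.
rewrite eqxx; move: xn; rewrite !inE !negb_or => /and3P[/negbTE xy /negbTE xz _].
by rewrite [y == x]eq_sym xy eqxx => zx; rewrite zx eqxx in xz.
Qed.

(** * Refutation of hamiltonicity *)

(* An edge carries a numerical key under which its status is stored. *)
Definition kedge := (positive * (positive * positive))%type.

Definition inc_table (T : seq kedge) (vs : seq positive) : PM.t (seq kedge) :=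
  foldr (fun v m => PM.add v [seq t <- T | (t.2.1 == v) || (t.2.2 == v)] m)
    (PM.empty _) vs.

(* [status] records the edges known to be on the cycle ([true]) or off it
   ([false]), [mates] sends an end of a maximal path of known cycle edges to its
   other end (entries of inner vertices are stale but still connected), and
   [ncyc] counts the known cycle edges. *)
Record hstate := HState {
  status : PM.t bool; mates : PM.t positive; ncyc : nat }.

Definition mate (s : hstate) (v : positive) : positive :=
  if PM.find v (mates s) is Some w then w else v.

(** [None] signals a contradiction. A cycle edge between the two ends of one known path would close
    a cycle, which is refused unless it is the [n]-th known edge. *)
Definition assign (n : nat) (b : bool) (s : hstate) (t : kedge) : option hstate :=
  match PM.find t.1 (status s) with
  | Some b' => if b == b' then Some s else None
  | None =>
    if b then
      let x := mate s t.2.1 in let y := mate s t.2.2 in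
      if (x == t.2.2) && ((ncyc s).+1 < n) then None
      else Some (HState (PM.add t.1 true (status s))
                   (PM.add x y (PM.add y x (mates s))) (ncyc s).+1)
    else Some (HState (PM.add t.1 false (status s)) (mates s) (ncyc s))
  end.

Fixpoint assign_all (n : nat) (b : bool) (s : hstate) (l : seq kedge) :=
  if l is t :: l' then obind (fun s' => assign_all n b s' l') (assign n b s t)
  else Some s.

Definition unknown (s : hstate) (l : seq kedge) : seq kedge :=
  [seq t <- l | ~~ PM.mem t.1 (status s)].

Definition known_in (s : hstate) (l : seq kedge) : nat :=
  count (fun t => if PM.find t.1 (status s) is Some b then b else false) l.

Definition ends_of (l : seq kedge) : seq positive :=
  flatten [seq [:: t.2.1; t.2.2] | t <- l].

(** Only forced statuses are derived, from the fact that each vertex has exactly two cycle edges.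
    Running out of fuel thus costs strength, not soundness. *)
Fixpoint propagate (n : nat) (inc : PM.t (seq kedge)) (fuel : nat)
    (s : hstate) (wl : seq positive) : option hstate :=
  if fuel is fuel'.+1 then
    if wl is v :: wl' then
      if PM.find v inc is Some l then
        let free := unknown s l in
        let k := known_in s l in
        if 2 < k then None
        else if k == 2 then
          obind (fun s' => propagate n inc fuel' s' (ends_of free ++ wl'))
            (assign_all n false s free)
        else if k + size free < 2 then None
        else if k + size free == 2 then
          obind (fun s' => propagate n inc fuel' s' (ends_of free ++ wl'))
            (assign_all n true s free)
        else propagate n inc fuel' s wl'
      else propagate n inc fuel' s wl'
    else Some s
  else Some s.

Definition try_edge (n : nat) inc (b : bool) (s : hstate) (t : kedge) :=
  obind (fun s' => propagate n inc 400 s' [:: t.2.1; t.2.2]) (assign n b s t).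

(** A vertex stays at the head of the list until all its edges have a status, so both branches
    continue with [vs]. The answer [false] claims nothing. *)
Fixpoint refuted (n : nat) (inc : PM.t (seq kedge)) (fuel : nat)
    (s : hstate) (vs : seq positive) : bool :=
  if fuel is fuel'.+1 then
    if vs is v :: vs' then
      if PM.find v inc is Some l then
        if unknown s l is t :: _ then
          (if try_edge n inc true s t is Some s'
           then refuted n inc fuel' s' vs else true) &&
          (if try_edge n inc false s t is Some s'
           then refuted n inc fuel' s' vs else true)
        else refuted n inc fuel' s vs'
      else refuted n inc fuel' s vs'
    else false
  else false.

(** Listing each edge in both orientations without repetition excludes parallel edges and also
    loops, since a loop equals its own reversal. *)
Definition nonham_check (T : seq kedge) (vs : seq positive) : bool :=
  let n := size vs in
  [&& uniq [seq t.1 | t <- T],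
      uniq ([seq t.2 | t <- T] ++ [seq (t.2.2, t.2.1) | t <- T]) &
      refuted n (inc_table T vs) 1000 (HState (PM.empty _) (PM.empty _) 0) vs].

Section NonHam.

Variables (T : seq kedge) (vs c : seq positive).
Hypotheses (keyT : uniq [seq t.1 | t <- T])
  (simpT : uniq ([seq t.2 | t <- T] ++ [seq (t.2.2, t.2.1) | t <- T]))
  (uniq_c : uniq c) (size_c : 2 < size c)
  (cyc_c : cycle (fun x y => ((x, y) \in [seq t.2 | t <- T]) ||
                             ((y, x) \in [seq t.2 | t <- T])) c).

Let n := size c.

Let consec (x y : positive) := (next c x == y) || (next c y == x).

Let onc (t : kedge) := [&& t.2.1 \in c, t.2.2 \in c & consec t.2.1 t.2.2].

(** Connection by edges of [I], phrased through predicates that are constant along them: it is an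
    equivalence at once, and one cut predicate refutes it. *)
Definition joined (I : seq kedge) (x y : positive) : Prop :=
  forall P : pred positive, {in I, forall t, P t.2.1 = P t.2.2} -> P x = P y.

Lemma joinedC I x y : joined I x y -> joined I y x.
Proof. by move=> h P /h. Qed.

Lemma joined_trans I x y z : joined I x y -> joined I y z -> joined I x z.
Proof. by move=> h k P hP; rewrite (h P hP) (k P hP). Qed.

Lemma joined_sub I J x y : {subset I <= J} -> joined I x y -> joined J x y.
Proof. by move=> IJ h P hP; apply: h => t /IJ /hP. Qed.

Lemma joined_edge I t : t \in I -> joined I t.2.1 t.2.2.
Proof. by move=> tI P /(_ t tI). Qed.

Lemma kedge_inj t t' : t \in T -> t' \in T -> t.2 = t'.2 -> t = t'.
Proof.
move: simpT; rewrite cat_uniq => /andP[u _] tT t'T.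
elim: T u tT t'T => //= t0 T0 IH /andP[n0 u]; rewrite !inE.
case/orP=> [/eqP->|tT]; case/orP=> [/eqP->|t'T] // e.
- by rewrite e map_f in n0.
- by rewrite -e map_f in n0.
- exact: IH.
Qed.

Lemma key_inj t t' : t \in T -> t' \in T -> t.1 = t'.1 -> t = t'.
Proof.
move: keyT => u tT t'T.
elim: T u tT t'T => //= t0 T0 IH /andP[n0 u]; rewrite !inE.
case/orP=> [/eqP->|tT]; case/orP=> [/eqP->|t'T] // e.
- by rewrite e map_f in n0.
- by rewrite -e map_f in n0.
- exact: IH.
Qed.

Lemma swap_notin t t' : t \in T -> t' \in T -> t.2 = (t'.2.2, t'.2.1) -> False.
Proof.
move: simpT; rewrite cat_uniq => /and3P[_ /hasPn h _] tT t'T e.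
have /h /negP := map_f (fun t => (t.2.2, t.2.1)) t'T.
by apply; rewrite -e map_f.
Qed.

Lemma no_loop t : t \in T -> t.2.1 != t.2.2.
Proof.
move=> tT; apply/negP => /eqP e; apply: (swap_notin tT tT).
by case: t e {tT} => k [x y] /= ->.
Qed.

Lemma consec_edge x y : x \in c -> y \in c -> consec x y ->
  exists2 t, t \in T & onc t /\ (t.2 = (x, y) \/ t.2 = (y, x)).
Proof.
move=> xc yc; have hn z : z \in c -> (z, next c z) \in [seq t.2 | t <- T] \/ (next c z, z) \in [seq t.2 | t <- T].
  by move=> zc; apply/orP; exact: (next_cycle cyc_c zc).
by case/orP=> /eqP e; [have := hn _ xc | have := hn _ yc]; rewrite e;
  case=> /mapP[t tT et]; exists t => //; split; rewrite /onc -?et /= ?xc ?yc /consec ?e ?eqxx ?orbT //; auto.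
Qed.

Definition other (x : positive) (t : kedge) :=
  if t.2.1 == x then t.2.2 else t.2.1.

(** [other x] maps the cycle edges at [x] bijectively to the successor and the predecessor of [x],
    which differ on a cycle with more than two vertices. *)
Lemma deg2 x : x \in c ->
  count onc [seq t <- T | (t.2.1 == x) || (t.2.2 == x)] = 2.
Proof.
move=> xc; rewrite -size_filter.
set l := filter _ _; rewrite -(size_map (other x)).
have ul : uniq [seq other x t | t <- l].
  rewrite map_inj_in_uniq; last first.
    move=> t t'; rewrite /l !mem_filter => /and3P[_ ht tT] /and3P[_ ht' t'T].
    have := no_loop tT; have := no_loop t'T; rewrite /other.
    case: ifP ht => [/eqP h1 _|h1 /= /eqP h1']; case: ifP ht' => [/eqP h2 _|h2 /= /eqP h2'] n1 n2 e.
    - by apply: kedge_inj => //; move: h1 h2 e; case: (t.2) => ? ?; case: (t'.2) => ? ? /= -> -> ->.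
    - case: (swap_notin tT t'T).
      by move: h1 h2' e; case: (t.2) => ? ?; case: (t'.2) => ? ? /= -> -> ->.
    - case: (swap_notin tT t'T).
      by move: h1' h2 e; case: (t.2) => ? ?; case: (t'.2) => ? ? /= -> -> ->.
    - by apply: kedge_inj => //; move: h1' h2' e; case: (t.2) => ? ?; case: (t'.2) => ? ? /= -> -> ->.
  rewrite filter_uniq // filter_uniq //; move: keyT; exact: map_uniq.
have : perm_eq [seq other x t | t <- l] [:: next c x; prev c x].
  apply: uniq_perm => //=; first by rewrite inE next_neq_prev.
  move=> y; rewrite !inE; apply/mapP/idP => [[t]|].
    rewrite /l !mem_filter => /and3P[/and3P[c1 c2 co] ht tT] ->; rewrite /other.
    case: ifP ht co => [/eqP -> _|h1 /= /eqP ->]; rewrite /consec.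
      by case/orP => /eqP <-; rewrite ?eqxx // prev_next // eqxx orbT.
    by case/orP => /eqP <-; rewrite ?eqxx // prev_next // eqxx orbT.
  move=> hy; have yc : y \in c by case/orP: hy => /eqP ->; rewrite ?mem_next ?mem_prev.
  have cxy : consec x y.
    by rewrite /consec; case/orP: hy => /eqP ->; rewrite ?eqxx // next_prev // eqxx orbT.
  have [t tT [ot et]] := consec_edge xc yc cxy; exists t; rewrite /l ?mem_filter ?ot ?tT /other.
    by case: et => -> /=; rewrite eqxx ?orbT.
  have nl := no_loop tT.
  by case: et nl => -> /=; rewrite ?eqxx // => /negbTE ->.
by move/perm_size => ->.
Qed.

(** Removing [t] turns the cycle into a path of [n.-1] edges between the ends of [t]. Each of these
    edges separates the two ends, so joining them takes all [n.-1] edges, more than [I] has. *)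
Lemma open_path I t : t \in T -> onc t -> t \notin I ->
  {subset I <= T} -> {in I, forall u, onc u} -> uniq I -> (size I).+1 < n ->
  ~ joined I t.2.1 t.2.2.
Proof.
move=> tT ot tI IT Io uI sI.
have [x [y [xc [yx et]]]] : exists x y, x \in c /\ next c y = x /\ y \in c /\ (t.2 = (x, y) \/ t.2 = (y, x)).
  case/and3P: ot => c1 c2 /orP[] /eqP e; [exists t.2.2, t.2.1 | exists t.2.1, t.2.2];
  by split=> //; split=> //; split=> //; case: (t.2) => ? ?; auto.
case: et => yc et.
have [i c' e] := rot_to xc.
have uc' : uniq (x :: c') by rewrite -e rot_uniq.
have sc' : size (x :: c') = n by rewrite -e size_rot.
have memc z : (z \in c) = (z \in x :: c') by rewrite -e mem_rot.
pose ix z := index z (x :: c').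
have ixn z : z \in c -> ix z < n by rewrite memc -index_mem sc'.
have nxi z : z \in c -> ix (next c z) = if (ix z).+1 < n then (ix z).+1 else 0.
  move=> zc; rewrite -(next_rot i) // e next_nth -memc zc.
  have := ixn _ zc; rewrite -/(ix z) => iz; case: ifPn => h.
    by rewrite -[nth _ _ _]/(nth x (x :: c') (ix z).+1) /ix index_uniq ?sc'.
  by rewrite -leqNgt -sc' in h; rewrite nth_default /ix /= ?eqxx.
have ix0 : ix x = 0 by rewrite /ix /= eqxx.
have ixI z z' : z \in c -> z' \in c -> ix z = ix z' -> z = z'.
  by rewrite !memc => zc z'c; apply: index_inj.
have n2 : 2 < n by [].
have iy : ix y = n.-1.
  have := nxi _ yc; have := ixn _ yc; rewrite yx ix0; case: ifP => // h1 h2 _; clear - h1 h2 n2; lia.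
(* the positions up to [j] are separated from the others unless the edge
   between positions [j] and [j + 1] is known *)
have cut j : j.+1 < n -> joined I t.2.1 t.2.2 ->
    has (fun u => minn (ix u.2.1) (ix u.2.2) == j) I.
  move=> jn jI; apply/negPn/negP => /hasPn hI.
  have : joined I x y by case: et jI => ->; rewrite // => /joinedC.
  move/(_ (fun z => ix z <= j)); rewrite ix0 iy.
  suff h : {in I, forall u, (ix u.2.1 <= j) = (ix u.2.2 <= j)}.
    by move/(_ h); clear - jn; lia.
  move=> u hu; have uT := IT _ hu; have /and3P[c1 c2 cu] := Io _ hu.
  (* An edge of [I] between the last and the first position would be [t] itself or its reversal. *)
  have n0 : ~~ [|| (ix u.2.1 == 0) && (ix u.2.2 == n.-1) |
                   (ix u.2.2 == 0) && (ix u.2.1 == n.-1)].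
    have ex z : z \in c -> ix z = 0 -> z = x.
      by move=> zc z0; apply: ixI => //; rewrite ix0.
    have ey z : z \in c -> ix z = n.-1 -> z = y.
      by move=> zc z0; apply: ixI => //; rewrite iy.
    apply/negP => h; have ut : u.2 = (x, y) \/ u.2 = (y, x).
      case/orP: h => /andP[/eqP h1 /eqP h2]; [left|right].
        by rewrite -(ex _ c1 h1) -(ey _ c2 h2); case: (u.2).
      by rewrite -(ex _ c2 h1) -(ey _ c1 h2); case: (u.2).
    have : u = t \/ u.2 = (t.2.2, t.2.1).
      case: et ut => et [] ut; rewrite et ut; auto; left.
        by apply: kedge_inj => //; rewrite et ut.
      by apply: kedge_inj => //; rewrite et ut.
    case=> [ut'|ut']; first by rewrite -ut' hu in tI.
    exact: (swap_notin uT tT ut').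
  have := hI _ hu; have := ixn _ c1; have := ixn _ c2; move: n0.
  by case/orP: cu => /eqP h; [have := nxi _ c1|have := nxi _ c2]; rewrite h;
    move: (ix u.2.1) (ix u.2.2) => p q; clear - jn n2; case: ifP; lia.
move=> jI; suff : n.-1 <= size I by clear - sI; lia.
rewrite -(size_iota 0 n.-1) -(size_map (fun u => minn (ix u.2.1) (ix u.2.2)) I).
apply: uniq_leq_size; first exact: iota_uniq.
move=> j; rewrite mem_iota => /andP[_ jn].
have jn' : j.+1 < n by clear - jn; lia.
by have /hasP[w wI /eqP <-] := cut j jn' jI; apply: map_f.
Qed.

Hypothesis vs_c : {subset vs <= c}.

(** The state is compared with the fixed cycle [c]: every recorded status is the true one. Of
    [mates] it is only asked that both sides of an entry are joined by known edges, which stale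
    entries satisfy too. *)
Definition hinv (s : hstate) : Prop :=
  exists I : seq kedge,
  [/\ uniq I /\ size I = ncyc s, {subset I <= T},
      {in T, forall t, (t \in I) = (PM.find t.1 (status s) == Some true)},
      {in T, forall t b, PM.find t.1 (status s) = Some b -> onc t = b} &
      forall x y, PM.find x (mates s) = Some y -> joined I x y].

Lemma find_add (A : Type) (k k' : positive) (a : A) m :
  PM.find k (PM.add k' a m) = if k == k' then Some a else PM.find k m.
Proof.
by case: eqP => [->|h]; [exact: PM.gss | exact: PM.gso].
Qed.

Lemma joined_mate I s x : (forall x y, PM.find x (mates s) = Some y -> joined I x y) ->
  joined I x (mate s x).
Proof. by rewrite /mate => h; case E: (PM.find x _) => [y|]; [apply: h | move=> P]. Qed.

(** By [open_path] the test for a premature cycle cannot fire on an edge of [c]. *)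
Lemma assign_sound s t b : t \in T -> onc t = b -> hinv s ->
  exists2 s', assign n b s t = Some s' & hinv s'.
Proof.
move=> tT ob [I [[uI sI] IT memI knI mtI]]; rewrite /assign.
case E: (PM.find t.1 (status s)) => [b'|].
  by rewrite -(knI _ tT _ E) ob eqxx; exists s => //; exists I.
have tI : t \notin I by rewrite memI // E.
case: b ob => ob; last first.
  eexists; first by []; exists I; split=> //=.
    move=> u uT; rewrite find_add memI //; case: (u.1 =P t.1) => // e.
    by rewrite (key_inj uT tT e) E.
  move=> u uT b; rewrite find_add; case: (u.1 =P t.1) => [e [<-]|_]; last exact: knI.
  by rewrite (key_inj uT tT e).
have jt := joined_mate (s := s) _ mtI.
have Io : {in I, forall u, onc u}.
  by move=> u uI'; have uT := IT _ uI'; apply: (knI _ uT); apply/eqP; rewrite -memI.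
case: ifPn => [/andP[/eqP e kn]|_].
  case: (open_path tT ob tI IT Io uI); first by rewrite sI.
  by rewrite -e; exact: jt.
eexists; first by []; exists (t :: I); split=> /=.
- by rewrite tI uI sI.
- by move=> u; rewrite inE => /orP[/eqP->|/IT].
- move=> u uT; rewrite inE find_add memI //.
  case: (eqVneq u t) => [->|ut] /=; first by rewrite !eqxx.
  by case: (u.1 =P t.1) => // e; rewrite (key_inj uT tT e) eqxx in ut.
- move=> u uT b; rewrite find_add; case: (u.1 =P t.1) => [e [<-]|_]; last exact: knI.
  by rewrite (key_inj uT tT e).
have sub : {subset I <= t :: I} by move=> u uI'; rewrite inE uI' orbT.
have jxy : joined (t :: I) (mate s t.2.1) (mate s t.2.2).
  apply: joined_trans (joined_sub sub (jt t.2.2)).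
  apply: joined_trans (joined_edge (mem_head t I)).
  exact: joinedC (joined_sub sub (jt t.2.1)).
move=> x y; rewrite !find_add; case: eqP => [-> [<-] //|_].
case: eqP => [-> [<-]|_ /mtI]; first exact: joinedC.
exact: joined_sub.
Qed.

Lemma assign_all_sound s b l : {in l, forall t, t \in T /\ onc t = b} -> hinv s ->
  exists2 s', assign_all n b s l = Some s' & hinv s'.
Proof.
elim: l s => [|t l IH] s hl hs /=; first by exists s.
have [tT ot] := hl _ (mem_head _ _).
have [s' -> hs'] := assign_sound tT ot hs.
by apply: IH => // u ul; apply: hl; rewrite inE ul orbT.
Qed.

Lemma inc_tableP v l : PM.find v (inc_table T vs) = Some l ->
  v \in vs /\ l = [seq t <- T | (t.2.1 == v) || (t.2.2 == v)].
Proof.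
rewrite /inc_table; elim: (vs) => [|w ws IH] /=; first by rewrite PM.gempty.
rewrite find_add inE; case: eqP => [-> [<-] //|_ /IH[h ->]].
by rewrite h orbT.
Qed.

Lemma known_unknown s l : hinv s -> {subset l <= T} ->
  count onc l = known_in s l + count onc (unknown s l).
Proof.
case=> I [_ _ _ knI _]; rewrite /known_in /unknown.
elim: l => //= t l IH lT; rewrite IH => [|u ul]; last by apply: lT; rewrite inE ul orbT.
have tT := lT _ (mem_head _ _).
rewrite PM.mem_find; case E: (PM.find _ _) => [b|] /=; last by rewrite addnCA.
by rewrite (knI _ tT _ E) addnA.
Qed.

Lemma propagate_sound fuel s wl : hinv s ->
  exists2 s', propagate n (inc_table T vs) fuel s wl = Some s' & hinv s'.
Proof.
elim: fuel s wl => [|fuel IH] s [|v wl] hs /=; try by exists s.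
case E: (PM.find _ _) => [l|]; last exact: IH.
have [vvs le] := inc_tableP E.
have lT : {subset l <= T} by move=> t; rewrite le mem_filter => /andP[].
have d2 := deg2 (vs_c vvs); rewrite -le (known_unknown hs lT) in d2.
set k := known_in s l in d2 *; set fr := unknown s l in d2 *.
have frT : {subset fr <= T} by move=> t; rewrite mem_filter => /andP[_ /lT].
have := count_size onc fr; move: d2; set o := count onc fr => d2 os.
have -> : (2 < k) = false by clear - d2; lia.
case: ifPn => [/eqP k2|_].
  have o0 : ~~ has onc fr by rewrite has_count -/o; clear - d2 k2; lia.
  have h : {in fr, forall t, t \in T /\ onc t = false}.
    by move=> t tf; split; [exact: frT | apply: negbTE; exact: (hasPn o0)].
  by have [s' -> hs'] := assign_all_sound h hs; exact: IH.
have -> : (k + size fr < 2) = false by clear - d2 os; lia.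
case: ifPn => [/eqP k2|_]; last exact: IH.
have oA : all onc fr by rewrite all_count -/o; clear - d2 k2 os; lia.
have h : {in fr, forall t, t \in T /\ onc t = true}.
  by move=> t tf; split; [exact: frT | exact: (allP oA)].
by have [s' -> hs'] := assign_all_sound h hs; exact: IH.
Qed.

Lemma try_edge_sound s t : t \in T -> hinv s ->
  exists2 s', try_edge n (inc_table T vs) (onc t) s t = Some s' & hinv s'.
Proof.
move=> tT hs; rewrite /try_edge; have [s' -> hs'] := assign_sound tT erefl hs.
exact: propagate_sound.
Qed.

(** The branch giving the chosen edge its status on [c] preserves the invariant and is never
    refuted; this alone makes the conjunction false. *)
Lemma refuted_sound fuel s ws : hinv s ->
  refuted n (inc_table T vs) fuel s ws = false.
Proof.
elim: fuel s ws => [|fuel IH] s [|v ws] hs //=.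
case E: (PM.find _ _) => [l|]; last exact: IH.
case El: (unknown s l) => [|t fr]; first exact: IH.
have [_ le] := inc_tableP E.
have tT : t \in T.
  have : t \in unknown s l by rewrite El mem_head.
  by rewrite mem_filter le mem_filter => /and3P[].
have [s' h hs'] := try_edge_sound tT hs.
by case: (onc t) h => ->; rewrite (IH _ _ hs') ?andbF.
Qed.

End NonHam.

Theorem nonham_checkP (T : seq kedge) (vs c : seq positive) :
  nonham_check T vs -> uniq c -> 2 < size c -> perm_eq vs c ->
  ~ cycle (fun x y => ((x, y) \in [seq t.2 | t <- T]) ||
                      ((y, x) \in [seq t.2 | t <- T])) c.
Proof.
case/and3P=> kT sT + uc sc pc cc; rewrite (perm_size pc).
rewrite (refuted_sound kT sT uc sc cc) // => [x|]; first by rewrite (perm_mem pc).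
by exists [::]; split=> //=; [move=> t _ | move=> t _ b | move=> x y];
  rewrite PM.gempty.
Qed.

(** * Paths and cycles meeting a vertex set with few exits *)

Section SinglePass.

Variables (G : eqType) (e : rel G) (U : pred G) (ports : seq G).
Hypotheses (e_sym : symmetric e) (ports3 : size ports <= 3)
  (exitP : forall x y, U x -> ~~ U y -> e x y -> x \in ports)
  (exit_inj : forall x y y', U x -> ~~ U y -> ~~ U y' ->
     e x y -> e x y' -> y = y')
  (entry_inj : forall x x' y, U x -> U x' -> ~~ U y ->
     e x y -> e x' y -> x = x').

(** The run enters and leaves through different vertices: if it had just one, the vertices before
    and after it would be outside neighbours of the same port and coincide by [exit_inj]. *)
Lemma first_run a s : path e a s -> uniq (a :: s) -> ~~ U a ->
  ~~ U (last a s) -> has U s ->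
  exists s1 x r y s2, [/\ s = s1 ++ (x :: r) ++ y :: s2, all U (x :: r),
    ~~ has U (a :: s1), ~~ U y /\ x != last x r &
    x \in ports /\ last x r \in ports].
Proof.
move=> pas us Ua Ul hU.
have [s1 [x [s' [es Ux Us1]]]] : exists s1 x s', [/\ s = s1 ++ x :: s', U x & ~~ has U s1].
  exists (take (find U s) s), (nth a s (find U s)), (drop (find U s).+1 s).
  rewrite -drop_nth -?has_find // cat_take_drop; split=> //; first exact: nth_find.
  by rewrite has_take_leq ?find_size // ltnn.
have [r [y [s2 [es' Ur Uy]]]] : exists r y s2, [/\ s' = r ++ y :: s2, all U r & ~~ U y].
  have hn : has (predC U) s'.
    rewrite has_predC; apply/negP => /allP h; move: Ul; rewrite es last_cat /=.
    have := mem_last x s'; rewrite inE => /orP[/eqP e1|/h ->] //.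
    by rewrite e1 Ux.
  exists (take (find (predC U) s') s'), (nth a s' (find (predC U) s')), (drop (find (predC U) s').+1 s').
  rewrite -drop_nth -?has_find // cat_take_drop; split=> //; last exact: (nth_find a hn).
  by rewrite -[all _ _]negbK -has_predC has_take_leq ?find_size // ltnn.
exists s1, x, r, y, s2; rewrite es es' /= in pas us *.
move: pas; rewrite cat_path /= => /and3P[p1 ex]; rewrite cat_path /= => /and3P[pr ey p2].
have Ul1 : ~~ U (last a s1).
  have: last a s1 \in a :: s1 by exact: mem_last.
  by rewrite inE => /orP[/eqP->//|h]; apply: contraNN Us1 => ?; apply/hasP; exists (last a s1).
have Ulr : U (last x r).
  have: last x r \in x :: r by exact: mem_last.
  by rewrite inE => /orP[/eqP->//|h]; exact: (allP Ur).
split=> //; first by rewrite Ux.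
- by rewrite negb_or Ua.
- split=> //; apply/negP => /eqP xl.
  have yl : last a s1 = y.
    by apply: (exit_inj Ux Ul1 Uy); [rewrite e_sym | rewrite [X in e X _]xl].
  move: us => /andP[ni]; rewrite cat_uniq => /and3P[_ /hasPn h _].
  have ys : y \in x :: r ++ y :: s2 by rewrite inE mem_cat mem_head !orbT.
  have : last a s1 \in a :: s1 by exact: mem_last.
  rewrite yl inE => /orP[/eqP ya|ys1]; last by have /negP := h _ ys; apply.
  by move: ni; rewrite -ya mem_cat ys orbT.
- by split; [apply: (exitP Ux Ul1); rewrite e_sym | apply: exitP ey].
Qed.

(** A second run would bring the number of distinct end vertices to four, all of them among at most
    three ports. *)
Lemma single_pass a s : path e a s -> uniq (a :: s) -> ~~ U a ->
  ~~ U (last a s) ->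
  exists s1 r s2, [/\ s = s1 ++ r ++ s2, all U r, ~~ has U (a :: s1),
    ~~ has U s2 & r != [::] ->
    [/\ head a r \in ports, last a r \in ports & head a r != last a r]].
Proof.
move=> pas us Ua Ul; have [hU|nU] := boolP (has U s); last first.
  by exists s, [::], [::]; rewrite /= cats0 negb_or Ua.
have [s1 [x [r [y [s2 [es Ur Us1 [Uy nx] [px pl]]]]]]] := first_run pas us Ua Ul hU.
exists s1, (x :: r), (y :: s2); split=> //=; rewrite negb_or Uy /=.
apply/negP => hU2.
have es3 : a :: s = (a :: s1) ++ (x :: r) ++ y :: s2 by rewrite es.
have pys : path e y s2.
  by move: pas; rewrite es cat_path /= => /and3P[_ _]; rewrite cat_path /= => /and3P[].
have us2 : uniq (y :: s2) by move: us; rewrite es3 !cat_uniq => /and3P[_ _ /and3P[]].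
have Ul2 : ~~ U (last y s2) by move: Ul; rewrite es /= !last_cat /= last_cat.
have [s3 [x' [r' [y' [s4 [es2 Ur' _ [_ nx'] [px' pl']]]]]]] := first_run pys us2 Uy Ul2 hU2.
have xin : x \in x :: r by rewrite mem_head.
have lin : last x r \in x :: r by exact: mem_last.
have xin' : x' \in y :: s2 by rewrite es2 inE !mem_cat mem_head !orbT.
have lin' : last x' r' \in y :: s2.
  by rewrite es2 inE !mem_cat mem_last !orbT.
have dis z z' : z \in x :: r -> z' \in y :: s2 -> z != z'.
  move=> zr z's; apply/negP => /eqP zz'; move: us; rewrite es3 catA cat_uniq.
  case/and3P=> _ /hasPn /(_ _ z's) /negP h _; apply: h.
  by rewrite mem_cat -zz' zr orbT.
have u4 : uniq [:: x; last x r; x'; last x' r'].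
  by rewrite /= !inE !negb_or nx nx' !dis.
have s4p : {subset [:: x; last x r; x'; last x' r'] <= ports}.
  by move=> z; rewrite !inE => /or4P[] /eqP->.
by have := leq_trans (uniq_leq_size u4 s4p) ports3.
Qed.

Lemma cycle_single_pass c : cycle e c -> uniq c -> 2 < size c -> has U c ->
  ~~ all U c ->
  exists k r s, [/\ rot k c = r ++ s, all U r, ~~ has U s &
    exists x y, [/\ r = x :: behead r, last x r = y, x \in ports, y \in ports & x != y]].
Proof.
move=> cc uc sc hU nA.
have [a ac Ua] : exists2 a, a \in c & ~~ U a by apply/allPn.
(* The cycle is to be opened between two consecutive outside vertices. If both neighbours of [a]
   were inside, [entry_inj] would identify them. *)
have [b [bc Ub Up]] : exists b, [/\ b \in c, ~~ U b & ~~ U (prev c b)].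
  have [Up|Up] := boolP (U (prev c a)); last by exists a.
  have [Un|Un] := boolP (U (next c a)); last first.
    by exists (next c a); rewrite mem_next prev_next.
  have e1 : e (prev c a) a by apply: prev_cycle.
  have e2 : e (next c a) a by rewrite e_sym; apply: next_cycle.
  have := entry_inj Up Un Ua e1 e2 => pn.
  have := next_neq_prev uc sc ac.
  by rewrite pn eqxx.
have [i c' ec] := rot_to bc.
have pc' : path e b c'.
  by move: cc; rewrite -(rot_cycle i) ec /= rcons_path => /andP[].
have uc' : uniq (b :: c') by rewrite -ec rot_uniq.
have lc' : last b c' = prev c b.
  rewrite -(prev_rot i) // ec prev_nth mem_head /= memNindex ?nth_last //.
  by case/andP: uc'.
have [s1 [r [s2 [es Ur Us1 Us2 hr]]]] := single_pass pc' uc' Ub (ltac:(by rewrite lc')).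
have r0 : r != [::].
  apply/negP => /eqP r0; move: hU; rewrite -(has_rot i) ec es r0 -cat_cons has_cat.
  by rewrite (negbTE Us1) (negbTE Us2).
have [h1 h2 h3] := hr r0.
exists (rot_add c i (size (b :: s1))), r, (s2 ++ b :: s1).
rewrite -rot_rot_add ec es -cat_cons rot_size_cat -catA; split=> //.
  by rewrite has_cat negb_or Us2.
by case: r r0 Ur h1 h2 h3 {es hr} => // x r _ _ h1 h2 h3; exists x, (last x r).
Qed.

End SinglePass.

(** * Block sequences without immediate repetitions *)

Section Squash.

Variable B : eqType.

Fixpoint squash (b : seq B) : seq B :=
  if b is x :: b' then
    if b' is y :: _ then if x == y then squash b' else x :: squash b' else [:: x]
  else [::].

Lemma mem_squash b : squash b =i b.
Proof.
elim: b => //= x [|y b] // IH z; case: eqP => [->|_]; last by rewrite !inE IH inE.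
by rewrite IH !inE; case: eqP.
Qed.

Lemma squash_cons x b : exists b', squash (x :: b) = x :: b'.
Proof.
elim: b x => [|y b IH] x /=; first by exists [::].
case: eqP => [->|_]; first by have [b' e] := IH y; exists b'.
by eexists.
Qed.

Lemma last_squash x b : last x (squash b) = last x b.
Proof.
elim: b x => //= z [|y b] // IH x.
case: eqP => [_|_] /=; rewrite ?(IH x) ?(IH z) //.
Qed.

Lemma squash_path (r : rel B) x b :
  path (fun u v => (u == v) || r u v) x b -> sorted r (squash (x :: b)).
Proof.
elim: b x => //= y b IH x /andP[xy /IH h].
case: eqP xy => [_ _|_ /= xy] //.
have [b' eb] := squash_cons y b; rewrite -/(squash (y :: b)) eb in h *.
by rewrite /= xy.
Qed.

Definition contiguous (u : B) (b : seq B) : Prop :=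
  exists b1 r b2, [/\ b = b1 ++ r ++ b2, all (pred1 u) r, u \notin b1 & u \notin b2].

Lemma squash_uniq b : (forall u, contiguous u b) -> uniq (squash b).
Proof.
elim: b => //= x [|y b] // IH hc.
have hc' u : contiguous u (y :: b).
  have [[|z b1] [[|z' r] [b2 [e hr h1 h2]]]] := hc u; move: e => /= [].
  - by move=> e; exists [::], [::], (y :: b); split=> //; move: h2; rewrite -e inE negb_or => /andP[].
  - by move=> _ e; exists [::], r, b2; split=> //; case/andP: hr.
  - by move=> _ e; exists b1, [::], b2; split=> //; move: h1; rewrite inE negb_or => /andP[].
  - by move=> _ e; exists b1, (z' :: r), b2; split=> //; move: h1; rewrite inE negb_or => /andP[].
case: eqP => [_|/eqP xy]; first exact: IH.
rewrite [uniq _]/= -/(squash (y :: b)) IH // andbT mem_squash.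
have [[|z b1] [[|z' r] [b2 [e hr h1 h2]]]] := hc x; move: e => /= [].
- by move=> e; move: h2; rewrite -e mem_head.
- move=> _ e; case: r e hr => [/= e _|w r /= [ew _] /and3P[_ /eqP yx _]]; last by rewrite ew yx eqxx in xy.
  by rewrite e.
- by move=> xz; move: h1; rewrite inE xz eqxx.
- by move=> xz; move: h1; rewrite inE xz eqxx.
Qed.

End Squash.

(** * Replacing the vertices of a cubic graph by a piece *)

Section Embedded.

Variables (G : eqType) (e : rel G) (Q : finType) (adjQ : rel Q) (term : 'I_3 -> Q)
  (f : Q -> G).

(* [f] places a copy of the piece in [e] so that the edges leaving the copy form
   a matching of its terminals. *)
Definition embedded : Prop :=
  [/\ injective f /\ forall x y, e (f x) (f y) = adjQ x y,
      forall x y, y \notin codom f -> e (f x) y -> x \in codom term,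
      forall x y y', y \notin codom f -> y' \notin codom f ->
        e (f x) y -> e (f x) y' -> y = y' &
      forall x x' y, y \notin codom f -> e (f x) y -> e (f x') y -> x = x'].

Definition pass_bound (t : nat) : Prop := forall a s, path adjQ a s ->
  uniq (a :: s) -> a \in codom term -> last a s \in codom term ->
  a != last a s -> size (a :: s) <= t.

Hypotheses (e_sym : symmetric e) (emb : embedded).

Definition ports : seq G := [seq f (term i) | i <- enum 'I_3].

Lemma embedded_exits : [/\ size ports <= 3,
  forall x y, x \in codom f -> y \notin codom f -> e x y -> x \in ports,
  forall x y y', x \in codom f -> y \notin codom f -> y' \notin codom f ->
    e x y -> e x y' -> y = y' &
  forall x x' y, x \in codom f -> x' \in codom f -> y \notin codom f ->
    e x y -> e x' y -> x = x'].
Proof.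
case: emb => _ e1 e2 e3; split; first by rewrite size_map size_enum_ord.
- move=> x y /codomP[q ->] yn /(e1 _ _ yn) /codomP[i ->].
  by apply/mapP; exists i; rewrite ?mem_enum.
- by move=> x y y' /codomP[q ->]; exact: e2.
- by move=> x x' y /codomP[q ->] /codomP[q' ->] yn h h'; rewrite (e3 _ _ _ yn h h').
Qed.

Lemma codom_seq (r : seq G) : all (mem (codom f)) r -> exists r', r = [seq f x | x <- r'].
Proof.
elim: r => [|x r IH] /=; first by exists [::].
by case/andP=> /codomP[q ->] /IH[r' ->]; exists (q :: r').
Qed.

Lemma embedded_pass a s : path e a s -> uniq (a :: s) ->
  a \notin codom f -> last a s \notin codom f ->
  exists s1 r s2, [/\ s = s1 ++ [seq f x | x <- r] ++ s2,
    ~~ has (mem (codom f)) (a :: s1), ~~ has (mem (codom f)) s2 &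
    if r is x :: r' then [/\ path adjQ x r', uniq r, x \in codom term,
      last x r' \in codom term & x != last x r'] else True].
Proof.
case: (emb) => [[fI ef] _ _ _] pas us ha hl; have [p3 c1 c2 _] := embedded_exits.
have [s1 [r [s2 [es Ur U1 U2 hr]]]] := single_pass e_sym p3 c1 c2 pas us ha hl.
have [r' er] := codom_seq Ur.
exists s1, r', s2; rewrite -er; split=> //.
case: r' er => // x r' /= er.
have [] := hr (ltac:(by rewrite er)); rewrite er /= last_map.
have inj i : f i \in ports -> i \in codom term.
  by case/mapP=> j _ /fI ->; exact: codom_f.
move=> /inj h1 /inj h2; rewrite (inj_eq fI) => h3; split=> //.
  move: pas; rewrite es cat_path er /= => /and3P[_ _]; rewrite cat_path => /andP[].
  by rewrite path_map => + _; apply: sub_path => p q /=; rewrite ef.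
have : uniq [seq f q | q <- x :: r'].
  by move: us; rewrite es er cons_uniq !cat_uniq => /andP[_ /and3P[_ _ /and3P[+ _ _]]].
exact: map_uniq.
Qed.

Lemma embedded_count t a s : pass_bound t -> path e a s -> uniq (a :: s) ->
  a \notin codom f -> last a s \notin codom f ->
  count (mem (codom f)) (a :: s) <= t.
Proof.
move=> ht pas us ha hl.
have [s1 [r [s2 [es U1 U2 hr]]]] := embedded_pass pas us ha hl.
rewrite es -cat_cons !count_cat; move: U1 U2; rewrite !has_count -!eqn0Ngt.
move=> /eqP -> /eqP ->; rewrite addn0 add0n (leq_trans (count_size _ _)) // size_map.
by case: r hr {es} => // x r [] *; apply: ht.
Qed.

End Embedded.

Lemma size_sum_count (T : finType) (l : seq T) :
  size l = \sum_(u : T) count_mem u l.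
Proof.
elim: l => /= [|x l ->]; first by rewrite big1.
rewrite big_split /= -add1n; congr (_ + _).
by rewrite (bigD1 x) //= eqxx big1 // => u; rewrite eq_sym => /negbTE ->.
Qed.

Section Composite.

Variables (B Q : finType) (adjQ : rel Q) (term : 'I_3 -> Q)
  (nxt : B * 'I_3 -> option (B * 'I_3)) (ext : 'I_3 -> B * 'I_3).

(** A pair [(u, i)] is port [i] of block [u], also called a dart. The partial involution [nxt]
    matches the ports along the edges of the base graph; a port sent to [None] is open, and [ext]
    lists the open ports when the composite serves as a piece. *)
Definition cadj (x y : B * Q) : bool :=
  (x.1 == y.1) && adjQ x.2 y.2 ||
  [exists i, exists j, [&& nxt (x.1, i) == Some (y.1, j), x.2 == term i & y.2 == term j]].

Definition cterm (k : 'I_3) : B * Q := ((ext k).1, term (ext k).2).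

Hypotheses (adjQ_sym : symmetric adjQ) (term_inj : injective term)
  (nxt_sym : forall d d', nxt d = Some d' -> nxt d' = Some d)
  (nxt_neq : forall d d', nxt d = Some d' -> d.1 != d'.1).

Lemma linkP x y : reflect (exists i j, [/\ nxt (x.1, i) = Some (y.1, j), x.2 = term i & y.2 = term j])
  [exists i, exists j, [&& nxt (x.1, i) == Some (y.1, j), x.2 == term i & y.2 == term j]].
Proof.
apply: (iffP existsP) => [[i /existsP[j /and3P[/eqP h1 /eqP h2 /eqP h3]]]|[i [j [h1 h2 h3]]]].
  by exists i, j.
by exists i; apply/existsP; exists j; rewrite h1 h2 h3 !eqxx.
Qed.

Lemma cadj_sym : symmetric cadj.
Proof.
move=> x y; rewrite /cadj eq_sym adjQ_sym; congr (_ || _).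
by apply/linkP/linkP => [] [i [j [/nxt_sym h1 h2 h3]]]; exists j, i.
Qed.

Lemma cadj_irr : irreflexive adjQ -> irreflexive cadj.
Proof.
move=> h x; rewrite /cadj h andbF orFb; apply/linkP => -[i [j [/nxt_neq]]].
by rewrite eqxx.
Qed.

Lemma cadj_in u x y : cadj (u, x) (u, y) = adjQ x y.
Proof.
rewrite /cadj eqxx andTb; case: (linkP (u, x) (u, y)) => [[i [j [/nxt_neq]]]|_].
  by rewrite eqxx.
by rewrite orbF.
Qed.

Lemma cadj_out x y : x.1 != y.1 -> cadj x y ->
  exists i j, [/\ nxt (x.1, i) = Some (y.1, j), x.2 = term i & y.2 = term j].
Proof. by rewrite /cadj => /negbTE -> /linkP. Qed.

Lemma codom_pair (u : B) (y : B * Q) : (y \in codom (pair u)) = (y.1 == u).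
Proof.
apply/codomP/eqP => [[q ->] //|<-]; by exists y.2; case: y.
Qed.

Lemma pair_embedded u : embedded cadj adjQ term (pair u).
Proof.
split.
- by split=> [x y []|x y]; rewrite ?cadj_in.
- move=> x y; rewrite codom_pair eq_sym => uy /cadj_out -/(_ uy)[i [j [_ /= -> _]]].
  exact: codom_f.
- move=> x y y'; rewrite !codom_pair !(eq_sym _ u) => uy uy' /cadj_out -/(_ uy)[i [j [h1 h2 h3]]].
  move=> /cadj_out -/(_ uy')[i' [j' [h1' h2' h3']]].
  have ii : i = i' by apply: term_inj; rewrite -h2 -h2'.
  move: h1; rewrite ii h1' => -[e1 e2].
  by case: y y' e1 h3 h3' {h1' uy uy'} => ? ? [? ?] /= -> -> ->; rewrite e2.
- move=> x x' y; rewrite codom_pair eq_sym => uy /cadj_out -/(_ uy)[i [j [h1 h2 h3]]].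
  move=> /cadj_out -/(_ uy)[i' [j' [h1' h2' h3']]].
  have jj : j = j' by apply: term_inj; rewrite -h3 -h3'.
  move: (nxt_sym h1) (nxt_sym h1'); rewrite jj => -> [ii].
  by rewrite /= in h2 h2'; rewrite h2 h2' ii.
Qed.

Hypothesis ext_None : forall k, nxt (ext k) = None.

(** An edge leaving the block is a link of the composite or leaves the composite through an open
    port. No terminal has edges of both kinds, as [nxt] is [None] at [ext k], so the edges out of
    the block still form a matching. *)
Lemma embedded_block (G : eqType) (e : rel G) (g : B * Q -> G) u :
  embedded e cadj cterm g -> embedded e adjQ term (fun q => g (u, q)).
Proof.
case=> [[gI eg] e1 e2 e3].
have cg y : (y \in codom g) -> exists w q, y = g (w, q).
  by case/codomP=> -[w q] ->; exists w, q.
have nblk w q : g (w, q) \notin codom (fun q => g (u, q)) -> u != w.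
  by apply: contraNneq => ->; apply/codomP; exists q.
have ng y : y \notin codom g -> forall q, e (g (u, q)) y -> exists2 k, ext k = (u, (ext k).2) & q = term (ext k).2.
  move=> yn q /(e1 _ _ yn) /codomP[k]; rewrite /cterm => -[eu ->].
  by exists k => //; rewrite eu -surjective_pairing.
split.
- by split=> [x y /gI[]|x y] //; rewrite eg cadj_in.
- move=> x y yn h; have [/cg[w [q ey]]|yg] := boolP (y \in codom g).
    move: yn h; rewrite ey => /nblk uw; rewrite eg => /cadj_out -/(_ uw)[i [j [_ /= -> _]]].
    exact: codom_f.
  by have [k _ ->] := ng _ yg _ h; exact: codom_f.
- move=> x y y' yn yn' h h'.
  have [/cg[w [q ey]]|yg] := boolP (y \in codom g); have [/cg[w' [q' ey']]|yg'] := boolP (y' \in codom g).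
  + move: yn h yn' h'; rewrite ey ey' => /nblk uw + /nblk uw'; rewrite !eg.
    case: (pair_embedded u) => _ _ h _ c1 c2; congr g.
    by apply: h c1 c2; rewrite codom_pair eq_sym.
  + move: yn h; rewrite ey => /nblk uw; rewrite eg => /cadj_out -/(_ uw)[i [j [/= h1 h2 _]]].
    have [k ek ex] := ng _ yg' _ h'.
    by have := ext_None k; rewrite ek -(term_inj (etrans (esym h2) ex)) h1.
  + move: yn' h'; rewrite ey' => /nblk uw; rewrite eg => /cadj_out -/(_ uw)[i [j [/= h1 h2 _]]].
    have [k ek ex] := ng _ yg _ h.
    by have := ext_None k; rewrite ek -(term_inj (etrans (esym h2) ex)) h1.
  + exact: (e2 (u, x)).
- move=> x x' y yn h h'; have [/cg[w [q ey]]|yg] := boolP (y \in codom g).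
    move: yn h h'; rewrite ey => /nblk uw; rewrite !eg.
    case: (pair_embedded u) => _ _ _ h c1 c2; apply: h c1 c2.
    by rewrite codom_pair eq_sym.
  by have [] := e3 _ _ _ yg h h'.
Qed.

Definition blink (u w : B) : bool := [exists i, exists j, nxt (u, i) == Some (w, j)].

(** For a base graph with a deleted vertex, and open ports where its edges were, this expresses that
    the undeleted graph is nonhamiltonian. *)
Definition no_spanning_pass : Prop := forall i j b bs, i != j ->
  b = (ext i).1 -> last b bs = (ext j).1 -> path blink b bs ->
  uniq (b :: bs) -> size (b :: bs) != #|B|.

(* Pendant vertices at the terminals turn a pass into a path that starts and ends
   outside. *)
Let padj (x y : B * Q + 'I_3) : bool :=
  match x, y with
  | inl x, inl y => cadj x y
  | inl x, inr k => x == cterm k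
  | inr k, inl x => x == cterm k
  | inr _, inr _ => false
  end.

Hypothesis ext_inj : injective ext.

Lemma cterm_inj : injective cterm.
Proof.
move=> k k' [e1 /term_inj e2]; apply: ext_inj.
by case: (ext k) (ext k') e1 e2 => ? ? [? ?] /= -> ->.
Qed.

Lemma padj_embedded : embedded padj cadj cterm inl.
Proof.
have ni (z : B * Q) : (inl z : B * Q + 'I_3) \in codom inl by exact: codom_f.
split.
- by split=> // x y [].
- move=> x [y|k] /=; first by rewrite ni.
  by move=> _ /eqP ->; exact: codom_f.
- move=> x [y|k] [y'|k'] //=; rewrite ?ni // => _ _ /eqP -> /eqP.
  by move/cterm_inj => ->.
- by move=> x x' [y|k] /=; rewrite ?ni // => _ /eqP -> /eqP ->.
Qed.

(** Since each block is passed once, the sequence of blocks is a path of the base between two exits,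
    hence misses a block; the others contribute at most [t] each. *)
Lemma cadj_pass_bound t : pass_bound adjQ term t -> no_spanning_pass ->
  pass_bound cadj cterm (#|B|.-1 * t).
Proof.
move=> ht hB x s pxs us /codomP[i ex] /codomP[j el] xl.
have ij : i != j by apply: contraNneq xl => ij; rewrite el ex ij.
pose s' : seq (B * Q + 'I_3) := rcons [seq inl z | z <- x :: s] (inr j).
have ps' : path padj (inr i) s'.
  rewrite rcons_path /= ex eqxx /= path_map last_map -ex el /= eqxx andbT.
  by apply: sub_path pxs.
have us' : uniq (inr i :: s').
  rewrite cons_uniq mem_rcons inE rcons_uniq (map_inj_uniq (@inl_inj _ _)) us !andbT.
  rewrite (inj_eq (@inr_inj _ _)) negb_or ij /=.
  by apply/andP; split; apply/mapP => -[].
have padj_sym : symmetric padj by move=> [a|a] [b|b] //=; exact: cadj_sym.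
have nin u k : (inr k : B * Q + 'I_3) \notin codom (fun q => inl (u, q)).
  by apply/codomP => -[].
have ls' : last (inr i) s' = inr j by rewrite last_rcons.
have pass u := embedded_pass padj_sym (embedded_block u padj_embedded) ps' us' (nin u i) (ltac:(rewrite ls'; exact: nin)).
have cnt u : count (fun z : B * Q => z.1 == u) (x :: s) <= t.
  have := embedded_count padj_sym (embedded_block u padj_embedded) ht ps' us' (nin u i) (ltac:(rewrite ls'; exact: nin)).
  move=> h; apply: leq_trans h; rewrite -[inr i :: s']/([:: inr i] ++ s') /s' -cats1 !count_cat addnCA.
  apply: leq_trans (leq_addr _ _); rewrite -/([seq inl z | z <- x :: s]).
  elim: (x :: s) => //= -[w q] l IH; apply: leq_add IH.
  by case: eqP => //= ->; rewrite codom_f.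
pose pr (z : B * Q + 'I_3) : option B := if z is inl y then Some y.1 else None.
have ctg u : contiguous u [seq z.1 | z <- x :: s].
  have [s1 [r [s2 [es n1 n2 _]]]] := pass u.
  exists (pmap pr s1), (pmap pr [seq inl (u, q) | q <- r]), (pmap pr s2); split.
  - rewrite -!pmap_cat -es /s' -cats1 pmap_cat cats0.
    by elim: (x :: s) => //= z l <-.
  - by elim: (r) => //= q l ->; rewrite eqxx.
  - apply/negP; rewrite mem_pmap => /mapP[[[w q]|k] hz //= [ew]].
    move: n1; rewrite /= negb_or => /andP[_ /hasPn /(_ _ hz) /negP]; apply.
    by rewrite ew; exact: codom_f.
  - apply/negP; rewrite mem_pmap => /mapP[[[w q]|k] hz //= [ew]].
    by move/hasPn: n2 => /(_ _ hz) /negP; apply; rewrite ew; exact: codom_f.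
have [bs ebs] := squash_cons x.1 [seq z.1 | z <- s].
have ub : uniq (x.1 :: bs) by rewrite -ebs; apply: squash_uniq.
have pb : path blink x.1 bs.
  suff : sorted blink (x.1 :: bs) by [].
  rewrite -ebs; apply: squash_path; rewrite path_map; apply: sub_path pxs => y z /=.
  rewrite /cadj; case: eqP => //= _ /linkP[k [l [h _ _]]].
  by apply/existsP; exists k; apply/existsP; exists l; rewrite h.
have lb : last x.1 bs = (ext j).1.
  have := last_squash x.1 (x.1 :: [seq z.1 | z <- s]); rewrite ebs /= last_map => ->.
  by rewrite el.
have xi : x.1 = (ext i).1 by rewrite ex.
have nb := hB _ _ _ _ ij xi lb pb ub.
have [u0 u0n] : exists u0, u0 \notin x.1 :: bs.
  apply/existsP; rewrite -negb_forall; apply: contra nb => /forallP h.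
  by rewrite -(card_uniqP ub); apply/eqP/eq_card => u; rewrite h.
rewrite -(size_map (fun z => z.1)) size_sum_count (bigD1 u0) //.
have -> : count_mem u0 [seq z.1 | z <- x :: s] = 0.
  by apply/count_memPn; rewrite -(mem_squash (x.1 :: _)) ebs.
rewrite Monoid.mul1m -(cardC1 u0) -sum_nat_const; apply: leq_sum => u _; have := cnt u.
by rewrite -(count_map (fun z => z.1) (pred1 u)).
Qed.

End Composite.

Section EmbeddedBounds.

Variables (G : eqType) (e : rel G) (Q : finType) (adjQ : rel Q) (term : 'I_3 -> Q)
  (f : Q -> G) (t : nat).
Hypotheses (e_sym : symmetric e) (emb : embedded e adjQ term f)
  (ht : pass_bound adjQ term t).

Lemma count_codom_card c : uniq c -> count (mem (codom f)) c <= #|Q|.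
Proof.
move=> uc; rewrite -size_filter -(size_codom f).
apply: uniq_leq_size; first exact: filter_uniq.
by move=> x; rewrite mem_filter => /andP[].
Qed.

(** A block containing an end of the path need not be passed just once, but it has at most one
    vertex more than the bound [t], and the end pays for that vertex. *)
Lemma embedded_ends a s : #|Q| <= t.+1 -> path e a s -> uniq (a :: s) ->
  count (mem (codom f)) (a :: s) <= t + count (mem (codom f)) [:: a; last a s].
Proof.
move=> Qt pas us; set ends := [:: a; last a s].
have [/hasP he|/hasPn he] := boolP (has (mem (codom f)) ends).
  apply: leq_trans (leq_trans (count_codom_card us) Qt) _.
  by rewrite -addn1 leq_add2l -has_count; apply/hasP.
have ha : a \notin codom f by apply: he; rewrite mem_head.
have hl : last a s \notin codom f by apply: he; rewrite !inE eqxx orbT.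
exact: leq_trans (embedded_count e_sym emb ht pas us ha hl) (leq_addr _ _).
Qed.

Lemma embedded_cycle c : cycle e c -> uniq c -> 2 < size c ->
  has (mem (codom f)) c -> ~~ all (mem (codom f)) c ->
  exists k x r s, [/\ rot k c = [seq f z | z <- x :: r] ++ s,
    ~~ has (mem (codom f)) s, x != last x r & size (x :: r) <= t].
Proof.
move=> cc uc sc hc nc; case: (emb) => [[fI ef] _ _ _]; have [p3 c1 c2 c3] := embedded_exits emb.
have [k [r [s [er Ur Us [x [y [ex ey px py xy]]]]]]] :=
  cycle_single_pass e_sym p3 c1 c2 c3 cc uc sc hc nc.
have [r' er'] := codom_seq Ur.
have urc : uniq (rot k c) by rewrite rot_uniq.
have crc : cycle e (rot k c) by rewrite rot_cycle.
case: r' er' => [|z r'] er'; first by rewrite er' in ex.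
have inj i : f i \in ports term f -> i \in codom term.
  by case/mapP=> j _ /fI ->; exact: codom_f.
move: ex px ey py xy; rewrite er' /= => -[<-] /inj hz; rewrite last_map => <- /inj hl.
rewrite (inj_eq fI) => zl.
exists k, z, r', s; split; [by rewrite er er' | exact: Us | exact: zl |].
apply: ht => //.
- move: crc; rewrite er er' /= rcons_cat cat_path => /andP[+ _].
  by rewrite path_map; apply: sub_path => p q /=; rewrite ef.
- by move: urc; rewrite er er' cat_uniq => /andP[/map_uniq].
- exact: hz.
- exact: hl.
- exact: zl.
Qed.

End EmbeddedBounds.

Section CycleBound.

Variables (B B' Q : finType) (adjQ : rel Q) (term : 'I_3 -> Q)
  (nxt : B * 'I_3 -> option (B * 'I_3)) (ext : 'I_3 -> B * 'I_3)
  (nxt' : B' * 'I_3 -> option (B' * 'I_3)) (v : B') (g : B * Q -> B' * Q) (t : nat).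
Hypotheses (adjQ_sym : symmetric adjQ) (term_inj : injective term)
  (nxt'_sym : forall d d', nxt' d = Some d' -> nxt' d' = Some d)
  (nxt'_neq : forall d d', nxt' d = Some d' -> d.1 != d'.1)
  (ht : pass_bound adjQ term t)
  (hR : pass_bound (cadj adjQ term nxt) (cterm term ext) (#|B|.-1 * t))
  (gemb : embedded (cadj adjQ term nxt') (cadj adjQ term nxt) (cterm term ext) g)
  (codom_g : forall x, (x \in codom g) = (x.1 != v))
  (cardB' : #|B'| = #|B|.+1) (Qt : #|Q| <= #|B| * t) (B0 : 0 < #|B|).

(** Three cases: the cycle stays in one block; it misses block [v], which leaves [#|B|] blocks with
    one pass each; or it passes [v] once and the remainder is a pass of the composite piece, bounded
    by [hR]. *)
Lemma cycle_bound c : cycle (cadj adjQ term nxt') c -> uniq c -> 2 < size c ->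
  size c <= #|B| * t.
Proof.
move=> cc uc sc; have e_sym := cadj_sym term adjQ_sym nxt'_sym.
have emb u := pair_embedded adjQ term_inj nxt'_sym nxt'_neq u.
have cod u : codom (pair u) =i [pred x : B' * Q | x.1 == u].
  by move=> x; rewrite codom_pair.
have [/existsP[u /allP hu]|/existsPn hn] := boolP [exists u, all (fun x : B' * Q => x.1 == u) c].
  apply: leq_trans Qt; rewrite -(size_codom (pair u)); apply: uniq_leq_size => // x /hu.
  by rewrite codom_pair.
have nall u : ~~ all (mem (codom (pair u))) c.
  by have := hn u; apply: contra => /allP h; apply/allP => x /h /=; rewrite codom_pair.
have cnt u : count (fun x : B' * Q => x.1 == u) c <= t.
  rewrite (eq_count (a2 := mem (codom (@pair B' Q u)))) => [|x]; last by rewrite /= codom_pair.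
  have [hh|] := boolP (has (mem (codom (pair u))) c); last by rewrite has_count -eqn0Ngt => /eqP ->.
  have [k [x [r [s [er ns _ sr]]]]] := embedded_cycle e_sym (emb u) ht cc uc sc hh (nall u).
  rewrite -(permP (permEl (perm_rot k c))) er count_cat; move: ns; rewrite has_count -eqn0Ngt => /eqP ->.
  by rewrite addn0 (leq_trans (count_size _ _)) // size_map.
have [hv|nv] := boolP (has (mem (codom (pair v))) c); last first.
  rewrite -(size_map (fun z => z.1)) size_sum_count (bigD1 v) //.
  have -> : count_mem v [seq z.1 | z <- c] = 0.
    apply/count_memPn; apply: contra nv => /mapP[x xc xv]; apply/hasP; exists x => //=.
    by rewrite codom_pair -xv.
  rewrite Monoid.mul1m; have -> : #|B| = #|predC1 v| by rewrite cardC1 cardB'.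
  rewrite -sum_nat_const; apply: leq_sum => u _; have := cnt u.
  by rewrite -(count_map (fun z => z.1) (pred1 u)).
have [k [x [r [s [er ns xr sr]]]]] := embedded_cycle e_sym (emb v) ht cc uc sc hv (nall v).
have [s' es] : exists s', s = [seq g z | z <- s'].
  apply: codom_seq; apply/allP => z zs.
  by move/hasPn: ns => /(_ z zs) /=; rewrite codom_pair codom_g.
rewrite -(size_rot k) er es size_cat !size_map.
have -> : #|B| * t = t + #|B|.-1 * t by rewrite -mulSn prednK.
apply: leq_add => //; case: s' es => // y s' es.
have urc : uniq (rot k c) by rewrite rot_uniq.
have crc : cycle (cadj adjQ term nxt') (rot k c) by rewrite rot_cycle.
move: urc crc; rewrite er es cat_uniq => /and3P[ur _ us].
rewrite /= rcons_cat cat_path /= rcons_path !last_map => /and4P[_ exy pys eyx].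
case: (gemb) => [[gI eg] e1 e2 e3].
have nv0 z : (v, z) \notin codom g by rewrite codom_g eqxx.
rewrite -[(size s').+1]/(size (y :: s')); apply: hR.
- by move: pys; rewrite path_map; apply: sub_path => p q /=; rewrite eg.
- exact: map_uniq us.
- by apply: (e1 _ (v, last x r)); rewrite ?nv0 // e_sym.
- exact: (e1 _ _ (nv0 _) eyx).
(* A remainder with equal ends would have edges to two vertices of block [v], against the matching
   condition. *)
- apply/negP => /eqP yl; have := e2 y (v, last x r) (v, x) (nv0 _) (nv0 _).
  rewrite e_sym exy; move: eyx; rewrite -yl => -> /(_ isT isT) [xl].
  by rewrite xl eqxx in xr.
Qed.

End CycleBound.

Section PathBound.

Variables (K P : finType) (adjP : rel P) (term : 'I_3 -> P)
  (nxt : K * 'I_3 -> option (K * 'I_3)) (t D : nat).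
Hypotheses (adjP_sym : symmetric adjP) (term_inj : injective term)
  (nxt_sym : forall d d', nxt d = Some d' -> nxt d' = Some d)
  (nxt_neq : forall d d', nxt d = Some d' -> d.1 != d'.1)
  (ht : pass_bound adjP term t).

Let e := cadj adjP term nxt.

(** A block without ends of the path is passed once. Any other block is charged [D + 1] for each end
    in it, and there are two ends. *)
Lemma path_bound a s : path e a s -> uniq (a :: s) ->
  (forall k, count (fun x => x.1 == k) (a :: s) <=
     t + D + count (fun x => x.1 == k) [:: a; last a s]) ->
  size (a :: s) <= #|K| * t + (D + 1).*2.
Proof.
move=> pas us hD; have e_sym := cadj_sym term adjP_sym nxt_sym.
pose ends k := count (fun x : K * P => x.1 == k) [:: a; last a s].
have cnt k : count (fun x => x.1 == k) (a :: s) <= t + (D + 1) * ends k.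
  case: (posnP (ends k)) => [e0|ep]; last first.
    by apply: leq_trans (hD k) _; rewrite -/(ends k) mulnDl mul1n -addnA leq_add2l leq_add2r leq_pmulr.
  rewrite e0 muln0 addn0 (eq_count (a2 := mem (codom (@pair K P k)))) => [|x]; last by rewrite /= codom_pair.
  move: e0 => /eqP; rewrite eqn0Ngt -has_count => /hasPn h.
  by apply: (embedded_count e_sym (pair_embedded adjP term_inj nxt_sym nxt_neq k) ht) => //;
    rewrite codom_pair; apply: h; rewrite !inE eqxx ?orbT.
have ends2 : \sum_(k : K) ends k = 2.
  rewrite -[RHS]/(size [:: a.1; (last a s).1]) size_sum_count.
  by apply: eq_bigr => k _; rewrite /ends /=.
rewrite -(size_map (fun z => z.1)) size_sum_count.
apply: (@leq_trans (\sum_(k : K) (t + (D + 1) * ends k))).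
  by apply: leq_sum => k _; rewrite count_map; exact: cnt.
by rewrite big_split /= sum_nat_const cardT -cardE -big_distrr /= ends2 muln2.
Qed.

End PathBound.

(** * Graphs given by edge lists *)

Definition erel (E : seq (nat * nat)) : rel nat :=
  fun x y => ((x, y) \in E) || ((y, x) \in E).

Lemma erel_sym E : symmetric (erel E).
Proof. by move=> x y; rewrite /erel orbC. Qed.

Definition kedges (E : seq (nat * nat)) : seq kedge :=
  [seq (Pos.of_succ_nat p.1, (Pos.of_succ_nat p.2.1, Pos.of_succ_nat p.2.2))
     | p <- zip (iota 0 (size E)) E].

(** [o] is the order in which the search picks vertices to branch at; any permutation of the
    vertices is sound. *)
Definition list_nonham (E : seq (nat * nat)) (o : seq nat) : bool :=
  nonham_check (kedges E) [seq Pos.of_succ_nat x | x <- o].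

Lemma list_nonhamP E o c : list_nonham E o -> perm_eq o c -> uniq c ->
  2 < size c -> ~ cycle (erel E) c.
Proof.
move=> h oc uc sc cc; have pI : injective Pos.of_succ_nat.
  exact: SuccNat2Pos.inj.
apply: (nonham_checkP (c := [seq Pos.of_succ_nat x | x <- c]) h).
- by rewrite map_inj_uniq.
- by rewrite size_map.
- exact: perm_map.
have -> : [seq t.2 | t <- kedges E] =
    [seq (Pos.of_succ_nat e.1, Pos.of_succ_nat e.2) | e <- E].
  rewrite /kedges -map_comp -[in RHS](@unzip2_zip _ _ (iota 0 (size E)) E).
    by rewrite -map_comp.
  by rewrite size_iota.
have ppI : injective (fun e : nat * nat => (Pos.of_succ_nat e.1, Pos.of_succ_nat e.2)).
  by move=> [a b] [a' b'] [/pI -> /pI ->].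
case: c cc {oc uc sc} => //= x c.
rewrite -map_rcons path_map; apply: sub_path => a b.
by rewrite /erel /= -!(mem_map ppI).
Qed.

(** The vertex [n], joined to both ends, would close a path through all smaller vertices to a
    Hamiltonian cycle. *)
Lemma list_nonham_path E o n l : list_nonham E o -> perm_eq o (iota 0 n.+1) ->
  1 < n -> uniq l -> size l = n -> all (fun x => x < n) l ->
  sorted (erel E) l -> erel E n (head n l) -> erel E n (last n l) -> False.
Proof.
move=> h po n1 ul sl ln pl hl ll; apply: (list_nonhamP (c := n :: l) h).
- apply: perm_trans po _; rewrite perm_sym.
  have nl : n \notin l by apply/negP => /(allP ln); rewrite ltnn.
  have un : uniq (n :: l) by rewrite /= nl.
  have sub : {subset n :: l <= iota 0 n.+1}.
    by move=> x; rewrite inE mem_iota => /predU1P[->|/(allP ln) /ltnW xn]; rewrite ?ltnSn ?ltnS.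
  have [_ eqi] := uniq_min_size un sub (ltac:(by rewrite size_iota /= sl)).
  by apply: uniq_perm => //; exact: iota_uniq.
- by rewrite /= ul andbT; apply/negP => /(allP ln); rewrite ltnn.
- by rewrite /= sl.
- case: l sl pl hl ll {ul ln} => [|x l] /= sl pl hl ll; first by rewrite -sl in n1.
  by rewrite hl rcons_path pl /= erel_sym.
Qed.

(** * Connectivity *)

Definition del (G : finType) (e : rel G) (X : {set G}) : rel G :=
  [rel u v | [&& u \notin X, v \notin X & e u v]].

Definition conn1 (G : finType) (e : rel G) : Prop :=
  forall p x y, x != p -> y != p -> connect (del e [set p]) x y.

(** Together with [conn1], this is what 3-connectedness leaves behind when a vertex joined to the
    three terminals is deleted. *)
Definition conn2_to (G : finType) (e : rel G) (term : 'I_3 -> G) : Prop :=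
  forall p q x, p != q -> x \notin [set p; q] ->
  exists2 k, term k \notin [set p; q] & connect (del e [set p; q]) x (term k).

Lemma del_sym (G : finType) (e : rel G) X : symmetric e -> symmetric (del e X).
Proof. by move=> es x y; rewrite /del /= es; case: (x \in X); case: (y \in X). Qed.

Lemma avoid2 (T : finType) (f : 'I_3 -> T) (p q : T) : injective f ->
  exists k, (f k != p) && (f k != q).
Proof.
move=> fI; apply/existsP; apply: contraT => /existsPn h.
have sub : codom f \subset [set p; q].
  apply/subsetP => x /codomP[k ->]; have := h k; rewrite negb_and !negbK !inE.
  by case/orP=> ->; rewrite ?orbT.
have := subset_leq_card sub; rewrite card_codom // card_ord.
by rewrite cards2; case: (p != q).
Qed.

Section CompositeConnectivity.

Variables (B Q : finType) (adjQ : rel Q) (term : 'I_3 -> Q)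
  (nxt : B * 'I_3 -> option (B * 'I_3)).
Hypotheses (adjQ_sym : symmetric adjQ) (term_inj : injective term)
  (nxt_sym : forall d d', nxt d = Some d' -> nxt d' = Some d)
  (nxt_neq : forall d d', nxt d = Some d' -> d.1 != d'.1)
  (Q1 : conn1 adjQ) (Q2 : conn2_to adjQ term).

(** Open ports of blocks in [X] count as leaving it, so that deleting a vertex of the base graph
    does not make cuts smaller. *)
Definition outset (X : {set B}) : {set B * 'I_3} :=
  [set d | (d.1 \in X) && (if nxt d is Some d' then d'.1 \notin X else true)].

Hypothesis cut3 : forall X : {set B}, X != set0 -> X != setT -> 3 <= #|outset X|.

Let e := cadj adjQ term nxt.
Let port (d : B * 'I_3) : B * Q := (d.1, term d.2).

Lemma port_inj : injective port.
Proof. by move=> [u i] [w j] [-> /term_inj ->]. Qed.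

Lemma e_sym : symmetric e. Proof. exact: cadj_sym. Qed.

Lemma connect_sym_del X : connect_sym (del e X).
Proof. by apply: sym_connect_sym; apply: del_sym; exact: e_sym. Qed.

Lemma port_link d d' : nxt d = Some d' -> e (port d) (port d').
Proof.
move=> h; rewrite /e /cadj /port /=; apply/orP; right.
by apply/existsP; exists d.2; apply/existsP; exists d'.2;
  rewrite -!surjective_pairing h !eqxx.
Qed.

Lemma block_connect (X : {set B * Q}) u x y (Y : {set Q}) :
  (forall q, ((u, q) \in X) -> q \in Y) ->
  connect (del adjQ Y) x y -> connect (del e X) (u, x) (u, y).
Proof.
move=> XY /connectP[p pp ->]; elim: p x pp => //= z p IH x /andP[/and3P[xY zY xz] pp].
apply: connect_trans (IH _ pp); apply: connect1.
by rewrite /del /= /e cadj_in // xz andbT; apply/andP; split; [apply: contra xY | apply: contra zY] => /XY.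
Qed.

Lemma block_connect0 (X : {set B * Q}) u x y : (forall q, (u, q) \notin X) ->
  connect (del e X) (u, x) (u, y).
Proof.
(* [conn1] speaks of a piece with one vertex deleted, so a terminal other than both ends is
   sacrificed. *)
move=> h; have [k /andP[kx ky]] := avoid2 x y term_inj.
apply: (block_connect (Y := [set term k])); first by move=> q; rewrite (negbTE (h q)).
by apply: Q1; rewrite eq_sym.
Qed.

Lemma block_connect1 (X : {set B * Q}) u x y : (forall q q', (u, q) \in X -> (u, q') \in X -> q = q') ->
  (u, x) \notin X -> (u, y) \notin X -> connect (del e X) (u, x) (u, y).
Proof.
move=> h xX yX; have [/existsP[q qX]|/existsPn n] := boolP [exists q, (u, q) \in X];
  last exact: block_connect0.
apply: (block_connect (Y := [set q])) => [q' q'X|]; first by rewrite inE (h _ _ q'X qX).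
by apply: Q1; [apply: contraNneq xX | apply: contraNneq yX] => ->.
Qed.

Lemma connect_port (X : {set B * Q}) a d d' : port d \notin X -> port d' \notin X ->
  nxt d = Some d' -> connect (del e X) a (port d) -> connect (del e X) a (port d').
Proof.
move=> dX d'X h c; apply: connect_trans c _; apply: connect1.
by rewrite /del /= dX d'X port_link.
Qed.

Let hit (X : {set B * Q}) a : {set B} :=
  [set u | [exists q, ((u, q) \notin X) && connect (del e X) a (u, q)]].

Lemma removed_darts (X : {set B * Q}) : #|[set d | port d \in X]| <= #|X|.
Proof.
rewrite -(card_imset _ port_inj); apply: subset_leq_card.
by apply/subsetP => z /imsetP[d]; rewrite inE => h ->.
Qed.

(* If no block is missed, the ports leaving the blocks met by a component have
   been removed. *)
Lemma hit_cut (X : {set B * Q}) a :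
  (forall u q q', (u, q) \in X -> (u, q') \in X -> q = q') -> a \notin X ->
  (forall u q, u \in hit X a -> (u, q) \notin X -> connect (del e X) a (u, q)) /\
  (forall d, d \in outset (hit X a) -> port d \in X \/
     match nxt d with Some d' => port d' \in X | None => connect (del e X) a (port d) end).
Proof.
move=> hX aX.
have full u q : u \in hit X a -> (u, q) \notin X -> connect (del e X) a (u, q).
  rewrite inE => /existsP[q' /andP[q'X c]] qX; apply: connect_trans c _.
  by apply: block_connect1 => // ? ?; exact: hX.
split=> // d; rewrite inE => /andP[dh out].
have [|dX] := boolP (port d \in X); first by left.
right; have c := full _ _ dh dX.
case E: (nxt d) out => [d'|] // out; apply: contraNT out => d'X.
rewrite inE; apply/existsP; exists (term d'.2); rewrite d'X /=.
exact: (connect_port dX d'X E).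
Qed.

(** Suppose that the component of [a] contains no open port. If [p] and [q] lie in different blocks,
    the darts leaving the blocks met by the component, at least three, would need as many deleted
    ports. If both lie in a block [w], all edges leaving the other blocks met go to [w]; being at
    least three, they occupy all its ports, and every vertex left in [w] reaches a surviving port by
    [Q2]. *)
Lemma comp_reach p q a : p != q -> a \notin [set p; q] ->
  (exists d, [/\ nxt d = None, port d \notin [set p; q] & connect (del e [set p; q]) a (port d)]) \/
  (forall b, b \notin [set p; q] -> connect (del e [set p; q]) a b).
Proof.
set X := [set p; q] => pq aX.
have cX : #|X| = 2 by rewrite cards2 pq.
case: (boolP [exists d, [&& nxt d == None, port d \notin X & connect (del e X) a (port d)]]) => [/existsP[d /and3P[/eqP h1 h2 h3]]|nexit].
  by left; exists d.
have noexit d : nxt d = None -> port d \notin X -> ~ connect (del e X) a (port d).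
  by move=> h1 h2 h3; case/existsP: nexit; exists d; rewrite h1 h2 h3 eqxx.
right; have [pq1|pq1] := eqVneq p.1 q.1; last first.
  have hX u r r' : (u, r) \in X -> (u, r') \in X -> r = r'.
    rewrite !inE => /orP[]/eqP h /orP[]/eqP h'.
    - by case: (etrans h (esym h')).
    - by rewrite -h -h' eqxx in pq1.
    - by rewrite -h -h' eqxx in pq1.
    - by case: (etrans h (esym h')).
  have [full out] := hit_cut hX aX.
  have [hT|hT] := eqVneq (hit X a) setT.
    by case=> u r bX; apply: full bX; rewrite hT inE.
  have h0 : hit X a != set0.
    apply/set0Pn; exists a.1; rewrite inE; apply/existsP; exists a.2.
    by rewrite -surjective_pairing aX connect0.
  suff : #|outset (hit X a)| <= #|X| by rewrite cX leqNgt cut3.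
  apply: leq_trans (removed_darts X).
  (* Each leaving dart is charged to a deleted end of its edge, and no two of them share one. *)
  pose psi d := if port d \in X then d else odflt d (nxt d).
  have psi_out d : d \in outset (hit X a) -> port (psi d) \in X.
    move=> dO; rewrite /psi; case: ifPn => // dX; have := out d dO.
    case E: (nxt d) => [d'|] [] //=; rewrite ?(negbTE dX) //.
    by move=> c; case: (noexit _ E dX).
  rewrite -(card_in_imset (f := psi) (D := mem (outset (hit X a)))).
    by apply: subset_leq_card; apply/subsetP => z /imsetP[d dO ->]; rewrite inE psi_out.
  move=> d d' dO d'O; rewrite /psi.
  case: ifPn => dX; case: ifPn => d'X //.
  - case E: (nxt d') => [d2|] //= dd; move: d'O; rewrite inE E -dd => /andP[_].
    by move: dO; rewrite inE => /andP[->].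
  - case E: (nxt d) => [d2|] //= dd; move: dO; rewrite inE E dd => /andP[_].
    by move: d'O; rewrite inE => /andP[->].
  - case E: (nxt d) => [d2|]; case E': (nxt d') => [d2'|] //=.
    + by move=> dd; move: (nxt_sym E) (nxt_sym E'); rewrite dd => -> [].
    + by case: (out _ d'O); rewrite ?(negbTE d'X) // E' => c; case: (noexit _ E' d'X).
    + by case: (out _ dO); rewrite ?(negbTE dX) // E => c; case: (noexit _ E dX).
set w := p.1.
have offw u r : u != w -> (u, r) \notin X.
  apply: contraNN; rewrite !inE => /orP[]/eqP h; first by rewrite /w -h.
  by rewrite /w pq1 -h.
have offport d : d.1 != w -> port d \notin X by exact: offw.
pose qs := [set p.2; q.2].
have Xqs r : ((w, r) \in X) = (r \in qs).
  have ez z : z.1 = w -> ((w, r) == z) = (r == z.2).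
    by case: z => z1 z2 /= ->; rewrite xpair_eqE eqxx.
  by rewrite !inE !ez // -pq1.
have reach r : (w, r) \notin X -> exists2 k, port (w, k) \notin X &
    connect (del e X) (w, r) (port (w, k)).
  rewrite Xqs => rq; have pq2 : p.2 != q.2.
    by apply: contra pq => /eqP h; rewrite [p]surjective_pairing [q]surjective_pairing pq1 h.
  have [k kq c] := Q2 pq2 rq; exists k; first by rewrite /port /= Xqs.
  by apply: (block_connect (Y := qs)) c => r'; rewrite Xqs.
pose Xb := hit X a :\ w.
have fullX u r : u \in Xb -> connect (del e X) a (u, r).
  rewrite !inE => /andP[uw /existsP[r' /andP[_ c]]]; apply: connect_trans c _.
  by apply: block_connect0 => ?; exact: offw.
have inXb u r : u != w -> connect (del e X) a (u, r) -> u \in Xb.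
  by move=> uw c; rewrite !inE uw; apply/existsP; exists r; rewrite c offw.
have step d d' : nxt d = Some d' -> port d \notin X -> connect (del e X) a (port d) ->
    d'.1 != w -> d'.1 \in Xb.
  move=> E dX c d'w; apply: (inXb _ (term d'.2)) => //.
  exact: (connect_port dX (offport _ d'w) E c).
have Xb0 : Xb != set0.
  apply/set0Pn; have [aw|aw] := eqVneq a.1 w; last first.
    by exists a.1; apply: (inXb _ a.2) => //; rewrite -surjective_pairing connect0.
  have ea : (w, a.2) = a by rewrite -aw -surjective_pairing.
  have := reach a.2; rewrite ea => /(_ aX) [k kX c].
  case E: (nxt (w, k)) => [d'|]; last by case: (noexit _ E kX).
  by exists d'.1; apply: (step _ _ E kX c); rewrite eq_sym; exact: (nxt_neq E).
have XbT : Xb != setT by apply/negP => /eqP h; have := in_setT w; rewrite -h !inE eqxx.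
have outw d : d \in outset Xb -> exists2 k, nxt d = Some (w, k) & d.1 \in Xb.
  rewrite inE => /andP[dX out]; have c := fullX _ (term d.2) dX.
  have dw : d.1 != w by move: dX; rewrite !inE => /andP[].
  case E: (nxt d) out => [[u k]|] /= out; last by case: (noexit _ E (offport _ dw)).
  exists k => //; congr (Some (_, _)); apply/eqP; apply: contraNT out => uw.
  exact: (step _ _ E (offport _ dw) c uw).
(* At least three darts leave [Xb], and they lead to different ports of [w], which has only
   three. *)
have back k : exists2 d, nxt (w, k) = Some d & d.1 \in Xb.
  have inj : {in outset Xb &, injective (fun d => if nxt d is Some d' then d'.2 else ord0)}.
    move=> d d' /outw[i E _] /outw[j E' _]; rewrite E E' /= => ij.
    by move: (nxt_sym E) (nxt_sym E'); rewrite ij => -> [].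
  have imT : [set (if nxt d is Some d' then d'.2 else ord0) | d in outset Xb] = setT.
    by apply/eqP; rewrite eqEcard subsetT card_in_imset // cardsT card_ord cut3.
  have : k \in [set: 'I_3] by rewrite inE.
  rewrite -imT => /imsetP[d dO ek]; have [i E dX] := outw d dO.
  by exists d => //; rewrite ek E; exact: (nxt_sym E).
(* As all ports of [w] lead to [Xb], nothing leaves the union. *)
have YT : w |: Xb = setT.
  apply/eqP; apply: contraT => hT; have h0 : w |: Xb != set0 by apply/set0Pn; exists w; rewrite setU11.
  have /set0Pn[d] : outset (w |: Xb) != set0 by rewrite -card_gt0; apply: leq_trans (cut3 h0 hT).
  rewrite inE => /andP[]; case: (boolP (d.1 \in Xb)) => [dX _|dX].
    have dw : d.1 != w by move: dX; rewrite !inE => /andP[].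
    have c := fullX _ (term d.2) dX.
    case E: (nxt d) => [d'|]; last by case: (noexit _ E (offport _ dw)).
    rewrite in_setU1 negb_or => /andP[d'w /negP []].
    exact: (step _ _ E (offport _ dw) c d'w).
  rewrite in_setU1 (negbTE dX) orbF => /eqP dw.
  have [d' E d'X] := back d.2; rewrite [d]surjective_pairing dw E.
  by rewrite in_setU1 d'X orbT.
move=> [u r] bX; have [uw|uw] := eqVneq u w; last first.
  by apply: fullX; have := in_setT u; rewrite -YT in_setU1 (negbTE uw).
rewrite uw in bX *; have [k kX c] := reach _ bX.
have [d E dX] := back k.
have dw : d.1 != w by move: dX; rewrite !inE => /andP[].
apply: connect_trans (connect_port (offport _ dw) kX (nxt_sym E) (fullX _ _ dX)) _.
by rewrite connect_sym_del.
Qed.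

(** A component missing some block would give two complementary cuts with at least six leaving darts
    in all. At most three of them are open ports; every link between the two sides uses the one
    deleted port, so there is at most one link, with one dart on each side. *)
Lemma comp_conn1 : #|[set d | nxt d == None]| <= 3 -> conn1 e.
Proof.
move=> ext3 p a b ap bp; set X := [set p].
have aX : a \notin X by rewrite inE.
have bX : b \notin X by rewrite inE.
have hX u r r' : (u, r) \in X -> (u, r') \in X -> r = r'.
  by rewrite !inE => /eqP <- /eqP [].
have [full out] := hit_cut hX aX.
have [hT|hT] := eqVneq (hit X a) setT.
  by case: b bp bX => u r bp bX; apply: full bX; rewrite hT inE.
have h0 : hit X a != set0.
  apply/set0Pn; exists a.1; rewrite inE; apply/existsP; exists a.2.
  by rewrite -surjective_pairing aX connect0.
have cT : ~: hit X a != setT by rewrite -setC0 (inj_eq (@setC_inj _)).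
have c0 : ~: hit X a != set0 by rewrite -setCT (inj_eq (@setC_inj _)).
have := leq_add (cut3 h0 hT) (cut3 c0 cT).
set Y := hit X a in out h0 hT c0 cT *.
pose cr (Z : {set B}) := [set d in outset Z | nxt d != None].
have split (Z : {set B}) : #|outset Z| = #|outset Z :&: [set d | nxt d == None]| + #|cr Z|.
  rewrite -(cardsID [set d | nxt d == None]); congr (_ + _); apply: eq_card => d.
  by rewrite !inE; case: (nxt d == None); rewrite ?andbF ?andbT.
have one : #|[set d | port d \in X]| <= 1 by apply: leq_trans (removed_darts X) _; rewrite cards1.
have crP (Z : {set B}) d : d \in cr Z ->
    exists2 d', nxt d = Some d' & (d.1 \in Z) && (d'.1 \notin Z).
  by rewrite !inE; case: (nxt d) => [d'|]; rewrite ?andbF // andbT; exists d'.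
have crI (Z : {set B}) d d' : nxt d = Some d' -> d.1 \in Z -> d'.1 \notin Z -> d \in cr Z.
  by move=> E h h'; rewrite !inE E h h'.
have crY d : d \in cr Y -> (port d \in X) || (if nxt d is Some d' then port d' \in X else false).
  rewrite inE => /andP[dO dn]; case: (out d dO) => [-> //|].
  by case: (nxt d) dn => // d' _ ->; rewrite orbT.
have crC d : d \in cr (~: Y) -> exists2 d', nxt d = Some d' & d' \in cr Y.
  case/crP=> d' E; rewrite !in_setC negbK => /andP[dY d'Y]; exists d' => //.
  exact: crI (nxt_sym E) d'Y dY.
have uniqY : {in cr Y &, forall d d', d = d'}.
  move=> d d' dY d'Y; have := crY _ dY; have := crY _ d'Y.
  have eqd x y : port x \in X -> port y \in X -> x = y.
    by rewrite !inE => /eqP <- /eqP /port_inj.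
  case/crP: dY => d2 E /andP[dY d2Y]; case/crP: d'Y => d2' E' /andP[d'Y d2'Y].
  rewrite E E' => /orP[] h' /orP[] h.
  - exact: eqd.
  - by move: d2Y; rewrite (eqd _ _ h h') d'Y.
  - by move: d2'Y; rewrite (eqd _ _ h' h) dY.
  - by move: (nxt_sym E) (nxt_sym E'); rewrite (eqd _ _ h h') => -> [].
have c1 : #|cr Y| <= 1.
  by apply/card_le1_eqP => d d' dY d'Y; exact: uniqY.
have c2 : #|cr (~: Y)| <= 1.
  apply/card_le1_eqP => d d' /crC[x E xY] /crC[x' E' x'Y].
  by move: (nxt_sym E) (nxt_sym E'); rewrite (uniqY _ _ xY x'Y) => -> [].
have c3 : #|outset Y :&: [set d | nxt d == None]| + #|outset (~: Y) :&: [set d | nxt d == None]| <= 3.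
  apply: leq_trans ext3; rewrite -(cardsID [set d : B * 'I_3 | d.1 \in Y] [set d | nxt d == None]).
  apply: leq_add; apply: subset_leq_card; apply/subsetP => d; rewrite !inE.
    by case/andP=> /andP[-> _] ->.
  by case/andP=> /andP[-> _] ->.
rewrite !split; clear - c1 c2 c3; lia.
Qed.

End CompositeConnectivity.

Import GRing.Theory.

(** * Cubic graphs *)

Section Flow.

Variables (B : finType) (nxt : B * 'I_3 -> option (B * 'I_3)) (phi : B * 'I_3 -> Z).
Hypotheses (nxt_sym : forall d d', nxt d = Some d' -> nxt d' = Some d)
  (nxt_neq : forall d d', nxt d = Some d' -> d.1 != d'.1)
  (closed_nxt : forall d, nxt d)
  (connected_base : forall X : {set B}, X != set0 -> X != setT -> outset nxt X != set0)
  (phi_sum : forall u, (\sum_i phi (u, i) = 0)%R)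
  (phi_anti : forall d d', nxt d = Some d' -> phi d' = (- phi d)%R)
  (phi_inj : forall d d', (phi d + phi d' = 0)%R -> nxt d = Some d').

(* A flow whose values have pairwise distinct nonzero absolute values on the
   edges forbids edge cuts of size 1 and 2. *)
Lemma flow_cut3 (X : {set B}) : X != set0 -> X != setT -> 3 <= #|outset nxt X|.
Proof.
move=> X0 XT; have O0 := connected_base X0 XT.
pose nx d := odflt d (nxt d).
have nxE d : nxt d = Some (nx d) by rewrite /nx; case: (nxt d) (closed_nxt d).
have nxK : involutive nx by move=> d; have := nxt_sym (nxE d); rewrite nxE => -[].
have outE d : (d \in outset nxt X) = (d.1 \in X) && ((nx d).1 \notin X).
  by rewrite inE nxE.
have sX : (\sum_(d | d.1 \in X) phi d = 0)%R.
  rewrite (eq_bigr (fun d => phi (d.1, d.2))) => [|d _]; last by rewrite -surjective_pairing.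
  rewrite (eq_bigl (fun d : B * 'I_3 => (d.1 \in X) && true)) => [|d]; last by rewrite andbT.
  rewrite -(pair_big (fun u => u \in X) xpredT (fun u i => phi (u, i))) /=.
  by apply: big1 => u _; exact: phi_sum.
(* The two darts of an edge inside [X] carry opposite values and cancel. *)
have int0 : (\sum_(d | (d.1 \in X) && ((nx d).1 \in X)) phi d = 0)%R.
  set S := (\sum_(d | _) _)%R.
  have : S = (- S)%R.
    rewrite {1}/S (reindex_inj (inv_inj nxK)) /= /S -sumrN; apply: eq_big => d.
      by rewrite nxK andbC.
    by move=> _; apply: phi_anti; exact: nxE.
  lia.
have out0 : (\sum_(d in outset nxt X) phi d = 0)%R.
  rewrite -[RHS]sX [in RHS](bigID (fun d : B * 'I_3 => (nx d).1 \in X)) /= int0 add0r.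
  by apply: eq_bigl => d; rewrite outE.
(* Opposite values occur only on the two darts of one edge, which cannot both leave [X]. With
   [d' = d] this also excludes a single leaving dart, whose value would be 0. *)
have selfF d d' : d \in outset nxt X -> d' \in outset nxt X -> (phi d + phi d')%R <> 0%R.
  rewrite !outE => /andP[_ h] /andP[h' _] /phi_inj; rewrite nxE => -[e].
  by rewrite e h' in h.
rewrite leqNgt ltnS leq_eqVlt ltnS leq_eqVlt ltnS leqn0 cards_eq0 (negbTE O0) orbF.
apply/negP => /orP[/cards2P[d [d' [dd e]]]|/cards1P[d e]].
  move: out0; rewrite e big_setU1 ?inE //= big_set1; apply: selfF; rewrite e ?set21 ?set22 //.
have := @selfF d d; rewrite e set11 => /(_ isT isT); apply.
by move: out0; rewrite e big_set1 => ->.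
Qed.

End Flow.

Section Deletion.

Variables (B B' Q : finType) (adjQ : rel Q) (term : 'I_3 -> Q)
  (nxt : B * 'I_3 -> option (B * 'I_3)) (ext : 'I_3 -> B * 'I_3)
  (nxt' : B' * 'I_3 -> option (B' * 'I_3)) (v : B') (w : B -> B').
Let wd (d : B * 'I_3) := (w d.1, d.2).
Hypotheses (w_inj : injective w) (codom_w : forall u, (u \in codom w) = (u != v))
  (term_inj : injective term)
  (nxt'_sym : forall d d', nxt' d = Some d' -> nxt' d' = Some d)
  (closed_nxt' : forall d, nxt' d) (nxt'_neq : forall d d', nxt' d = Some d' -> d.1 != d'.1)
  (nxt_w : forall d d', nxt' (wd d) = Some (wd d') <-> nxt d = Some d')
  (nxt_v : forall k, nxt' (v, k) = Some (wd (ext k))).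

Lemma nxt_wE d : nxt' (wd d) = match nxt d with Some d' => Some (wd d') | None => nxt' (wd d) end.
Proof. by case E: (nxt d) => [d'|] //; apply/nxt_w. Qed.

Lemma nxt_None d : nxt d = None <-> exists k, ext k = d.
Proof.
have wdI : injective wd by move=> [a i] [b j] [/w_inj -> ->].
split=> [h|[k ek]].
  case E: (nxt' (wd d)) (closed_nxt' (wd d)) => [[u k]|] // _.
  have uv : u = v.
    apply/eqP; rewrite -[_ == _]negbK -codom_w; apply/negP => /codomP[u0 eu].
    by have := (nxt_w d (u0, k)).1; rewrite E eu h /wd /= => /(_ erefl).
  by exists k; apply: wdI; apply: Some_inj; rewrite -(nxt_v k) -uv (nxt'_sym E).
case E: (nxt d) => [d'|] //; have := (nxt_w d d').2 E.
have := nxt'_sym (nxt_v k); rewrite ek => -> [e _].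
by have := codom_w (w d'.1); rewrite codom_f -e eqxx.
Qed.

Lemma deletion_sym d d' : nxt d = Some d' -> nxt d' = Some d.
Proof. by move/nxt_w /nxt'_sym /nxt_w. Qed.

Lemma deletion_neq d d' : nxt d = Some d' -> d.1 != d'.1.
Proof. by move/nxt_w /nxt'_neq; rewrite (inj_eq w_inj). Qed.

Lemma deletion_ext_inj : injective ext.
Proof.
move=> k k' e; have := nxt'_sym (nxt_v k); rewrite e.
by rewrite (nxt'_sym (nxt_v k')) => -[].
Qed.

(** A dart whose edge led to [v] is now open and still counted, so each cut of the smaller graph is
    as large as that of its image. *)
Lemma deletion_cut3 :
  (forall X : {set B'}, X != set0 -> X != setT -> 3 <= #|outset nxt' X|) ->
  forall X : {set B}, X != set0 -> X != setT -> 3 <= #|outset nxt X|.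
Proof.
move=> h X X0 _; have wdI : injective wd by move=> [a i] [b j] [/w_inj -> ->].
have vX : v \notin w @: X.
  apply/negP => /imsetP[u _ e]; have := codom_w (w u).
  by rewrite codom_f -e eqxx.
have mw u : (w u \in w @: X) = (u \in X) by rewrite mem_imset.
apply: leq_trans (h (w @: X) _ _) _.
- by rewrite imset_eq0.
- by apply: contraNneq vX => ->; rewrite inE.
rewrite -(card_imset _ wdI); apply: subset_leq_card; apply/subsetP => d.
rewrite inE => /andP[/imsetP[u uX eu] out]; apply/imsetP.
have ed : d = wd (u, d.2) by rewrite /wd /= -eu -surjective_pairing.
exists (u, d.2) => //; rewrite inE uX /=; move: out; rewrite ed nxt_wE /=.
by case: (nxt (u, d.2)) => // d'; rewrite /wd /= mw.
Qed.

Lemma deletion_embedded :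
  embedded (cadj adjQ term nxt') (cadj adjQ term nxt) (cterm term ext)
    (fun x => (w x.1, x.2)).
Proof.
have codE y : (y \in codom (fun x : B * Q => (w x.1, x.2))) = (y.1 != v).
  rewrite -codom_w; apply/codomP/codomP => [[x ->]|[u e]]; first by exists x.1.
  by exists (u, y.2); rewrite -e -surjective_pairing.
have out x y : y.1 = v -> cadj adjQ term nxt' (w x.1, x.2) y ->
    exists k, x = cterm term ext k /\ y = (v, term k).
  move=> yv c; have xv : w x.1 != v by rewrite -codom_w codom_f.
  have [|i [j [/= h1 h2 h3]]] := cadj_out _ c; first by rewrite yv.
  exists j; move: (nxt'_sym h1); rewrite yv nxt_v => -[/w_inj e1 e2].
  rewrite /cterm e1 e2 -h2; split; first by case: (x).
  by rewrite -yv -h3 -surjective_pairing.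
split.
- split=> [[u q] [u' q'] [/w_inj -> ->] //|x y]; rewrite /cadj /= (inj_eq w_inj).
  congr (_ || _); apply/(linkP term nxt' (w x.1, x.2) (w y.1, y.2))/(linkP term nxt x y) => -[i [j [h1 h2 h3]]]; exists i, j; split=> //.
    by apply/nxt_w.
  by apply/(nxt_w (x.1, i) (y.1, j)).
- move=> x y; rewrite codE negbK => /eqP yv /(out _ _ yv)[k [-> _]]; exact: codom_f.
- move=> x y y'; rewrite !codE !negbK => /eqP yv /eqP yv' /(out _ _ yv)[k [e1 ->]].
  move/(out _ _ yv')=> [k' [e2 ->]]; congr (_, term _).
  by apply: (@cterm_inj B Q term ext term_inj deletion_ext_inj); rewrite -e1 -e2.
- move=> x x' y; rewrite codE negbK => /eqP yv /(out _ _ yv)[k [-> e]].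
  by move/(out _ _ yv)=> [k' [->]]; rewrite e => -[/term_inj ->].
Qed.

End Deletion.

(** * Cubic graphs given by tables *)

Section Table.

Variables (n : nat) (tab : seq nat).

Definition dart_code (d : 'I_n.+1 * 'I_3) : nat := 3 * d.1 + d.2.
Definition code_dart (c : nat) : 'I_n.+1 * 'I_3 := (inord (c %/ 3), inord (c %% 3)).

(* Codes beyond the blocks stand for missing edges. *)
Definition tnxt (d : 'I_n.+1 * 'I_3) : option ('I_n.+1 * 'I_3) :=
  let c := nth (3 * n.+1) tab (dart_code d) in
  if c < 3 * n.+1 then Some (code_dart c) else None.

Lemma dart_code_lt d : dart_code d < 3 * n.+1.
Proof. by rewrite /dart_code; case: d => -[u hu] [i hi] /=; lia. Qed.

Lemma dart_codeK : cancel dart_code code_dart.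
Proof.
move=> [u i]; rewrite /dart_code /code_dart mulnC /=; congr (_, _); apply: val_inj => /=.
  by rewrite divnMDl // divn_small // addn0 inordK.
by rewrite modnMDl modn_small // inordK.
Qed.

Lemma code_dartK c : c < 3 * n.+1 -> dart_code (code_dart c) = c.
Proof.
move=> h; rewrite /dart_code /code_dart /= !inordK ?ltn_mod //; first by rewrite mulnC -divn_eq.
by rewrite ltn_divLR // mulnC.
Qed.

Lemma tnxtP d d' : reflect (tnxt d = Some d') (nth (3 * n.+1) tab (dart_code d) == dart_code d').
Proof.
rewrite /tnxt; apply: (iffP eqP) => [->|]; first by rewrite dart_code_lt dart_codeK.
by case: ifP => // h [<-]; rewrite code_dartK.
Qed.

Definition table_ok : bool :=
  all (fun c => let c' := nth (3 * n.+1) tab c in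
    (c' < 3 * n.+1) ==> (nth (3 * n.+1) tab c' == c) && (c' %/ 3 != c %/ 3))
    (iota 0 (3 * n.+1)).

Lemma dart_code_div d : dart_code d %/ 3 = d.1.
Proof. by rewrite /dart_code mulnC divnMDl // divn_small // addn0. Qed.

Lemma table_okP : table_ok ->
  (forall d d', tnxt d = Some d' -> tnxt d' = Some d) /\
  (forall d d', tnxt d = Some d' -> d.1 != d'.1).
Proof.
move=> /allP h; split=> d d' /tnxtP /eqP e; have := h (dart_code d);
  rewrite mem_iota add0n dart_code_lt /= e dart_code_lt => /(_ isT) /andP[e1 e2].
  by apply/tnxtP.
by move: e2; rewrite !dart_code_div eq_sym.
Qed.

Definition table_closed : bool :=
  all (fun c => nth (3 * n.+1) tab c < 3 * n.+1) (iota 0 (3 * n.+1)).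

Lemma table_closedP : table_closed -> forall d, tnxt d.
Proof.
by move=> /allP h d; rewrite /tnxt h // mem_iota add0n dart_code_lt.
Qed.

(** The numbering is such that every vertex but the first has a neighbour of smaller number;
    connectedness follows by induction. *)
Definition table_conn : bool :=
  all (fun u => has (fun i => nth (3 * n.+1) tab (3 * u + i) %/ 3 < u) [:: 0; 1; 2]) (iota 1 n).

Lemma table_connP : table_ok -> table_conn ->
  forall X : {set 'I_n.+1}, X != set0 -> X != setT -> outset tnxt X != set0.
Proof.
move=> /table_okP [sy _] /allP h X X0 XT; apply: contra XT => /eqP O0.
have stay d d' : tnxt d = Some d' -> (d.1 \in X) = (d'.1 \in X).
  move=> e; apply/idP/idP => hx; apply: contraT => hy.
    by have := in_set0 d; rewrite -O0 inE hx e hy.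
  by have := in_set0 d'; rewrite -O0 inE hx (sy _ _ e) hy.
have all0 m (hm : m < n.+1) : (Ordinal hm \in X) = (ord0 \in X).
  elim/ltn_ind: m hm => -[|m] IH hm; first by congr (_ \in X); apply: val_inj.
  have [|i i3 hi] := hasP (h m.+1 _); first by rewrite mem_iota.
  have i3' : i < 3 by move: i3; rewrite !inE; lia.
  set c := nth _ _ _ in hi.
  have cl : c < 3 * n.+1 by move: hi; rewrite ltn_divLR //; lia.
  have e : tnxt (Ordinal hm, Ordinal i3') = Some (code_dart c).
    by apply/tnxtP; rewrite code_dartK.
  rewrite (stay _ _ e) /=.
  have hc : c %/ 3 < n.+1 by apply: ltn_trans hi hm.
  rewrite -(IH _ hi hc); congr (_ \in X); apply: val_inj; by rewrite /= inordK.
case/set0Pn: X0 => -[m hm]; rewrite all0 => h0; rewrite -subTset.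
by apply/subsetP => -[k hk] _; rewrite all0.
Qed.

Variable phi : seq Z.

(** Zero is excluded, and opposite values are allowed only on darts matched by [tab]. *)
Fixpoint no_opposite (l : seq (nat * Z)) : bool :=
  if l is (c, x) :: l' then
    [&& ~~ Z.eqb x Z0, all (fun p => Z.eqb (Z.add x p.2) Z0 ==> (nth (3 * n.+1) tab c == p.1)) l'
      & no_opposite l']
  else true.

Definition flow_ok : bool :=
  let f := nth Z0 phi in
  [&& all (fun u => Z.eqb (Z.add (f (3 * u)) (Z.add (f (3 * u + 1)) (f (3 * u + 2)))) Z0) (iota 0 n.+1),
      all (fun c => Z.eqb (f (nth (3 * n.+1) tab c)) (Z.opp (f c))) (iota 0 (3 * n.+1))
    & no_opposite [seq (c, f c) | c <- iota 0 (3 * n.+1)]].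

Lemma table_cut3 : [&& table_ok, table_closed, table_conn & flow_ok] ->
  forall X : {set 'I_n.+1}, X != set0 -> X != setT -> 3 <= #|outset tnxt X|.
Proof.
case/and4P=> hok /table_closedP hcl hcn /and3P[/allP hs /allP ha hn].
have [sy ne] := table_okP hok.
pose f c := nth Z0 phi c.
apply: (@flow_cut3 _ tnxt (fun d => f (dart_code d))) => //.
- exact: table_connP.
- move=> u; have /Z.eqb_eq := hs u (ltac:(by rewrite mem_iota add0n ltn_ord)).
  rewrite !big_ord_recl big_ord0 /dart_code /= /f => h.
  by rewrite addr0 addn0; exact: h.
- move=> d d' /tnxtP /eqP e; have /Z.eqb_eq := ha (dart_code d) (ltac:(by rewrite mem_iota add0n dart_code_lt)).
  by rewrite e.
- move=> d d' h; have nopP l c c' : no_opposite [seq (c, f c) | c <- l] -> c \in l -> c' \in l ->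
      (f c + f c')%R = 0%R -> nth (3 * n.+1) tab c = c' \/ nth (3 * n.+1) tab c' = c.
    elim: l => //= x l IH /and3P[/negP x0 /allP xl hl]; rewrite !inE.
    case/predU1P=> [->|cl]; case/predU1P=> [->|cl'] e.
    + by case: x0; apply/Z.eqb_eq; move: e; lia.
    + left; apply/eqP; have := xl (c', f c') (map_f (fun c => (c, f c)) cl').
      by move/implyP; apply; apply/Z.eqb_eq.
    + right; apply/eqP; have := xl (c, f c) (map_f (fun c => (c, f c)) cl).
      by move/implyP; apply; apply/Z.eqb_eq; rewrite Z.add_comm.
    + exact: IH.
  have [] := nopP _ (dart_code d) (dart_code d') hn; rewrite ?mem_iota ?dart_code_lt //.
    by move/eqP/tnxtP.
  by move/eqP/tnxtP/sy.
Qed.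

End Table.

Import Order.TTheory Num.Theory.
Local Open Scope ring_scope.

(** * Straight-line drawings *)

Section Plane.

Variable F : realFieldType.
Implicit Types p q r s z : F * F.

Definition between p q (t : F) : F * F :=
  (p.1 + t * (q.1 - p.1), p.2 + t * (q.2 - p.2)).

Definition seg p q z : Prop := exists2 t, 0 <= t <= 1 & z = between p q t.

(* The affine map sending the standard triangle to [a b c]. *)
Definition affine a b c z : F * F :=
  (a.1 + z.1 * (b.1 - a.1) + z.2 * (c.1 - a.1),
   a.2 + z.1 * (b.2 - a.2) + z.2 * (c.2 - a.2)).

Definition std z : bool := [&& 0 <= z.1, 0 <= z.2 & z.1 + z.2 <= 1].

Definition orient p q r : F :=
  (q.1 - p.1) * (r.2 - p.2) - (q.2 - p.2) * (r.1 - p.1).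

(** The convex hull in dual form, by the closed and open half-planes that contain [S]; this is the
    form in which separating lines use it. *)
Definition hull (S : seq (F * F)) z : Prop := forall p q,
  (all (fun s => 0 <= orient p q s) S -> 0 <= orient p q z) /\
  (all (fun s => orient p q s < 0) S -> orient p q z < 0).

Lemma seg_sym p q z : seg p q z -> seg q p z.
Proof.
case=> t t01 ->; exists (1 - t); first by lra.
by congr (_, _); rewrite /=; ring.
Qed.

Lemma seg_left p q : seg p q p.
Proof.
by exists 0; rewrite ?lexx ?ler01 // /between !mul0r !addr0 -surjective_pairing.
Qed.

Lemma orient_between p q a b t :
  orient p q (between a b t) = (1 - t) * orient p q a + t * orient p q b.
Proof. by rewrite /orient /between /=; ring. Qed.

Lemma orient_affine p q a b c z : orient p q (affine a b c z) =
  (1 - z.1 - z.2) * orient p q a + z.1 * orient p q b + z.2 * orient p q c.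
Proof. by rewrite /orient /affine /=; ring. Qed.

Lemma hull_seg a b z : seg a b z -> hull [:: a; b] z.
Proof.
case=> t /andP[t0 t1] -> p q; rewrite orient_between /=.
set x := orient p q a; set y := orient p q b.
by split=> /and3P[xa xb _]; nra.
Qed.

Lemma hull_affine a b c z : std z -> hull [:: a; b; c] (affine a b c z).
Proof.
case/and3P=> z1 z2 z12 p q; rewrite orient_affine /=.
set x := orient p q a; set y := orient p q b; set w := orient p q c.
have k3 : 0 <= 1 - z.1 - z.2 by lra.
split=> /and4P[xa xb xc _]; first by rewrite !addr_ge0 // mulr_ge0.
have m1 : (1 - z.1 - z.2) * x <= 0 by rewrite mulr_ge0_le0 // ltW.
have m2 : z.1 * y <= 0 by rewrite mulr_ge0_le0 // ltW.
have m3 : z.2 * w <= 0 by rewrite mulr_ge0_le0 // ltW.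
have [h1|h1] := ltP 0 (1 - z.1 - z.2).
  have : (1 - z.1 - z.2) * x < 0 by rewrite pmulr_rlt0.
  lra.
have [h2|h2] := ltP 0 z.1.
  have : z.1 * y < 0 by rewrite pmulr_rlt0.
  lra.
have : z.2 * w < 0 by rewrite pmulr_rlt0 //; lra.
lra.
Qed.

Lemma between_affine a b c p q t :
  between (affine a b c p) (affine a b c q) t = affine a b c (between p q t).
Proof. by rewrite /between /affine /=; congr (_, _); ring. Qed.

Lemma std_between p q t : 0 <= t <= 1 -> std p -> std q -> std (between p q t).
Proof.
move=> /andP[t0 t1] /and3P[p1 p2 p12] /and3P[q1 q2 q12]; rewrite /std /between /=.
by apply/and3P; split; nra.
Qed.

Lemma affine_inj a b c : orient a b c != 0 -> injective (affine a b c).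
Proof.
move=> h z w [e1 e2]; have h1 : orient a b c * (z.1 - w.1) = 0.
  have -> : orient a b c * (z.1 - w.1) =
    (c.2 - a.2) * ((a.1 + z.1 * (b.1 - a.1) + z.2 * (c.1 - a.1)) - (a.1 + w.1 * (b.1 - a.1) + w.2 * (c.1 - a.1)))
    - (c.1 - a.1) * ((a.2 + z.1 * (b.2 - a.2) + z.2 * (c.2 - a.2)) - (a.2 + w.1 * (b.2 - a.2) + w.2 * (c.2 - a.2))).
    by rewrite /orient; ring.
  by rewrite e1 e2 !subrr !mulr0 subrr.
have h2 : orient a b c * (z.2 - w.2) = 0.
  have -> : orient a b c * (z.2 - w.2) =
    (b.1 - a.1) * ((a.2 + z.1 * (b.2 - a.2) + z.2 * (c.2 - a.2)) - (a.2 + w.1 * (b.2 - a.2) + w.2 * (c.2 - a.2)))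
    - (b.2 - a.2) * ((a.1 + z.1 * (b.1 - a.1) + z.2 * (c.1 - a.1)) - (a.1 + w.1 * (b.1 - a.1) + w.2 * (c.1 - a.1))).
    by rewrite /orient; ring.
  by rewrite e1 e2 !subrr !mulr0 subrr.
move/eqP: h1; rewrite mulf_eq0 (negbTE h) subr_eq0 => /eqP h1.
move/eqP: h2; rewrite mulf_eq0 (negbTE h) subr_eq0 => /eqP h2.
by rewrite [z]surjective_pairing h1 h2 -surjective_pairing.
Qed.

(** The conclusion names only the ends of the first edge; exchanging the two edges puts the common
    point at an end of the second as well. *)
Definition straight (V : Type) (e : rel V) (pos : V -> F * F) : Prop :=
  injective pos /\ forall u v x y z, e u v -> e x y -> (u, v) <> (x, y) -> (u, v) <> (y, x) ->
    seg (pos u) (pos v) z -> seg (pos x) (pos y) z -> z = pos u \/ z = pos v.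

(** Some edge starts at [w], and the condition on pairs of edges applies to it. *)
Lemma straight_vertex (V : eqType) (e : rel V) pos u v w :
  straight e pos -> (forall x, exists y, e x y) -> e u v ->
  seg (pos u) (pos v) (pos w) -> w = u \/ w = v.
Proof.
move=> [pI h] iso uv; have [w' ww'] := iso w.
have [[<- _]|/eqP n1] := eqVneq (u, v) (w, w'); first by left.
have [[_ <-]|/eqP n2] := eqVneq (u, v) (w', w); first by right.
by move=> s; have [/pI|/pI] := h _ _ _ _ _ uv ww' n1 n2 s (seg_left _ _); [left|right].
Qed.

Definition corner (k : 'I_3) : F * F :=
  if val k is 0%N then (0, 0) else if val k is 1%N then (1, 0) else (0, 1).

Lemma affine_corner (P : 'I_3 -> F * F) k :
  affine (P ord0) (P (inord 1)) (P (inord 2)) (corner k) = P k.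
Proof.
rewrite /affine /corner; case: k => [[|[|[|//]]] h] /=.
- have -> : Ordinal h = ord0 by apply: val_inj.
  by rewrite !mul0r !addr0 -surjective_pairing.
- have -> : Ordinal h = inord 1 by apply: val_inj; rewrite /= inordK.
  by rewrite !mul0r !mul1r !addr0 !subrKC -surjective_pairing.
- have -> : Ordinal h = inord 2 by apply: val_inj; rewrite /= inordK.
  by rewrite !mul0r !mul1r !addr0 !subrKC -surjective_pairing.
Qed.

Definition piece_drawing (V : Type) (e : rel V) (term : 'I_3 -> V) (pos : V -> F * F) : Prop :=
  [/\ straight e pos, forall x, std (pos x) & forall k, pos (term k) = corner k].

(* Each block is a triangle with its ports at the corners. *)
Definition base_drawing (B : eqType) (nxt : B * 'I_3 -> option (B * 'I_3))
    (P : B * 'I_3 -> F * F) : Prop :=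
  let T u := [:: P (u, ord0); P (u, inord 1); P (u, inord 2)] in
  [/\ forall u, orient (P (u, ord0)) (P (u, inord 1)) (P (u, inord 2)) != 0,
      forall u w z, u != w -> hull (T u) z -> hull (T w) z -> False,
      forall d d' u z, nxt d = Some d' -> hull (T u) z -> seg (P d) (P d') z ->
        d.1 = u /\ z = P d \/ d'.1 = u /\ z = P d' &
      forall d d' c c' z, nxt d = Some d' -> nxt c = Some c' -> d <> c -> d <> c' ->
        seg (P d) (P d') z -> seg (P c) (P c') z -> False].

Section Composite.

Variables (B Q : finType) (adjQ : rel Q) (term : 'I_3 -> Q)
  (nxt : B * 'I_3 -> option (B * 'I_3)) (posQ : Q -> F * F) (P : B * 'I_3 -> F * F).
Hypotheses (term_inj : injective term)
  (nxt_sym : forall d d', nxt d = Some d' -> nxt d' = Some d)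
  (nxt_neq : forall d d', nxt d = Some d' -> d.1 != d'.1)
  (iso : forall x, exists y, adjQ x y)
  (hQ : piece_drawing adjQ term posQ) (hB : base_drawing nxt P).

Let A u := affine (P (u, ord0)) (P (u, inord 1)) (P (u, inord 2)).
Definition cpos (x : B * Q) : F * F := A x.1 (posQ x.2).

Lemma cpos_term d : cpos (d.1, term d.2) = P d.
Proof.
case: hQ => _ _ ht; rewrite /cpos ht /A (affine_corner (fun k => P (d.1, k))).
by rewrite -surjective_pairing.
Qed.

(** Inside a block the drawing of the piece is carried over by an injective affine map, different
    blocks lie in disjoint triangles, and a link meets a triangle at most in the corner where it is
    attached. *)
Lemma composite_straight : straight (cadj adjQ term nxt) cpos.
Proof.
case: hQ => hs hstd ht; case: hB => h1 h2 h3 h4.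
have AI u : injective (A u) by exact: affine_inj.
have hcpos x : hull [:: P (x.1, ord0); P (x.1, inord 1); P (x.1, inord 2)] (cpos x).
  exact: hull_affine.
have segin u a b z : seg (cpos (u, a)) (cpos (u, b)) z ->
    exists2 z0, std z0 & z = A u z0 /\ seg (posQ a) (posQ b) z0.
  case=> t t01 ->; exists (between (posQ a) (posQ b) t); first exact: std_between.
  by rewrite /cpos between_affine; split=> //; exists t.
have lnk u a w b : u != w -> cadj adjQ term nxt (u, a) (w, b) ->
    exists i j, [/\ nxt (u, i) = Some (w, j), a = term i & b = term j].
  by move=> uw /cadj_out -/(_ uw) /= [i [j [? ? ?]]]; exists i, j.
(* The common point is a corner of the triangle, hence a terminal, and a terminal on an edge of the
   piece is one of its ends. *)
have inlink u a b x y z : adjQ a b -> x.1 != y.1 -> cadj adjQ term nxt x y ->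
    seg (cpos (u, a)) (cpos (u, b)) z -> seg (cpos x) (cpos y) z ->
    (z = cpos (u, a) \/ z = cpos (u, b)) /\ (z = cpos x \/ z = cpos y).
  case: x y => [w x] [w' y] ab ww /(lnk _ _ _ _ ww) [i [j [hn -> ->]]].
  case/segin=> z0 z0s [ez sz]; rewrite !(cpos_term (_, _)) => sxy.
  have := h3 _ _ u z hn; rewrite {1}ez => /(_ (hull_affine _ _ _ z0s) sxy) /= hz.
  have fin k : z = P (u, k) -> z = cpos (u, a) \/ z = cpos (u, b).
    rewrite ez -(cpos_term (u, k)) /cpos /= => /AI e0; rewrite e0 in sz *.
    by case: (straight_vertex hs iso ab sz) => ->; [left|right].
  by case: hz => -[e ez']; rewrite e in ez'; (split; first exact: (fin _ ez')); rewrite e; [left|right].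
split.
  move=> [u a] [w b] e; have [uw|uw] := eqVneq u w; last first.
    by case: (h2 _ _ _ uw (hcpos (u, a))); rewrite e; exact: (hcpos (w, b)).
  by move: e; rewrite uw => /AI /(proj1 hs) /= ->.
move=> [u a] [w b] [u' a'] [w' b'] z e1 e2 n1 n2 s1 s2.
have [uw|uw] := eqVneq u w; have [uw'|uw'] := eqVneq u' w'.
- subst w w'; rewrite !cadj_in // in e1 e2.
  have [z0 z0s [ez sz]] := segin _ _ _ _ s1; have [z1 z1s [ez' sz']] := segin _ _ _ _ s2.
  have [uu|uu] := eqVneq u u'; last first.
    by case: (h2 _ _ z uu); [rewrite ez | rewrite ez']; exact: hull_affine.
  subst u'; have zz : z1 = z0 by apply: (AI u); rewrite -ez -ez'.
  rewrite zz in sz'; rewrite ez.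
  by case: (proj2 hs _ _ _ _ _ e1 e2 _ _ sz sz') => [[aa bb]|[aa bb]|->|->];
    [case: n1; rewrite aa bb | case: n2; rewrite aa bb | left | right].
- subst w; rewrite cadj_in // in e1.
  by have [] := inlink _ _ _ (u', a') (w', b') _ e1 uw' e2 s1 s2.
- subst w'; rewrite cadj_in // in e2.
  by have [] := inlink _ _ _ (u, a) (w, b) _ e2 uw e1 s2 s1.
- have [i [j [hn ea eb]]] := lnk _ _ _ _ uw e1.
  have [i' [j' [hn' ea' eb']]] := lnk _ _ _ _ uw' e2.
  move: s1 s2; rewrite ea eb ea' eb' !(cpos_term (_, _)) => s1 s2.
  case: (h4 _ _ _ _ _ hn hn' _ _ s1 s2) => e.
  + by apply: n1; move: hn'; rewrite -e hn => -[-> ej]; rewrite ea eb ea' eb'; case: e => -> ->; rewrite ej.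
  + have := nxt_sym hn'; rewrite -e hn => -[e3 ej].
    by apply: n2; rewrite ea eb ea' eb' e3 ej; case: e => -> ->.
Qed.

Lemma composite_piece (ext : 'I_3 -> B * 'I_3) :
  (forall d, std (P d)) -> (forall k, P (ext k) = corner k) ->
  piece_drawing (cadj adjQ term nxt) (cterm term ext) cpos.
Proof.
move=> Ps Pe; split; first exact: composite_straight.
  move=> [u a]; case: hQ => _ hstd _; rewrite /cpos /A /=.
  have /and3P[z1 z2 z3] := hstd a.
  have /and3P[p1 p2 p3] := Ps (u, ord0); have /and3P[q1 q2 q3] := Ps (u, inord 1).
  have /and3P[r1 r2 r3] := Ps (u, inord 2).
  move: (posQ a) (P (u, ord0)) (P (u, inord 1)) (P (u, inord 2)) z1 z2 z3 p1 p2 p3 q1 q2 q3 r1 r2 r3.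
  move=> z p q r *; rewrite /affine /std /=.
  have e1 : p.1 + z.1 * (q.1 - p.1) + z.2 * (r.1 - p.1) = (1 - z.1 - z.2) * p.1 + z.1 * q.1 + z.2 * r.1 by ring.
  have e2 : p.2 + z.1 * (q.2 - p.2) + z.2 * (r.2 - p.2) = (1 - z.1 - z.2) * p.2 + z.1 * q.2 + z.2 * r.2 by ring.
  have w : 0 <= 1 - z.1 - z.2 by lra.
  rewrite e1 e2; apply/and3P; split; rewrite ?addr_ge0 ?mulr_ge0 //.
  by nra.
by move=> k; rewrite /cterm (cpos_term (ext k)).
Qed.

End Composite.

End Plane.

(** * Drawings with integer coordinates *)

Definition pointZ : Type := (Z * Z)%type.

Definition orientZ (p q r : pointZ) : Z :=
  Z.sub (Z.mul (Z.sub q.1 p.1) (Z.sub r.2 p.2)) (Z.mul (Z.sub q.2 p.2) (Z.sub r.1 p.1)).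

(** Only lines through two points of [S] are tried: disjoint convex polygons are separated by a line
    along a side of one of them, hence the two orders in [apart]. *)
Definition separates (S S' : seq pointZ) : bool :=
  has (fun p => has (fun q => all (fun s => Z.leb Z0 (orientZ p q s)) S &&
    all (fun s => Z.ltb (orientZ p q s) Z0) S') S) S.

Definition apart S S' : bool := separates S S' || separates S' S.

(* The segment from [p] to [q] leaves the hull of [S] at [p]. *)
Definition touches (S : seq pointZ) (p q : pointZ) : bool :=
  has (fun a => has (fun b => [&& all (fun s => Z.leb Z0 (orientZ a b s)) S,
    Z.leb (orientZ a b p) Z0 & Z.ltb (orientZ a b q) Z0]) S) S.

Section Cast.

Variables (F : realFieldType) (D : Z).
Hypothesis D_gt0 : Z.lt Z0 D.

Definition zr (x : Z) : F := (int_of_Z x)%:~R.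

Definition pt (p : pointZ) : F * F := (zr p.1 / zr D, zr p.2 / zr D).

Lemma zr_ge0 x : (0 <= zr x) = Z.leb Z0 x.
Proof. by rewrite /zr ler0z; case: x. Qed.

Lemma zr_lt0 x : (zr x < 0) = Z.ltb x Z0.
Proof. by rewrite /zr ltrz0; case: x => //= p; apply/esym/idP; lia. Qed.

Lemma zrB x y : zr (Z.sub x y) = zr x - zr y.
Proof. by rewrite /zr -rmorphB -(rmorphB int_of_Z). Qed.

Lemma zrD x y : zr (Z.add x y) = zr x + zr y.
Proof. by rewrite /zr -rmorphD -(rmorphD int_of_Z). Qed.

Lemma zrM x y : zr (Z.mul x y) = zr x * zr y.
Proof. by rewrite /zr -rmorphM -(rmorphM int_of_Z). Qed.

Lemma zrD_gt0 : 0 < zr D.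
Proof. by rewrite /zr ltr0z; case: D D_gt0 => //= p _; lia. Qed.

Lemma zr_inj : injective zr.
Proof. by move=> x y /intr_inj /(can_inj int_of_ZK). Qed.

Lemma pt_inj : injective pt.
Proof.
have D0 : (zr D)^-1 != 0 by rewrite invr_eq0 gt_eqF // zrD_gt0.
by move=> [a b] [a' b'] [/(mulIf D0) /zr_inj -> /(mulIf D0) /zr_inj ->].
Qed.

Lemma orient_pt p q r : orient (pt p) (pt q) (pt r) = zr (orientZ p q r) * ((zr D)^-1 ^+ 2).
Proof. by rewrite /orient /orientZ zrB !zrM !zrB /pt /=; ring. Qed.

Let D2 : 0 < (zr D)^-1 ^+ 2.
Proof. by rewrite exprn_gt0 // invr_gt0 zrD_gt0. Qed.

Lemma orient_ge0 p q r : (0 <= orient (pt p) (pt q) (pt r)) = Z.leb Z0 (orientZ p q r).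
Proof. by rewrite orient_pt pmulr_lge0 // zr_ge0. Qed.

Lemma orient_lt0 p q r : (orient (pt p) (pt q) (pt r) < 0) = Z.ltb (orientZ p q r) Z0.
Proof. by rewrite orient_pt pmulr_llt0 // zr_lt0. Qed.

Lemma all_orient_ge0 p q S : all (fun s => 0 <= orient (pt p) (pt q) s) (map pt S) =
  all (fun s => Z.leb Z0 (orientZ p q s)) S.
Proof. by rewrite all_map; apply: eq_all => s; exact: orient_ge0. Qed.

Lemma all_orient_lt0 p q S : all (fun s => orient (pt p) (pt q) s < 0) (map pt S) =
  all (fun s => Z.ltb (orientZ p q s) Z0) S.
Proof. by rewrite all_map; apply: eq_all => s; exact: orient_lt0. Qed.

Lemma separatesP S S' z : separates S S' ->
  hull (map pt S) z -> hull (map pt S') z -> False.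
Proof.
move=> /hasP[p _ /hasP[q _ /andP[h h']]] /(_ (pt p) (pt q)) [+ _] /(_ (pt p) (pt q)) [_ +].
rewrite all_orient_ge0 all_orient_lt0.
by move=> /(_ h) a /(_ h'); rewrite ltNge a.
Qed.

Lemma apartP S S' z : apart S S' -> hull (map pt S) z -> hull (map pt S') z -> False.
Proof. by case/orP=> h a b; apply: (separatesP h); eassumption. Qed.

(** The orientation with respect to [a] and [b] is nonnegative on the hull. Along the segment it is
    affine, at most 0 at [p] and negative at [q], hence negative everywhere beyond [p]. *)
Lemma touchesP S p q z : touches S p q -> hull (map pt S) z -> seg (pt p) (pt q) z ->
  z = pt p.
Proof.
move=> /hasP[a _ /hasP[b _ /and3P[h hp hq]]] /(_ (pt a) (pt b)) [+ _].
rewrite all_orient_ge0 => /(_ h).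
move=> hz [t /andP[t0 t1] ez]; move: hz; rewrite ez orient_between.
have hp' : orient (pt a) (pt b) (pt p) <= 0.
  by rewrite leNgt; apply/negP; rewrite orient_pt pmulr_lgt0 // /zr ltr0z; case: (orientZ _ _ _) hp => //= x _; lia.
have hq' : orient (pt a) (pt b) (pt q) < 0 by rewrite orient_lt0.
move=> hz; have t00 : t = 0.
  apply/eqP; rewrite eq_le t0 andbT leNgt; apply/negP => tp.
  have : t * orient (pt a) (pt b) (pt q) < 0 by rewrite pmulr_rlt0.
  have : (1 - t) * orient (pt a) (pt b) (pt p) <= 0 by rewrite mulr_ge0_le0 // subr_ge0.
  lra.
by rewrite /between t00 !mul0r !addr0.
Qed.

Definition stdZ (p : pointZ) : bool :=
  [&& Z.leb Z0 p.1, Z.leb Z0 p.2 & Z.leb (Z.add p.1 p.2) D].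

Lemma std_pt p : stdZ p -> std (pt p).
Proof.
case/and3P=> h1 h2 h3; rewrite /std /pt /=.
have D' := zrD_gt0.
have i0 : 0 <= (zr D)^-1 by rewrite invr_ge0 ltW.
rewrite !mulr_ge0 ?zr_ge0 //= -mulrDl ler_pdivrMr // mul1r -zrD.
by rewrite -subr_ge0 -zrB zr_ge0; lia.
Qed.

End Cast.

Lemma pairwise_or (T : eqType) (r : rel T) s x y : pairwise r s ->
  x \in s -> y \in s -> x != y -> r x y || r y x.
Proof.
elim: s => //= z s IH /andP[/allP hz hs]; rewrite !inE.
case/predU1P=> [->|xs]; case/predU1P=> [->|ys] ne.
- by rewrite eqxx in ne.
- by rewrite hz.
- by rewrite hz ?orbT.
- exact: IH.
Qed.

Definition lgraph (n : nat) (E : seq (nat * nat)) : rel 'I_n :=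
  fun x y => erel E x y.

Section ListGraph.

Variables (n : nat) (E : seq (nat * nat)) (pos : seq pointZ).

Definition edges_meet (e e' : (nat * nat) * (pointZ * pointZ)) : bool :=
  let: ((a, b), (pa, pb)) := e in let: ((c, d), (pc, pd)) := e' in
  if (c == a) || (c == b) then touches [:: pa; pb] pc pd
  else if (d == a) || (d == b) then touches [:: pa; pb] pd pc
  else apart [:: pa; pb] [:: pc; pd].

Definition place (x : nat) : pointZ := nth (Z0, Z0) pos x.

Definition list_straight : bool :=
  [&& size pos == n, uniq pos &
  pairwise edges_meet [seq (e, (place e.1, place e.2)) | e <- E]].

Definition list_iso : bool := all (fun x => has (fun e => (e.1 == x) || (e.2 == x)) E) (iota 0 n).

Hypothesis E_lt : all (fun e => (e.1 < n)%N && (e.2 < n)%N) E.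

Lemma list_isoP : list_iso -> forall x : 'I_n, exists y, lgraph E x y.
Proof.
move=> /allP h x; have [|e eE] := hasP (h x _); first by rewrite mem_iota ltn_ord.
have /andP[l1 l2] := allP E_lt e eE.
case/orP=> /eqP ex; [exists (Ordinal l2) | exists (Ordinal l1)];
  by rewrite /lgraph /erel /= -ex -?surjective_pairing eE ?orbT.
Qed.

Lemma list_straightP (F : realFieldType) D : Z.lt Z0 D -> list_straight ->
  straight (@lgraph n E) (fun x => pt F D (place x)).
Proof.
move=> D0 /and3P[/eqP sp up hp]; split.
  move=> x y /(pt_inj D0) /eqP; rewrite nth_uniq ?sp //; first by move/eqP/val_inj.
have key a b c d z : (a, b) \in E -> (c, d) \in E -> (a, b) != (c, d) ->
    seg (pt F D (place a)) (pt F D (place b)) z -> seg (pt F D (place c)) (pt F D (place d)) z ->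
    exists2 w, ((w == a) || (w == b)) /\ ((w == c) || (w == d)) & z = pt F D (place w).
  move=> h h' ne s s'.
  have {}ne : ((a, b), (place a, place b)) != ((c, d), (place c, place d)).
    by apply: contra ne => /eqP[-> -> _ _].
  have inE' e : e \in E -> (e, (place e.1, place e.2)) \in [seq (e, (place e.1, place e.2)) | e <- E].
    by move=> eE; apply: (map_f (fun e => (e, (place e.1, place e.2)))).
  have ori a1 b1 c1 d1 : seg (pt F D (place a1)) (pt F D (place b1)) z ->
    seg (pt F D (place c1)) (pt F D (place d1)) z ->
    edges_meet ((a1, b1), (place a1, place b1)) ((c1, d1), (place c1, place d1)) ->
    exists2 w, ((w == a1) || (w == b1)) /\ ((w == c1) || (w == d1)) & z = pt F D (place w).
    move=> s1 s2 /=; case: ifP => [hc|_].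
      by move/(touchesP (F := F) D0) => /(_ z (hull_seg s1) s2) ->; exists c1; rewrite ?eqxx.
    case: ifP => [hd|_].
      move/(touchesP (F := F) D0) => /(_ z (hull_seg s1) (seg_sym s2)) ->; exists d1; rewrite ?eqxx ?orbT //.
    by move/(apartP (F := F) D0) => /(_ z (hull_seg s1) (hull_seg s2)).
  case/orP: (pairwise_or hp (inE' _ h) (inE' _ h') ne); first exact: ori.
  by case/(ori _ _ _ _ s' s)=> w [? ?] ?; exists w.
have key2 u v x y z : erel E u v -> erel E x y -> (u, v) != (x, y) -> (u, v) != (y, x) ->
    seg (pt F D (place u)) (pt F D (place v)) z -> seg (pt F D (place x)) (pt F D (place y)) z ->
    z = pt F D (place u) \/ z = pt F D (place v).
  have fin a b c d : (exists2 w, ((w == a) || (w == b)) /\ ((w == c) || (w == d)) & z = pt F D (place w)) ->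
      z = pt F D (place a) \/ z = pt F D (place b).
    by case=> w [/orP[]/eqP -> _] ->; [left|right].
  move=> /orP[] h1 /orP[] h2 n1 n2 s1 s2.
  - exact: fin (key _ _ _ _ _ h1 h2 n1 s1 s2).
  - exact: fin (key _ _ _ _ _ h1 h2 n2 s1 (seg_sym s2)).
  - apply/or_comm; apply: fin (key _ _ _ _ _ h1 h2 _ (seg_sym s1) s2).
    by apply: contra n2 => /eqP[-> ->].
  - apply/or_comm; apply: fin (key _ _ _ _ _ h1 h2 _ (seg_sym s1) (seg_sym s2)).
    by apply: contra n1 => /eqP[-> ->].
move=> u v x y z uv xy /eqP n1 /eqP n2.
by apply: key2.
Qed.

End ListGraph.

Local Close Scope ring_scope.

Section TableDrawing.

Variables (n : nat) (tab : seq nat) (pos : seq pointZ).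

Definition tri (u : nat) : seq pointZ :=
  [:: place pos (3 * u); place pos (3 * u + 1); place pos (3 * u + 2)].

Definition link_of (c : nat) :=
  let c' := nth (3 * n.+1)%N tab c in
  ((c %/ 3, c' %/ 3), (place pos c, place pos c'), (c, c')).

Definition link_block (l : (nat * nat) * (pointZ * pointZ) * (nat * nat)) (ut : nat * seq pointZ) : bool :=
  let: ((a, b), (p, q), _) := l in
  if a == ut.1 then touches ut.2 p q
  else if b == ut.1 then touches ut.2 q p
  else apart ut.2 [:: p; q].

Definition link_link (l l' : (nat * nat) * (pointZ * pointZ) * (nat * nat)) : bool :=
  apart [:: l.1.2.1; l.1.2.2] [:: l'.1.2.1; l'.1.2.2].

Definition table_drawing : bool :=
  let tris := [seq (u, tri u) | u <- iota 0 n.+1] in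
  let links := [seq link_of c | c <- iota 0 (3 * n.+1) & (c < nth (3 * n.+1) tab c < 3 * n.+1)%N] in
  [&& all (fun u => ~~ Z.eqb (orientZ (place pos (3 * u)) (place pos (3 * u + 1)) (place pos (3 * u + 2))) Z0)
        (iota 0 n.+1),
      pairwise (fun t t' => apart t.2 t'.2) tris,
      all (fun l => all (link_block l) tris) links
    & pairwise link_link links].

Variables (F : realFieldType) (D : Z).
Hypothesis D0 : Z.lt Z0 D.

Definition tpos (d : 'I_n.+1 * 'I_3) : F * F := pt F D (place pos (dart_code d)).

Lemma tpos_tri u : [:: tpos (u, ord0); tpos (u, inord 1); tpos (u, inord 2)] = map (pt F D) (tri u).
Proof. by rewrite /tpos /dart_code /= !inordK // addn0. Qed.

Lemma table_drawingP : table_ok n tab -> table_drawing -> base_drawing (@tnxt n tab) tpos.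
Proof.
move=> /table_okP[sy ne] /and4P[/allP h1 h2 /allP h3 h4].
have triE (u : 'I_n.+1) : (val u, tri (val u)) \in [seq (u, tri u) | u <- iota 0 n.+1].
  by apply: (map_f (fun u => (u, tri u))); rewrite mem_iota add0n (ltn_ord u).
have linkE (d d' : 'I_n.+1 * 'I_3) : tnxt tab d = Some d' -> (dart_code d < dart_code d')%N ->
    ((val d.1, val d'.1), (place pos (dart_code d), place pos (dart_code d')), (dart_code d, dart_code d')) \in
    [seq link_of c | c <- iota 0 (3 * n.+1) & (c < nth (3 * n.+1) tab c < 3 * n.+1)%N].
  move=> /tnxtP /eqP e lt; apply/mapP; exists (dart_code d).
    by rewrite mem_filter e lt dart_code_lt mem_iota add0n dart_code_lt.
  by rewrite /link_of /= e !dart_code_div.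
have lneq (d d' : 'I_n.+1 * 'I_3) : tnxt tab d = Some d' -> (dart_code d < dart_code d')%N || (dart_code d' < dart_code d)%N.
  move=> e; rewrite -neq_ltn (can_eq (@dart_codeK n)).
  by apply: contraNneq (ne _ _ e) => ->.
split.
- move=> u; have := h1 u (ltac:(by rewrite mem_iota add0n ltn_ord)).
  rewrite /tpos /dart_code /= !inordK // addn0 => h.
  rewrite (orient_pt F D) mulf_neq0 //.
    by rewrite /zr intr_eq0; apply: contra h; case: (orientZ _ _ _) => //= p /eqP; lia.
  by rewrite expf_neq0 // invr_eq0 gt_eqF // zrD_gt0.
- move=> u w z uw; rewrite !tpos_tri => hu hw.
  have un : (val u, tri (val u)) != (val w, tri (val w)).
    by rewrite xpair_eqE negb_and uw.
  case/orP: (pairwise_or h2 (triE u) (triE w) un) => /= h; first exact: (apartP D0 h hu hw).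
  exact: (apartP D0 h hw hu).
- have half (d d' : 'I_n.+1 * 'I_3) u z : tnxt tab d = Some d' -> (dart_code d < dart_code d')%N ->
     hull [:: tpos (u, ord0); tpos (u, inord 1); tpos (u, inord 2)] z -> seg (tpos d) (tpos d') z ->
     d.1 = u /\ z = tpos d \/ d'.1 = u /\ z = tpos d'.
    move=> e lt; rewrite tpos_tri => hu hs.
    have := allP (h3 _ (linkE _ _ e lt)) _ (triE u); rewrite /link_block /=.
    case: eqP => [/val_inj du|_].
      by move/(touchesP (F := F) D0)=> /(_ _ hu hs); left.
    case: eqP => [/val_inj du|_].
      by move/(touchesP (F := F) D0)=> /(_ _ hu (seg_sym hs)); right.
    by move/(apartP (F := F) D0)=> /(_ _ hu (hull_seg hs)).
  move=> d d' u z e hu hs; case/orP: (lneq _ _ e) => lt; first exact: half hu hs.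
  by apply/or_comm; apply: half hu (seg_sym hs) => //; exact: sy.
- have half (d d' c c' : 'I_n.+1 * 'I_3) z : tnxt tab d = Some d' -> tnxt tab c = Some c' -> d <> c -> d <> c' ->
      (dart_code d < dart_code d')%N -> (dart_code c < dart_code c')%N ->
      seg (tpos d) (tpos d') z -> seg (tpos c) (tpos c') z -> False.
    move=> e e' n1 n2 lt lt' s1 s2.
    have ll := pairwise_or h4 (linkE _ _ e lt) (linkE _ _ e' lt').
    have /ll : ((val d.1, val d'.1), (place pos (dart_code d), place pos (dart_code d')), (dart_code d, dart_code d'))
      != ((val c.1, val c'.1), (place pos (dart_code c), place pos (dart_code c')), (dart_code c, dart_code c')).
      by apply/eqP => -[_ _ _ _ /(can_inj (@dart_codeK n)) /n1].
    case/orP=> /= h; first exact: (apartP D0 h (hull_seg s1) (hull_seg s2)).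
    exact: (apartP D0 h (hull_seg s2) (hull_seg s1)).
  move=> d d' c c' z e e' n1 n2 s1 s2.
  have inj (x y x' : 'I_n.+1 * 'I_3) : tnxt tab x = Some y -> tnxt tab x' = Some y -> x = x'.
    by move=> /sy + /sy; move=> -> [].
  have n3 : d' <> c by move=> h; apply: n2; rewrite h in e; have := sy _ _ e; rewrite e' => -[].
  have n4 : d' <> c' by move=> h; apply: n1; apply: inj e _; rewrite h.
  case/orP: (lneq _ _ e) => lt; case/orP: (lneq _ _ e') => lt'.
  + exact: half e e' n1 n2 lt lt' s1 s2.
  + exact: half e (sy _ _ e') n2 n1 lt lt' s1 (seg_sym s2).
  + exact: half (sy _ _ e) e' n3 n4 lt lt' (seg_sym s1) s2.
  + exact: half (sy _ _ e) (sy _ _ e') n4 n3 lt lt' (seg_sym s1) (seg_sym s2).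
Qed.

End TableDrawing.

(** * Three-connectedness *)

(** A set with fewer than two elements is enlarged by vertices other than [x] and [y], of which
    there are enough in a graph with more than three vertices; deleting more only destroys paths. *)
Lemma k_connected3 (G : sgraph) : 3 < #|G| ->
  (forall (p q x y : G), p != q -> x \notin [set p; q] -> y \notin [set p; q] ->
     connect (del (@adj G) [set p; q]) x y) -> k_connected 3 G.
Proof.
move=> G3 h; split=> // X X2 x y xX yX.
have [p [q [pq px py XS]]] : exists p q : G, [/\ p != q, x \notin [set p; q],
    y \notin [set p; q] & X \subset [set p; q]].
  have [Y [XY Yxy Y2]] : exists Y : {set G}, [/\ X \subset Y, Y \subset ~: [set x; y] & #|Y| = 2].
    have c2 : 2 <= #|~: [set x; y]|.
      by move: G3; rewrite -(cardsC [set x; y]) cards2; case: (x != y); lia.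
    have sub : X \subset ~: [set x; y].
      by apply/subsetP => z zX; rewrite !inE; apply/norP; split; apply: contraTneq zX => ->.
    have [k ek] : exists k, k = 2 - #|X| by eexists.
    elim: k X X2 {xX yX} sub ek => [|k IH] X X2 sub ek; first by exists X; split=> //; lia.
    have [z zX zC] : exists2 z, z \notin X & z \in ~: [set x; y].
      apply/exists_inP; apply: contraT; rewrite negb_exists => /forallP hz.
      have : ~: [set x; y] \subset X.
        by apply/subsetP => z zC; move: (hz z); rewrite negb_and negbK zC orbF.
      by move/subset_leq_card; lia.
    have [|||Y [h1 h2 h3]] := IH (z |: X).
    - by rewrite cardsU1 zX; lia.
    - by rewrite subUset sub1set zC.
    - by rewrite cardsU1 zX; lia.
    by exists Y; split=> //; apply: subset_trans h1; exact: subsetU1.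
  have /cards2P[p [q [pq eY]]] := introT eqP Y2.
  exists p, q; rewrite -eY; split=> //; apply/negP => /(subsetP Yxy); rewrite !inE eqxx ?orbT //.
apply: connect_sub (h _ _ _ _ pq px py) => u w /and3P[u1 w1 uw]; apply: connect1.
by apply/and3P; split=> //; [apply: contra u1 | apply: contra w1] => /(subsetP XS).
Qed.

(** * Three-connectedness by graph search *)

Section Reach.

Variables (E : seq (positive * positive)) (V : seq positive).

Definition sweep (S : PM.t unit) : PM.t unit :=
  foldl (fun S e => if PM.mem e.1 S then PM.add e.2 tt S
                    else if PM.mem e.2 S then PM.add e.1 tt S else S) S E.

Fixpoint reach_all (fuel : nat) (S : PM.t unit) : bool :=
  all (fun x => PM.mem x S) V || if fuel is k.+1 then reach_all k (sweep S) else false.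

Lemma reach_allP (P : positive -> Prop) k S :
  (forall e, e \in E -> P e.1 <-> P e.2) -> (forall x, PM.mem x S -> P x) ->
  reach_all k S -> forall x, x \in V -> P x.
Proof.
move=> hE; have addP a S' : (forall x, PM.mem x S' -> P x) -> P a ->
    forall x, PM.mem x (PM.add a tt S') -> P x.
  move=> hS Pa x /PositiveMap.mem_2 [t]; have [->//|xa] := eqVneq x a.
  move=> h; apply: hS; apply: PositiveMap.mem_1; exists t.
  by apply: PositiveMap.add_3 h => /esym/eqP; apply/negP.
elim: k S => [|k IH] S hS /=; first by rewrite orbF => /allP h x /h /hS.
case/orP=> [/allP h x /h /hS //|]; apply: IH.
rewrite /sweep; elim: E hE S hS => //= e l IHl hl S hS; apply: IHl.
  by move=> e' e'l; apply: hl; rewrite inE e'l orbT.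
have he := hl e (mem_head _ _).
case: ifP => [/hS /he h|_]; first exact: addP.
by case: ifP => [/hS /he h|_]; first exact: addP.
Qed.

End Reach.

Definition conn3_pair (E : seq (positive * positive)) (V : seq positive) (p q : positive) : bool :=
  let ok x := ~~ Pos.eqb x p && ~~ Pos.eqb x q in
  let V' := filter ok V in
  if V' is s :: _ then
    reach_all [seq e <- E | ok e.1 && ok e.2] V' (size V) (PM.add s tt (PM.empty unit))
  else true.

Definition conn3 (n : nat) (E : seq (nat * nat)) : bool :=
  let kE := [seq (Pos.of_succ_nat e.1, Pos.of_succ_nat e.2) | e <- E] in
  let kV := [seq Pos.of_succ_nat x | x <- iota 0 n] in
  pairwise (conn3_pair kE kV) kV.

Lemma conn3P n E : all (fun e => (e.1 < n) && (e.2 < n)) E -> conn3 n E ->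
  forall p q x y : 'I_n, p != q -> x \notin [set p; q] -> y \notin [set p; q] ->
  connect (del (@lgraph n E) [set p; q]) x y.
Proof.
move=> /allP hE hc p q x y pq; set k := Pos.of_succ_nat.
have kI : injective k by exact: SuccNat2Pos.inj.
have e_sym : symmetric (@lgraph n E) by move=> a b; exact: erel_sym.
have cs X := sym_connect_sym (del_sym X e_sym).
pose ok (p q : 'I_n) (z : positive) := ~~ Pos.eqb z (k p) && ~~ Pos.eqb z (k q).
have key (p' q' : 'I_n) : [set p'; q'] = [set p; q] ->
    conn3_pair [seq (k e.1, k e.2) | e <- E] [seq k x | x <- iota 0 n] (k p') (k q') ->
    x \notin [set p; q] -> y \notin [set p; q] -> connect (del (@lgraph n E) [set p; q]) x y.
  move=> <-; rewrite /conn3_pair -/(ok p' q').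
  have okE (z : 'I_n) : ok p' q' (k z) = (z \notin [set p'; q']).
    rewrite /ok !inE negb_or; congr (~~ _ && ~~ _).
      by apply/idP/eqP => [/Pos.eqb_eq /kI /val_inj //|->]; exact: Pos.eqb_refl.
    by apply/idP/eqP => [/Pos.eqb_eq /kI /val_inj //|->]; exact: Pos.eqb_refl.
  have memV (z : 'I_n) : z \notin [set p'; q'] -> k z \in filter (ok p' q') [seq k x | x <- iota 0 n].
    by move=> hz; rewrite mem_filter okE hz map_f // mem_iota add0n ltn_ord.
  case EV: (filter (ok p' q') _) => [|s V'] h xX yX.
    by have := memV _ xX; rewrite EV.
  have : s \in filter (ok p' q') [seq k x | x <- iota 0 n] by rewrite EV mem_head.
  rewrite mem_filter => /andP[sok /mapP[s0]]; rewrite mem_iota add0n => /= s0n es.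
  pose so := Ordinal s0n.
  have sX : so \notin [set p'; q'] by rewrite -okE -es.
  pose P z := exists2 z' : 'I_n, z = k z' & connect (del (@lgraph n E) [set p'; q']) so z'.
  have hP : forall z, z \in s :: V' -> P z.
    apply: (reach_allP (E := [seq e <- [seq (k e.1, k e.2) | e <- E] | ok p' q' e.1 && ok p' q' e.2])) h => [e|z].
      rewrite mem_filter => /andP[/andP[o1 o2] /mapP[[a b] abE ee]].
      have /andP[/= an bn] := hE _ abE.
      rewrite ee /= in o1 o2 *.
      rewrite -[a]/(val (Ordinal an)) -[b]/(val (Ordinal bn)) !okE in o1 o2 *.
      have ad : del (@lgraph n E) [set p'; q'] (Ordinal an) (Ordinal bn).
        by rewrite /del /= o1 o2 /lgraph /erel /= abE.
      split=> -[z' /kI /val_inj <- c]; eexists; try reflexivity.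
        by apply: connect_trans c (connect1 ad).
      by apply: connect_trans c (connect1 _); rewrite del_sym.
    move=> /PositiveMap.mem_2 [t]; have [->|zs] := eqVneq z s.
      by move=> _; exists so.
    have sz : s <> z by apply/eqP; rewrite eq_sym.
    move=> h0; have : PM.MapsTo z t (PM.empty unit) by apply: PositiveMap.add_3 h0.
    by rewrite /PositiveMap.MapsTo PositiveMap.gempty.
  have cP (z : 'I_n) : z \notin [set p'; q'] -> connect (del (@lgraph n E) [set p'; q']) so z.
    by move/memV; rewrite EV => /hP [z' /kI /val_inj <-].
  by apply: connect_trans (cP _ yX); rewrite cs cP.
have pk : k p != k q by apply: contra pq => /eqP /kI /val_inj ->.
have mk (z : 'I_n) : k z \in [seq k x | x <- iota 0 n] by rewrite map_f // mem_iota add0n ltn_ord.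
case/orP: (pairwise_or hc (mk p) (mk q) pk); apply: key => //.
by rewrite setUC.
Qed.

Section Apex.

Variables (n : nat) (E : seq (nat * nat)) (n3 : 3 <= n).
Hypotheses (E_lt : all (fun e => (e.1 < n) && (e.2 < n)) E)
  (hc : conn3 n.+1 (E ++ [:: (0, n); (1, n); (2, n)])).

Definition lterm : 'I_3 -> 'I_n := widen_ord n3.

Lemma lterm_inj : injective lterm.
Proof. by move=> i j e; apply: val_inj; exact: (congr1 val e). Qed.

Let E' := E ++ [:: (0, n); (1, n); (2, n)].
Let w : 'I_n -> 'I_n.+1 := widen_ord (leqnSn n).

Let conn : forall p q x y : 'I_n.+1, p != q -> x \notin [set p; q] -> y \notin [set p; q] ->
  connect (del (@lgraph n.+1 E') [set p; q]) x y.
Proof.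
apply: (conn3P _ hc); rewrite all_cat; apply/andP; split.
  apply: (sub_all _ E_lt) => e /andP[h1 h2].
  by rewrite (ltn_trans h1 (ltnSn n)) (ltn_trans h2 (ltnSn n)).
by rewrite /= ltnSn !ltnS (ltnW (ltnW n3)) (ltnW n3).
Qed.

Let wI : injective w. Proof. by move=> i j e; apply: val_inj; exact: (congr1 val e). Qed.

Let wE x y : lgraph E' (w x) (w y) = lgraph E x y.
Proof.
rewrite /lgraph /erel /E' !mem_cat /= !inE /= !xpair_eqE.
by rewrite !(ltn_eqF (ltn_ord _)) !andbF !orbF.
Qed.

Let apexE (x : 'I_n) : lgraph E' (w x) ord_max -> exists k, x = lterm k.
Proof.
have nE a b : a = n \/ b = n -> (a, b) \notin E.
  by move=> ab; apply/negP => /(allP E_lt) /=; case: ab => ->; rewrite ltnn ?andbF.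
rewrite /lgraph /erel /E' !mem_cat /= !inE /= !xpair_eqE.
rewrite !(ltn_eqF (ltn_ord _)) !eqxx (negbTE (nE _ _ (or_intror erefl))) (negbTE (nE _ _ (or_introl erefl))) /=.
rewrite !andbF !andbT !orbF => h; have x3 : x < 3 by move: h => /or3P[]/eqP ->.
by exists (Ordinal x3); apply: val_inj.
Qed.

Let liftE (y : 'I_n.+1) : y != ord_max -> exists y0, y = w y0.
Proof.
by case: (unliftP ord_max y) => [y0 ->|->]; rewrite ?eqxx // => _; exists y0; apply: val_inj; rewrite /= /bump leqNgt ltn_ord.
Qed.

Lemma apex_conn1 : conn1 (@lgraph n E).
Proof.
move=> p x y xp yp.
have nin z : z != p -> w z \notin [set w p; ord_max].
  by move=> zp; rewrite !inE (inj_eq wI) negb_or zp /= -val_eqE /= (ltn_eqF (ltn_ord z)).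
have wpm : w p != ord_max by rewrite -val_eqE /= (ltn_eqF (ltn_ord p)).
have := conn wpm (nin _ xp) (nin _ yp).
case/connectP=> s; elim: s x xp => [|z s IH] x xp /=; first by move=> _ /wI ->.
case/andP=> /and3P[_ zX xz] ps.
have [z0 ez] : exists z0, z = w z0 by apply: liftE; move: zX; rewrite !inE negb_or => /andP[].
rewrite ez in zX xz ps * => ly; have z0p : z0 != p.
  by move: zX; rewrite !inE negb_or (inj_eq wI) => /andP[].
apply: connect_trans (IH z0 z0p ps ly); apply: connect1.
by rewrite /del /= !inE xp z0p -wE.
Qed.

(** A path from [x] to the apex that survives the deletion of [p] and [q] enters the apex from a
    terminal. *)
Lemma apex_conn2_to : conn2_to (@lgraph n E) lterm.
Proof.
move=> p q x pq xpq.
have wpq z : (w z \in [set w p; w q]) = (z \in [set p; q]) by rewrite !inE !(inj_eq wI).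
have mpq : ord_max \notin [set w p; w q].
  by rewrite !inE -!val_eqE /= !(gtn_eqF (ltn_ord _)).
have wpq' : w p != w q by rewrite (inj_eq wI).
have := conn wpq' (_ : w x \notin _) mpq; rewrite wpq => /(_ xpq) /connectP[s]; elim: s x xpq => [|z s IH] x xpq /=.
  by move=> _ e; have := ltn_ord x; rewrite -[val x]/(val (w x)) -e /= ltnn.
case/andP=> /and3P[_ zX xz] ps ls; have [zm|zm] := eqVneq z ord_max.
  move: xz; rewrite zm => /apexE [k ek]; exists k; rewrite -ek //.
have [z0 ez] := liftE zm; rewrite ez wpq in zX; rewrite ez in xz ps ls.
have [k kX c] := IH z0 zX ps ls; exists k => //.
apply: connect_trans c; apply: connect1.
by rewrite /del /= xpq zX -wE.
Qed.

End Apex.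

(** * Long paths through a piece *)

Lemma join_paths (T : eqType) (e : rel T) a s b s' :
  path e a s -> uniq (a :: s) -> path e b s' -> uniq (b :: s') -> e (last a s) b ->
  ~~ has (mem (a :: s)) (b :: s') -> path e a (s ++ b :: s') /\ uniq (a :: s ++ b :: s').
Proof.
move=> p1 u1 p2 u2 ab ds; split; first by rewrite cat_path p1 /= ab.
by rewrite -cat_cons cat_uniq u1 ds u2.
Qed.

Lemma two_of_three (i j k : 'I_3) : i != j -> i != k -> j != k ->
  forall a, a != k -> a = i \/ a = j.
Proof.
rewrite -!val_eqE /= => ij ik jk a; rewrite -val_eqE /= => ak.
have : (val a == val i) || (val a == val j).
  by move: (ltn_ord i) (ltn_ord j) (ltn_ord k) (ltn_ord a) ij ik jk ak => /=; lia.
by case/orP=> /eqP/val_inj; [left | right].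
Qed.

Lemma third (i j : 'I_3) : exists k, i != k /\ j != k.
Proof.
have [k /andP[ki kj]] := avoid2 (f := id) i j (@inj_id _).
by exists k; rewrite !(eq_sym _ k).
Qed.

Section Passes.

Variables (V : eqType) (e : rel V) (term : 'I_3 -> V).

Definition is_pass (i j : 'I_3) (t : nat) (s : seq V) : Prop :=
  [/\ path e (term i) s, uniq (term i :: s), last (term i) s = term j & (size s).+1 = t].

(* The passes join the two terminals other than [k]; they may visit [term k], but
   do not leave the piece through it. *)
Definition has_pass (t : nat) (bad : pred V) (k : 'I_3) : Prop :=
  forall i j, i != j -> i != k -> j != k ->
  exists2 s, is_pass i j t s & ~~ has bad (term i :: s).

Definition has_end (t : nat) (bad : pred V) (i : 'I_3) : Prop :=
  exists s, [/\ path e (term i) s, uniq (term i :: s), (size s).+1 = t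
    & ~~ has bad (term i :: s)].

Hypothesis e_sym : symmetric e.

Lemma rev_path_sym a s : path e a s ->
  exists s', [/\ path e (last a s) s', last (last a s) s' = a,
    last a s :: s' = rev (a :: s) & size s' = size s].
Proof.
move=> p; exists (behead (rev (a :: s))).
have er : rev (a :: s) = last a s :: behead (rev (a :: s)).
  by case/lastP: s {p} => [|s x]; rewrite ?last_rcons // -rcons_cons rev_rcons.
split=> //; last by rewrite size_behead size_rev.
  by move: p; rewrite -(eq_path (e := fun x y => e y x)) => [|x y]; rewrite 1?e_sym // -rev_path lastI rev_rcons.
by rewrite -(last_cons a) -er rev_cons last_rcons.
Qed.

Lemma has_pass_intro t bad i j k s : i != j -> i != k -> j != k ->
  is_pass i j t s -> ~~ has bad (term i :: s) -> has_pass t bad k.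
Proof.
move=> ij ik jk h hb i' j' ij' ik' jk'.
have two := two_of_three ij ik jk.
case: (two i' ik') => ei; case: (two j' jk') => ej.
- by rewrite ei ej eqxx in ij'.
- by rewrite ei ej; exists s.
- rewrite ei ej; case: h => p u l sz; have [s' [p' l' er sz']] := rev_path_sym p.
  rewrite l in p' l' er; exists s'; first split=> //.
  + by rewrite er rev_uniq.
  + by rewrite sz'.
  by rewrite er has_rev.
- by rewrite ei ej eqxx in ij'.
Qed.

End Passes.

(** * Walks of the base graph and their expansion *)

Section Walks.

Variables (B Q : finType) (adjQ : rel Q) (term : 'I_3 -> Q)
  (nxt : B * 'I_3 -> option (B * 'I_3)).
Hypotheses (adjQ_sym : symmetric adjQ).

Let e := cadj adjQ term nxt.

(* [((u, i), j)] enters block [u] at port [i] and leaves it at port [j]. *)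
Definition step : Type := ((B * 'I_3) * 'I_3)%type.
HB.instance Definition _ := Equality.on step.

Definition wlink (x y : step) : bool := nxt (x.1.1, x.2) == Some y.1.

Definition walk (x : step) (w : seq step) : bool :=
  [&& path wlink x w, uniq [seq y.1.1 | y <- x :: w] & all (fun y => y.1.2 != y.2) (x :: w)].

Definition routed (t : nat) (bad : pred (B * Q)) (y : step) : Prop :=
  exists2 s, is_pass adjQ term y.1.2 y.2 t s & ~~ has (fun q => bad (y.1.1, q)) (term y.1.2 :: s).

Lemma link_cadj u i w j : nxt (u, i) = Some (w, j) -> e (u, term i) (w, term j).
Proof. by move=> h; apply/orP; right; apply/linkP; exists i, j. Qed.

Lemma block_path u a s : path adjQ a s -> path e (u, a) [seq (u, q) | q <- s].
Proof.
rewrite path_map; apply: sub_path => x y /= h.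
by rewrite /e /cadj /= eqxx h.
Qed.

Lemma pair_inj (u : B) : injective (@pair B Q u). Proof. by move=> x y []. Qed.

Lemma block_has (bad : pred (B * Q)) u s :
  has bad [seq (u, q) | q <- s] = has (fun q => bad (u, q)) s.
Proof. by rewrite has_map. Qed.

Lemma expand_walk t bad x w : walk x w -> (forall y, y \in x :: w -> routed t bad y) ->
  exists s, [/\ path e (x.1.1, term x.1.2) s, uniq ((x.1.1, term x.1.2) :: s),
    last (x.1.1, term x.1.2) s = ((last x w).1.1, term (last x w).2),
    (size s).+1 = (size w).+1 * t /\ ~~ has bad ((x.1.1, term x.1.2) :: s)
    & {subset [seq z.1 | z <- (x.1.1, term x.1.2) :: s] <= [seq y.1.1 | y <- x :: w]}].
Proof.
elim: w x => [|y w IH] x /and3P[pw uw io] hr.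
  have [s [ps us ls ss] hb] := hr x (mem_head _ _).
  exists [seq (x.1.1, q) | q <- s]; split.
  - exact: block_path.
  - by rewrite -(map_cons (pair x.1.1) (term _)) (map_inj_uniq (pair_inj (u := _))).
  - by rewrite last_map ls.
  - by rewrite -(map_cons (pair x.1.1) (term _)) block_has size_map mul1n.
  - move=> u; rewrite -(map_cons (pair x.1.1) (term _)) -map_comp => /mapP[q _ ->].
    by rewrite mem_head.
have [s [ps us ls ss] hb] := hr x (mem_head _ _).
have [xy pw'] : nxt (x.1.1, x.2) = Some y.1 /\ path wlink y w by case/andP: pw => /eqP.
have [||s' [ps' us' ls' [ss' hb'] sub]] := IH y.
- by apply/and3P; split=> //; [case/andP: uw | case/andP: io].
- by move=> z zw; apply: hr; rewrite inE zw orbT.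
have ez : (x.1.1, term x.1.2) :: [seq (x.1.1, q) | q <- s] = [seq (x.1.1, q) | q <- term x.1.2 :: s] by [].
have [||||||p u] := @join_paths _ e (x.1.1, term x.1.2) [seq (x.1.1, q) | q <- s] (y.1.1, term y.1.2) s'.
- exact: block_path.
- by rewrite ez (map_inj_uniq (pair_inj (u := _))).
- exact: ps'.
- exact: us'.
- by rewrite last_map ls; apply: link_cadj; rewrite xy -surjective_pairing.
- apply/hasPn => z zs'; apply/negP; rewrite /= ez => /mapP[q _ eq].
  have : z.1 \in [seq y.1.1 | y <- y :: w] by apply: sub; apply: map_f.
  by rewrite eq /=; case/andP: uw => /negP.
exists ([seq (x.1.1, q) | q <- s] ++ (y.1.1, term y.1.2) :: s'); split=> //.
- by rewrite last_cat last_cons ls'.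
- split; first by rewrite size_cat size_map -addSn ss /= ss' mulSn.
  by rewrite -cat_cons has_cat negb_or ez block_has hb hb'.
- move=> u'; rewrite -cat_cons map_cat mem_cat => /orP[].
    by rewrite ez -map_comp => /mapP[q _ ->]; rewrite mem_head.
  by move/sub => h; rewrite map_cons in_cons h orbT.
Qed.

End Walks.

Section Routes.

Variables (B Q : finType) (adjQ : rel Q) (term : 'I_3 -> Q) (tau : Q -> 'I_3) (t : nat)
  (nxt : B * 'I_3 -> option (B * 'I_3)) (ext : 'I_3 -> B * 'I_3).
Hypotheses (adjQ_sym : symmetric adjQ)
  (tau_pass : forall x, has_pass adjQ term t (pred1 x) (tau x))
  (tau_surj : forall k, exists x, tau x = k)
  (Q_end : forall i, has_end adjQ term t.+1 pred0 i)
  (nxt_sym : forall d d', nxt d = Some d' -> nxt d' = Some d)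
  (ext_None : forall d, nxt d = None <-> exists k, ext k = d)
  (ext_block : injective (fun k => (ext k).1)).

Definition avoids (d : B * 'I_3) (y : step B) : bool :=
  (y.1.1 == d.1) ==> (d.2 != y.1.2) && (d.2 != y.2).

(** At most one vertex has to be missed in a visited block. A block with neither vertex still gets a
    pass of size [t], one that misses some [q] whose terminal is the third. *)
Lemma route_step (x1 x2 : B * Q) (y : step B) : y.1.2 != y.2 ->
  avoids (x1.1, tau x1.2) y -> avoids (x2.1, tau x2.2) y ->
  (x1.1 = x2.1 -> y.1.1 = x1.1 -> x1 = x2) ->
  routed adjQ term t (pred2 x1 x2) y.
Proof.
case: y x1 x2 => [[u i] j] [u1 q1] [u2 q2]; rewrite /avoids /routed /= => ij.
have single q : tau q != i -> tau q != j -> exists2 s, is_pass adjQ term i j t s &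
    ~~ has (pred1 q) (term i :: s).
  by move=> h1 h2; apply: (@tau_pass q i j ij); rewrite eq_sym.
have hq s (bad : pred (B * Q)) q : ~~ has (pred1 q) s -> (forall z, bad (u, z) -> z = q) ->
    ~~ has (fun z => bad (u, z)) s.
  by move=> h hb; apply: contra h => /hasP[z zs /hb e]; apply/hasP; exists z; rewrite //= e.
have [k [ik jk]] := third i j; have [q eq] := tau_surj k.
move=> a1 a2 a12; have [e1|n1] := eqVneq u u1; have [e2|n2] := eqVneq u u2.
- have [q12] : (u1, q1) = (u2, q2) := a12 (etrans (esym e1) e2) e1.
  move=> qq; have /andP[b1 c1] := implyP a1 (introT eqP e1).
  have [s h hb] := single _ b1 c1; exists s => //; apply: (hq _ (pred2 (u1, q1) (u2, q2)) _ hb) => z.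
  by rewrite /= qq q12 orbb => /eqP[_ ->].
- have /andP[b1 c1] := implyP a1 (introT eqP e1).
  have [s h hb] := single _ b1 c1; exists s => //; apply: (hq _ (pred2 (u1, q1) (u2, q2)) _ hb) => z.
  by rewrite /= !xpair_eqE e1 eqxx -[u1]e1 (negbTE n2) orbF => /eqP.
- have /andP[b1 c1] := implyP a2 (introT eqP e2).
  have [s h hb] := single _ b1 c1; exists s => //; apply: (hq _ (pred2 (u1, q1) (u2, q2)) _ hb) => z.
  by rewrite /= !xpair_eqE (negbTE n1) andFb e2 eqxx => /eqP.
- have [s h hb] : exists2 s, is_pass adjQ term i j t s & ~~ has (pred1 q) (term i :: s).
    by apply: single; rewrite eq eq_sym.
  exists s => //; apply: (hq _ (pred2 (u1, q1) (u2, q2)) _ hb) => z.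
  by rewrite /= !xpair_eqE (negbTE n1) (negbTE n2).
Qed.

(** The offset 2 in the size says that the walk visits all blocks but one. *)
Definition base_pass (i j : 'I_3) (x : step B) (w : seq (step B)) : Prop :=
  [/\ walk nxt x w, x.1 = ext i, ((last x w).1.1, (last x w).2) = ext j & (size w).+2 = #|B|].

Definition tied (x : B * Q) (k : 'I_3) : Prop := ext k = (x.1, tau x.2).

Hypotheses
  (base_passes : forall d d', (forall k k', d = ext k -> d' = ext k' -> k = k') ->
     exists i j x w, [/\ i != j, base_pass i j x w, all (avoids d) (x :: w) & all (avoids d') (x :: w)])
  (base_ends : forall i, exists x w d,
     [/\ walk nxt x w, x.1 = ext i, nxt ((last x w).1.1, (last x w).2) = Some d,
       d.1 \notin [seq y.1.1 | y <- x :: w] /\ (size w).+2 = #|B| &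
       forall j, j != i -> (ext j).1 != d.1 /\ all (avoids (ext j)) (x :: w)]).

Let e := cadj adjQ term nxt.
Let e_sym : symmetric e := cadj_sym term adjQ_sym nxt_sym.

(** A step uses two of the three ports of its block. So a step avoiding two ports of [u] is not in
    [u], and then avoids the third one as well. *)
Lemma avoids_block u y d : y.1.2 != y.2 -> avoids (u, ord0) y -> avoids (u, inord 1) y ->
  d.1 = u -> avoids d y.
Proof.
move=> ij h0 h1 du; apply/implyP; rewrite du => hu; exfalso.
move: (implyP h0 hu) (implyP h1 hu) ij => /= /andP[a0 b0] /andP[a1 b1].
move: a0 b0 a1 b1; rewrite -!val_eqE /= inordK //.
by move: (ltn_ord y.1.2) (ltn_ord y.2) => /=; lia.
Qed.

Lemma walk_routed (x y : B * Q) (x0 : step B) w : walk nxt x0 w ->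
  (x.1 = y.1 -> x <> y -> all (avoids (x.1, ord0)) (x0 :: w) /\ all (avoids (x.1, inord 1)) (x0 :: w)) ->
  (x.1 <> y.1 \/ x = y -> all (avoids (x.1, tau x.2)) (x0 :: w) /\ all (avoids (y.1, tau y.2)) (x0 :: w)) ->
  forall z, z \in x0 :: w -> routed adjQ term t (pred2 x y) z.
Proof.
move=> /and3P[_ _ /allP hio] h1 h2 z zw; have zio := hio z zw.
have [[xy ne]|d] : (x.1 = y.1 /\ x <> y) \/ (x.1 <> y.1 \/ x = y).
  have [xy|/eqP xy] := eqVneq x.1 y.1; last by right; left.
  by have [exy|/eqP exy] := eqVneq x y; [right; right | left].
- have [/allP a0 /allP a1] := h1 xy ne; have := a0 z zw; have := a1 z zw => b1 b0.
  apply: route_step => //; try exact: (avoids_block zio b0 b1).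
  by move=> _ hz; have := avoids_block (d := z.1) zio b0 b1 hz; rewrite /avoids !eqxx.
- have [/allP a0 /allP a1] := h2 d; apply: route_step => //; [exact: a0 | exact: a1|].
  by case: d => // d /d.
Qed.

Lemma composite_pass (x y : B * Q) i j x0 w k : base_pass i j x0 w -> i != j -> i != k -> j != k ->
  (forall z, z \in x0 :: w -> routed adjQ term t (pred2 x y) z) ->
  has_pass e (cterm term ext) (#|B|.-1 * t) (pred2 x y) k.
Proof.
case=> hw h0 hl hs ij ik jk hr; have [s [ps us ls [ss hb] _]] := expand_walk hw hr.
have et : (x0.1.1, term x0.1.2) = cterm term ext i by rewrite /cterm -h0.
rewrite et in ps us ls hb; apply: (has_pass_intro e_sym ij ik jk (s := s)) => //.
split=> //; last by rewrite ss -hs.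
by rewrite ls /cterm -hl.
Qed.

(** For distinct vertices of one block, the walk is made to skip that block by avoiding its ports 0
    and 1. Different exits lie in different blocks, so these two ports are not both exits. Otherwise
    the two darts to avoid are those given by [tau]. *)
Lemma composite_pass2 (x y : B * Q) : (forall k k', tied x k -> tied y k' -> k = k') ->
  exists k, has_pass e (cterm term ext) (#|B|.-1 * t) (pred2 x y) k.
Proof.
move=> ht; have [/andP[/eqP xy ne]|nd] := boolP ((x.1 == y.1) && (x != y)).
  have [|i [j [x0 [w [ij hp a0 a1]]]]] := base_passes (d := (x.1, ord0)) (d' := (x.1, inord 1)).
    by move=> k k' e1 e2; apply: ext_block; rewrite /= -e1 -e2.
  have [k [ik jk]] := third i j; exists k; apply: (composite_pass hp) => //.
  case: hp => hw _ _ _; apply: (walk_routed hw) => // -[] // e0; by rewrite ?e0 ?eqxx // in ne.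
have [|i [j [x0 [w [ij hp a0 a1]]]]] := base_passes (d := (x.1, tau x.2)) (d' := (y.1, tau y.2)).
  by move=> k k' /esym e1 /esym e2; exact: ht.
have [k [ik jk]] := third i j; exists k; apply: (composite_pass hp) => //.
case: hp => hw _ _ _; apply: (walk_routed hw) => // exy ne.
by case/negP: nd; rewrite exy eqxx; apply/eqP.
Qed.

(** Avoiding [ext k] as the second dart forces the walk to join the two other exits. *)
Lemma composite_pass1 (x : B * Q) k : (forall k', tied x k' -> k' = k) ->
  has_pass e (cterm term ext) (#|B|.-1 * t) (pred2 x x) k.
Proof.
move=> ht.
have [|i [j [x0 [w [ij hp a0 a1]]]]] := base_passes (d := (x.1, tau x.2)) (d' := ext k).
  by move=> k1 k2 /esym /ht -> e2; apply: ext_block; rewrite /= e2.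
have [hw h0 hl _] := hp.
apply: (composite_pass hp) => //.
- apply/eqP => ik; move/allP: a1 => /(_ x0 (mem_head _ _)).
  by rewrite /avoids h0 ik !eqxx.
- apply/eqP => jk; move/allP: a1 => /(_ _ (mem_last _ _)).
  by rewrite /avoids -jk -hl !eqxx andbF.
- by apply: (walk_routed hw) => // _; rewrite a0.
Qed.

(** The walk passes all blocks but one with [t] vertices each, and the path then ends in the last
    block, where it takes [t.+1]. The vertices [x] and [y] lie in blocks of exits other than [i],
    hence not in the last block. *)
Lemma composite_end (x y : B * Q) i : (exists2 j, j != i & tied x j) -> (exists2 j, j != i & tied y j) ->
  (x.1 = y.1 -> x = y) ->
  has_end e (cterm term ext) (#|B|.-1 * t + t.+1) (pred2 x y) i.
Proof.
move=> [j ji tx] [j' ji' ty] xy; have [x0 [w [d [hw h0 hd [dn sw] hj]]]] := base_ends i.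
have [dx ax] := hj j ji; have [dy ay] := hj j' ji'.
rewrite tx in dx ax; rewrite ty in dy ay; rewrite /= in dx dy.
have hr := walk_routed (x := x) (y := y) hw.
have {}hr : forall z, z \in x0 :: w -> routed adjQ term t (pred2 x y) z.
  by apply: hr => [exy ne|_]; [case: ne; exact: xy | rewrite ax ay].
have [s [ps us ls [ss hb] sub]] := expand_walk hw hr.
have et : (x0.1.1, term x0.1.2) = cterm term ext i by rewrite /cterm -h0.
rewrite et in ps us ls hb sub.
have [s' [ps' us' ss' _]] := Q_end d.2.
have ez : (d.1, term d.2) :: [seq (d.1, q) | q <- s'] = [seq (d.1, q) | q <- term d.2 :: s'] by [].
have [||||||p u] := @join_paths _ e (cterm term ext i) s (d.1, term d.2) [seq (d.1, q) | q <- s'].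
- exact: ps.
- exact: us.
- exact: block_path.
- by rewrite ez (map_inj_uniq (pair_inj (u := _))).
- by rewrite ls; apply: link_cadj; rewrite hd -surjective_pairing.
- apply/hasPn => z zs'; apply/negP => /= zs; move: zs'; rewrite ez => /mapP[q _ ezq].
  by move: dn; rewrite -[d.1]/((d.1, q).1) -ezq sub // map_f.
exists (s ++ (d.1, term d.2) :: [seq (d.1, q) | q <- s']); split=> //.
- by rewrite size_cat /= size_map -addSn ss ss' -sw.
- rewrite -cat_cons has_cat negb_or hb ez has_map; apply/hasPn => q _ /=.
  apply/negP => /orP[]/eqP eq; [move: dx | move: dy]; by rewrite -eq eqxx.
Qed.

End Routes.

(** * Long paths in the composites of the complete graph on four blocks *)

Section Orders.

(* A path runs through the blocks [k1], [k2], [k3], [k4] in this order and shall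
   avoid a vertex of block [z]; [s] is the block to which that vertex is tied, or
   [z] itself. *)
Definition order_ok (T : eqType) (k1 k2 k3 k4 z s : T) : bool :=
  [&& (k1 == z) ==> (s != z) && (s != k2), (k2 == z) ==> (s == z) || (s == k4),
      (k3 == z) ==> (s == z) || (s == k1) & (k4 == z) ==> (s != z) && (s != k3)].

Definition nat_order_ok (x y sx sy : nat) (o : seq nat) : bool :=
  if o is [:: k1; k2; k3; k4] then order_ok k1 k2 k3 k4 x sx && order_ok k1 k2 k3 k4 y sy else false.

Lemma order_exists (x y sx sy : 'I_4) : x != y -> exists k1 k2 k3 k4 : 'I_4,
  [/\ uniq [:: k1; k2; k3; k4], order_ok k1 k2 k3 k4 x sx & order_ok k1 k2 k3 k4 y sy].
Proof.
have : all (fun x => all (fun y => all (fun sx => all (fun sy =>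
    (x != y) ==> has (nat_order_ok x y sx sy) (permutations (iota 0 4)))
  (iota 0 4)) (iota 0 4)) (iota 0 4)) (iota 0 4) by vm_compute.
have io (z : 'I_4) : (val z) \in iota 0 4 by rewrite mem_iota ltn_ord.
move=> /allP/(_ _ (io x))/allP/(_ _ (io y))/allP/(_ _ (io sx))/allP/(_ _ (io sy)).
move=> /implyP h xy; have /hasP[o] := h xy; rewrite mem_permutations => po.
have o4 z : z \in o -> z < 4 by rewrite (perm_mem po) mem_iota.
have uo : uniq o by rewrite (perm_uniq po).
case: o po o4 uo => [|a [|b [|c [|d [|? ?]]]]] // _ o4 uo.
have [ha hb hc hd] : [/\ a < 4, b < 4, c < 4 & d < 4].
  by split; apply: o4; rewrite !inE eqxx ?orbT.
case/andP=> h1 h2; exists (Ordinal ha), (Ordinal hb), (Ordinal hc), (Ordinal hd).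
split; [|by move: h1; rewrite /order_ok -!val_eqE | by move: h2; rewrite /order_ok -!val_eqE].
by rewrite -(map_inj_uniq val_inj).
Qed.

End Orders.

Section Four.

Variables (P : finType) (adjP : rel P) (term : 'I_3 -> P) (t T : nat)
  (nxt : 'I_4 * 'I_3 -> option ('I_4 * 'I_3)).
Hypotheses (adjP_sym : symmetric adjP)
  (nxt_sym : forall d d', nxt d = Some d' -> nxt d' = Some d)
  (nxt_neq : forall d d', nxt d = Some d' -> d.1 != d'.1)
  (nxt_closed : forall d, nxt d)
  (linked : forall k l, k != l -> exists i j, nxt (k, i) = Some (l, j))
  (simple : forall k l i i' j j', nxt (k, i) = Some (l, j) -> nxt (k, i') = Some (l, j') -> i = i').

Let e := cadj adjP term nxt.

Definition toward (k : 'I_4) (i : 'I_3) (l : 'I_4) : Prop := exists j, nxt (k, i) = Some (l, j).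

Lemma prepend (bad : pred ('I_4 * P)) u a s i w j r :
  path adjP a s -> uniq (a :: s) -> last a s = term i -> nxt (u, i) = Some (w, j) ->
  path e (w, term j) r -> uniq ((w, term j) :: r) -> u \notin [seq z.1 | z <- (w, term j) :: r] ->
  ~~ has (fun q => bad (u, q)) (a :: s) -> ~~ has bad ((w, term j) :: r) ->
  exists l, [/\ path e (u, a) l, uniq ((u, a) :: l), size ((u, a) :: l) = size (a :: s) + size ((w, term j) :: r),
    ~~ has bad ((u, a) :: l) & {subset [seq z.1 | z <- (u, a) :: l] <= u :: [seq z.1 | z <- (w, term j) :: r]}].
Proof.
move=> ps us ls hn pr ur un bs br.
have ez : (u, a) :: [seq (u, q) | q <- s] = [seq (u, q) | q <- a :: s] by [].
have [||||||p uu] := @join_paths _ e (u, a) [seq (u, q) | q <- s] (w, term j) r.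
- exact: block_path.
- by rewrite ez (map_inj_uniq (pair_inj (u := _))).
- exact: pr.
- exact: ur.
- by rewrite last_map ls; exact: link_cadj.
- apply/hasPn => z zr; apply/negP; rewrite /= ez => /mapP[q _ eq].
  by move/negP: un; apply; apply/mapP; exists z; rewrite // eq.
exists ([seq (u, q) | q <- s] ++ (w, term j) :: r); split=> //.
- by rewrite -cat_cons size_cat ez size_map.
- by rewrite -cat_cons has_cat negb_or br andbT ez has_map.
- move=> x h; rewrite in_cons; move: h; rewrite -cat_cons map_cat mem_cat => /orP[|->]; last by rewrite orbT.
  by rewrite ez -map_comp => /mapP[q _ ->]; rewrite eqxx.
Qed.

Lemma assemble bad k1 k2 k3 k4 : uniq [:: k1; k2; k3; k4] ->
  (forall i, toward k1 i k2 -> has_end adjP term T (fun q => bad (k1, q)) i) ->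
  (forall i, toward k2 i k4 -> has_pass adjP term t (fun q => bad (k2, q)) i) ->
  (forall i, toward k3 i k1 -> has_pass adjP term t (fun q => bad (k3, q)) i) ->
  (forall i, toward k4 i k3 -> has_end adjP term T (fun q => bad (k4, q)) i) ->
  exists p, [/\ sorted e p, uniq p, size p = T + (t + (t + T)) & ~~ has bad p].
Proof.
rewrite /= !inE !negb_or !andbT => /and3P[/and3P[n12 n13 n14] /andP[n23 n24] n34] h1 h2 h3 h4.
have [i1 [i2 e12]] := linked n12; have [j2 [i3 e23]] := linked n23; have [j3 [i4 e34]] := linked n34.
have [c2 [c2' e24]] := linked n24; have [c3' [c3 e13]] := linked n13.
have ne k l l' i i' : l != l' -> toward k i l -> toward k i' l' -> i != i'.
  by move=> ll [a ea] [a' ea']; apply: contra ll => /eqP ii; move: ea'; rewrite -ii ea => -[->].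
have t21 : toward k2 i2 k1 by exists i1; exact: nxt_sym.
have t23 : toward k2 j2 k3 by exists i3.
have t24 : toward k2 c2 k4 by exists c2'.
have t32 : toward k3 i3 k2 by exists j2; exact: nxt_sym.
have t34 : toward k3 j3 k4 by exists i4.
have t31 : toward k3 c3 k1 by exists c3'; exact: nxt_sym.
have [s4 [p4 u4 z4 b4]] := h4 i4 (ex_intro _ j3 (nxt_sym e34)).
have [||| s3 [p3 u3 l3 z3] b3] := h3 c3 t31 i3 j3.
- exact: ne t32 t34.
- by apply: ne t32 t31; rewrite eq_sym.
- by apply: ne t34 t31; rewrite eq_sym.
have [||| s2 [p2 u2 l2 z2] b2] := h2 c2 t24 i2 j2.
- exact: ne t21 t23.
- exact: ne t21 t24.
- exact: ne t23 t24.
have [s1 [p1 u1 z1 b1]] := h1 i1 (ex_intro _ i2 e12).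
(* [has_end] runs inwards from the exit; in the first block it is traversed backwards. *)
have [s1' [p1' l1' er1 sz1]] := rev_path_sym adjP_sym p1.
have [|||||r4 [pr4 ur4 zr4 br4 sub4]] := @prepend bad k3 (term i3) s3 j3 k4 i4 [seq (k4, q) | q <- s4] p3 u3 l3 e34.
- exact: block_path.
- by rewrite -(map_cons (pair k4) (term _)) (map_inj_uniq (pair_inj (u := _))).
- rewrite -(map_cons (pair k4) (term _)) -map_comp; apply/mapP => -[q _ /= /eqP]; exact/negP.
- exact: b3.
- by rewrite -(map_cons (pair k4) (term _)) has_map.
have m4 : [seq z.1 | z <- (k4, term i4) :: [seq (k4, q) | q <- s4]] =i [:: k4].
  move=> z; rewrite -(map_cons (pair k4) (term _)) -map_comp mem_seq1.
  by apply/mapP/eqP => [[q _ ->] //|->]; exists (term i4); rewrite ?mem_head.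
have [|||r3 [pr3 ur3 zr3 br3 sub3]] := @prepend bad k2 (term i2) s2 j2 k3 i3 r4 p2 u2 l2 e23 pr4 ur4.
- by apply/negP => /sub4; rewrite in_cons m4 !inE (negbTE n23) (negbTE n24).
- exact: b2.
- exact: br4.
have [|||||||||r2 [pr2 ur2 zr2 br2 _]] := @prepend bad k1 (last (term i1) s1) s1' i1 k2 i2 r3.
- exact: p1'.
- by rewrite er1 rev_uniq.
- exact: l1'.
- exact: e12.
- exact: pr3.
- exact: ur3.
- apply/negP => /sub3; rewrite in_cons (negbTE n12) => /sub4.
  by rewrite in_cons m4 !inE (negbTE n13) (negbTE n14).
- by rewrite er1 has_rev.
- exact: br3.
exists ((k1, last (term i1) s1) :: r2); split=> //.
by rewrite zr2 zr3 zr4 /= sz1 z1 z2 z3 size_map z4.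
Qed.

Lemma block_outside (s : seq 'I_4) : size s < 4 -> exists k, k \notin s.
Proof.
move=> ss; apply/existsP; rewrite -negb_forall; apply: contraL ss => /forallP h.
have := uniq_leq_size (enum_uniq 'I_4) (fun x _ => h x : x \in s).
by rewrite size_enum_ord -leqNgt.
Qed.

Lemma sum_T : T + (t + (t + T)) = 2 * T + 2 * t. Proof. by lia. Qed.

Section Single.

Variable tau : P -> 'I_3.
Hypotheses (tau_pass : forall x, has_pass adjP term t (pred1 x) (tau x))
  (tau_surj : forall k, exists x, tau x = k) (P_end : forall i, has_end adjP term T pred0 i).

Lemma four_avoid1 (x : 'I_4 * P) : exists p,
  [/\ sorted e p, uniq p, size p = 2 * T + 2 * t & x \notin p].
Proof.
case E: (nxt (x.1, tau x.2)) (nxt_closed (x.1, tau x.2)) => [[k4 j]|] // _.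
have n24 : x.1 != k4 := nxt_neq E.
have [k1] := block_outside (s := [:: x.1; k4]) isT; rewrite !inE negb_or => /andP[n1 n1'].
have [k3] := block_outside (s := [:: k1; x.1; k4]) isT.
rewrite !inE !negb_or => /and3P[n3 n3' n3''].
have off k : k != x.1 -> (fun q => pred1 x (k, q)) =1 pred0.
  by case: (x) => [u q] /= ku q'; rewrite xpair_eqE (negbTE ku).
have pass0 k : has_pass adjP term t pred0 k.
  have [z <-] := tau_surj k; move=> a b ab ak bk; have [s h _] := tau_pass ab ak bk.
  by exists s => //; rewrite has_pred0.
have [|||||p [sp up zp bp]] := @assemble (pred1 x) k1 x.1 k3 k4.
- by rewrite /= !inE !negb_or n1 n1' n24 n3'' (eq_sym k1) n3 (eq_sym x.1) n3'.
- by move=> i _; have [s [? ? ? ?]] := P_end i; exists s; split=> //; rewrite (eq_has (off _ n1)) has_pred0.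
- move=> i [j' E']; rewrite (simple E' E) => a b ab ai bi.
  have [s h hb] := tau_pass ab ai bi; exists s => //.
  by apply: contra hb => /hasP[q qs /eqP eq]; apply/hasP; exists q; rewrite // -eq /=.
- move=> i _ a b ab ai bi; have [s h _] := pass0 i a b ab ai bi; exists s => //.
  by rewrite (eq_has (off _ n3')) has_pred0.
- by move=> i _; have [s [? ? ? ?]] := P_end i; exists s; split=> //;
    rewrite (eq_has (off _ _)) ?has_pred0 // eq_sym.
exists p; split=> //; first by rewrite zp sum_T.
by move: bp; rewrite has_pred1.
Qed.

End Single.

Section Double.

Variable tied : P -> 'I_3 -> Prop.
Hypotheses
  (tied_dec : forall x, (exists2 k, tied x k & forall k', tied x k' -> k' = k) \/ forall k, ~ tied x k)
  (tied_ex : forall k, exists x, tied x k)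
  (pass1 : forall x k, (forall k', tied x k' -> k' = k) -> has_pass adjP term t (pred2 x x) k)
  (pass2 : forall x y, (forall k k', tied x k -> tied y k' -> k = k') ->
    exists k, has_pass adjP term t (pred2 x y) k)
  (end2 : forall x y i, (exists2 j, j != i & tied x j) -> (exists2 j, j != i & tied y j) ->
    (x = y \/ exists j j', [/\ tied x j, tied y j' & j <> j']) -> has_end adjP term T (pred2 x y) i).

Let pass0 k : has_pass adjP term t pred0 k.
Proof.
have [x tx] := tied_ex k; have ht k' : tied x k' -> k' = k.
  by case: (tied_dec x) => [[k0 _ h] /h -> |/(_ k)]; [rewrite -(h _ tx)|].
move=> i j ij ik jk; have [s h _] := pass1 ht ij ik jk.
by exists s => //; rewrite has_pred0.
Qed.

Let end0 i : has_end adjP term T pred0 i.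
Proof.
have [j [_ ji]] := third i i; have [x tx] := tied_ex j.
have h : exists2 j, j != i & tied x j by exists j; rewrite // eq_sym.
have [s [? ? ? _]] := end2 h h (or_introl erefl).
by exists s; split=> //; rewrite has_pred0.
Qed.

Lemma eq_has_pass b b' k : b =1 b' -> has_pass adjP term t b k -> has_pass adjP term t b' k.
Proof.
move=> bb h i j ij ik jk; have [s hs hb] := h i j ij ik jk.
by exists s; rewrite // -(eq_has bb).
Qed.

Lemma eq_has_end b b' i : b =1 b' -> has_end adjP term T b i -> has_end adjP term T b' i.
Proof. by move=> bb [s [? ? ? hb]]; exists s; split=> //; rewrite -(eq_has bb). Qed.

Lemma four_avoid_same (k : 'I_4) x y : exists p,
  [/\ sorted e p, uniq p, size p = 2 * T + 2 * t & ~~ has (pred2 (k, x) (k, y)) p].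
Proof.
have off l : l != k -> pred0 =1 (fun q => pred2 (k, x) (k, y) (l, q)).
  by move=> lk q; rewrite /= !xpair_eqE (negbTE lk).
have on : pred2 x y =1 (fun q => pred2 (k, x) (k, y) (k, q)).
  by move=> q; rewrite /= !xpair_eqE eqxx.
have pass l i : l != k -> has_pass adjP term t (fun q => pred2 (k, x) (k, y) (l, q)) i.
  by move=> lk; apply: eq_has_pass (off _ lk) _; exact: pass0.
have end' l i : l != k -> has_end adjP term T (fun q => pred2 (k, x) (k, y) (l, q)) i.
  by move=> lk; apply: eq_has_end (off _ lk) _; exact: end0.
have other l : l != k -> exists k1 k3, uniq [:: k1; k; k3; l].
  move=> lk; have [k1] := block_outside (s := [:: k; l]) isT; rewrite !inE negb_or => /andP[n1 n1'].
  have [k3] := block_outside (s := [:: k1; k; l]) isT.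
  rewrite !inE !negb_or => /and3P[n3 n3' n3'']; exists k1, k3.
  by rewrite /= !inE !negb_or n1 n1' (eq_sym k1) n3 (eq_sym k) n3' (eq_sym k) lk n3''.
have [[i hi]|hi] : (exists i, has_pass adjP term t (pred2 x y) i) \/
    exists j j', [/\ tied x j, tied y j' & j <> j'].
  have [[j jx ux]|nx] := tied_dec x; last by left; apply: pass2 => j j' /nx.
  have [[j' jy uy]|ny] := tied_dec y; last by left; apply: pass2 => ? ? _ /ny.
  have [jj|/eqP jj] := eqVneq j j'; last by right; exists j, j'.
  by left; apply: pass2 => a a' /ux -> /uy ->.
- case E: (nxt (k, i)) (nxt_closed (k, i)) => [[k4 j]|] // _.
  have n24 : k4 != k by rewrite eq_sym; exact: nxt_neq E.
  have [k1 [k3 u]] := other _ n24.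
  have /and3P[] := u; rewrite !inE !negb_or => /and3P[n1 _ _] /andP[n3 _] _.
  have [||||p [sp up zp bp]] := @assemble (pred2 (k, x) (k, y)) k1 k k3 k4 u.
  + by move=> a _; exact: end'.
  + by move=> a [j' E']; rewrite (simple E' E); apply: eq_has_pass on _.
  + by move=> a _; apply: pass; rewrite eq_sym.
  + by move=> a _; apply: end'.
  by exists p; split=> //; rewrite zp sum_T.
case: hi => i [j' [tx ty ne]]; have [c [ic jc]] := third i j'.
case E: (nxt (k, c)) (nxt_closed (k, c)) => [[k2 j]|] // _.
have n12 : k2 != k by rewrite eq_sym; exact: nxt_neq E.
have [k3 [k4 u]] := other _ n12.
have u' : uniq [:: k; k2; k3; k4].
  rewrite (perm_uniq (s2 := [:: k3; k; k4; k2])) //.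
  by apply/permP => f /=; lia.
have /and3P[/norP[_ /norP[n3 /norP[n4 _]]] _ _] := u'.
have [||||p [sp up zp bp]] := @assemble (pred2 (k, x) (k, y)) k k2 k3 k4 u'.
+ move=> a [j0 E']; rewrite (simple E' E); apply: eq_has_end on _; apply: end2.
  * by exists i; rewrite // eq_sym.
  * by exists j'; rewrite // eq_sym.
  * by right; exists i, j'.
+ by move=> a _; apply: pass.
+ by move=> a _; apply: pass; rewrite eq_sym.
+ by move=> a _; apply: end'; rewrite eq_sym.
by exists p; split=> //; rewrite zp sum_T.
Qed.

Lemma four_avoid_distinct (kx ky : 'I_4) x y : kx != ky -> exists p,
  [/\ sorted e p, uniq p, size p = 2 * T + 2 * t & ~~ has (pred2 (kx, x) (ky, y)) p].
Proof.
move=> kxy.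
(* [s] is the block to which [z] is tied, with [k] itself encoding an untied vertex, as in
   [order_ok]. *)
have status k z : exists s, [/\ s = k -> forall i, ~ tied z i &
    s <> k -> exists i, [/\ tied z i, forall i', tied z i' -> i' = i & toward k i s]].
  have [[i hi ui]|n] := tied_dec z; last by exists k.
  case E: (nxt (k, i)) (nxt_closed (k, i)) => [[s j]|] // _; exists s.
  split=> [sk|_]; first by have := nxt_neq E; rewrite /= sk eqxx.
  by exists i; split=> //; exists j.
have [sx [ux tx]] := status kx x; have [sy [uy ty]] := status ky y.
have [k1 [k2 [k3 [k4 [u ox oy]]]]] := order_exists sx sy kxy.
set bad := pred2 (kx, x) (ky, y).
have badE k : (fun q => bad (k, q)) =1
    (if k == kx then (pred2 x x : pred P) else if k == ky then (pred2 y y : pred P) else (pred0 : pred P)).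
  move=> q; rewrite /bad /= !xpair_eqE; case: (eqVneq k kx) => [->|_].
    by rewrite (negbTE kxy) orbF /= orbb.
  by case: (k == ky); rewrite //= orbb.
have tow k i i' l : toward k i l -> toward k i' l -> i = i'.
  by move=> [j h] [j' h']; exact: simple h h'.
have passb k l i : toward k i l -> ((k == kx) ==> (sx == kx) || (sx == l)) ->
    ((k == ky) ==> (sy == ky) || (sy == l)) -> has_pass adjP term t (fun q => bad (k, q)) i.
  have one kz z sz : (sz = kz -> forall i, ~ tied z i) ->
      (sz <> kz -> exists i, [/\ tied z i, forall i', tied z i' -> i' = i & toward kz i sz]) ->
      toward kz i l -> (sz == kz) || (sz == l) -> has_pass adjP term t (pred2 z z) i.
    move=> uz tz hi h; apply: pass1 => i' ti'; case: (eqVneq sz kz) h => [/uz /(_ i') //|/eqP /tz [i0 [_ u0 t0]] /= /eqP sl].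
    by rewrite (u0 _ ti'); apply: tow t0 _; rewrite sl.
  move=> hi hx hy; apply: (eq_has_pass (fsym (badE k))).
  case: ifP hx => [/eqP kk|_ _] /=; first by rewrite kk in hi; exact: one ux tx hi.
  case: ifP hy => [/eqP kk|_ _] /=; first by rewrite kk in hi; exact: one uy ty hi.
  exact: pass0.
have endb k l i : toward k i l -> ((k == kx) ==> (sx != kx) && (sx != l)) ->
    ((k == ky) ==> (sy != ky) && (sy != l)) -> has_end adjP term T (fun q => bad (k, q)) i.
  have one kz z sz :
      (sz <> kz -> exists i, [/\ tied z i, forall i', tied z i' -> i' = i & toward kz i sz]) ->
      toward kz i l -> (sz != kz) && (sz != l) -> has_end adjP term T (pred2 z z) i.
    move=> tz [j hi] /andP[/eqP /tz [i0 [t0 u0 [j0 h0]]] sl].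
    have hz : exists2 j, j != i & tied z j.
      by exists i0 => //; apply: contra sl => /eqP ii; move: h0; rewrite ii hi => -[->].
    by apply: end2 => //; left.
  move=> hi hx hy; apply: (eq_has_end (fsym (badE k))).
  case: ifP hx => [/eqP kk|_ _] /=; first by rewrite kk in hi; exact: one tx hi.
  case: ifP hy => [/eqP kk|_ _] /=; first by rewrite kk in hi; exact: one ty hi.
  exact: end0.
case/and4P: ox => x1 x2 x3 x4; case/and4P: oy => y1 y2 y3 y4.
have [||||p [sp up zp bp]] := @assemble bad k1 k2 k3 k4 u.
- by move=> i hi; exact: endb hi x1 y1.
- by move=> i hi; exact: passb hi x2 y2.
- by move=> i hi; exact: passb hi x3 y3.
- by move=> i hi; exact: endb hi x4 y4.
by exists p; split=> //; rewrite zp sum_T.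
Qed.

End Double.

End Four.

(** * Long cycles in the composite of a cubic graph *)

Section ClosedWalks.

Variables (B B' Q : finType) (adjQ : rel Q) (term : 'I_3 -> Q) (tau : Q -> 'I_3) (t : nat)
  (nxt : B * 'I_3 -> option (B * 'I_3)) (ext : 'I_3 -> B * 'I_3)
  (nxt' : B' * 'I_3 -> option (B' * 'I_3)) (v : B') (w : B -> B').
Let wd (d : B * 'I_3) := (w d.1, d.2).
Hypotheses (w_inj : injective w) (codom_w : forall u, (u \in codom w) = (u != v))
  (nxt'_sym : forall d d', nxt' d = Some d' -> nxt' d' = Some d)
  (nxt_w : forall d d', nxt' (wd d) = Some (wd d') <-> nxt d = Some d')
  (nxt_v : forall k, nxt' (v, k) = Some (wd (ext k)))
  (tau_pass : forall x, has_pass adjQ term t (pred1 x) (tau x))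
  (tau_surj : forall k, exists x, tau x = k)
  (base_passes : forall d d', (forall k k', d = ext k -> d' = ext k' -> k = k') ->
     exists i j x s, [/\ i != j, base_pass nxt ext i j x s, all (avoids d) (x :: s) & all (avoids d') (x :: s)])
  (base_skip : exists x s, [/\ walk nxt x s, nxt ((last x s).1.1, (last x s).2) = Some x.1,
     (size s).+1 = #|B| & forall k, all (avoids (ext k)) (x :: s)]).

Let up (y : step B) : step B' := (wd y.1, y.2).

Lemma walk_up x s : walk nxt x s -> walk nxt' (up x) [seq up y | y <- s].
Proof.
case/and3P=> h1 h2 h3; apply/and3P; split.
- rewrite path_map; apply: sub_path h1 => y z /eqP h; apply/eqP.
  exact: (nxt_w (y.1.1, y.2) z.1).2.
- rewrite -(map_cons up) -map_comp; move: h2.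
  by rewrite -(map_inj_uniq w_inj) -map_comp.
- by rewrite -(map_cons up) all_map.
Qed.

(** A dart at the deleted block [v] is replaced by the other end of its edge, an open port. *)
Definition below (d' : B' * 'I_3) (d : B * 'I_3) : Prop :=
  d' = wd d \/ exists2 k, d' = (v, k) & d = ext k.

Lemma below_ex d' : exists d, below d' d.
Proof.
case: d' => u i; have [->|uv] := eqVneq u v; first by exists (ext i); right; exists i.
by move: uv; rewrite -codom_w => /codomP[u0 ->]; exists (u0, i); left.
Qed.

Lemma up_neq (y : step B) : (up y).1.1 != v.
Proof. by rewrite -codom_w; exact: codom_f. Qed.

Lemma avoids_up d' d s : below d' d -> all (avoids d) s -> all (avoids d') [seq up y | y <- s].
Proof.
move=> h; rewrite all_map; apply: sub_all => y; rewrite /avoids.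
case: h => [->|[k -> _] _]; first by rewrite /= (inj_eq w_inj).
by rewrite /= (negbTE (up_neq y)).
Qed.

(** A pass of the base is closed through [v]. It then uses two of the three edges at [v], so if two
    different ones are to be missed, the closed walk skipping [v] is taken instead. *)
Lemma closed_walk d1 d2 : exists x s, [/\ walk nxt' x s,
  nxt' ((last x s).1.1, (last x s).2) = Some x.1, (size s).+1 = #|B|,
  all (avoids d1) (x :: s) & all (avoids d2) (x :: s)].
Proof.
have [e1 h1] := below_ex d1; have [e2 h2] := below_ex d2.
have [/existsP[k /existsP[k' /and3P[/eqP ek /eqP ek' _]]]|/existsPn hn] :=
    boolP [exists k, exists k', [&& e1 == ext k, e2 == ext k' & k != k']].
  have [x [s [ws cs ss hs]]] := base_skip; exists (up x), [seq up y | y <- s]; split.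
  - exact: walk_up.
  - by rewrite last_map; exact: (nxt_w (_, _) _).2.
  - by rewrite size_map.
  - by rewrite -(map_cons up); apply: avoids_up h1 _; rewrite ek.
  - by rewrite -(map_cons up); apply: avoids_up h2 _; rewrite ek'.
have [|i [j [x [s [ij [ws hi hj ss] a1 a2]]]]] := base_passes (d := e1) (d' := e2).
  move=> k k' /eqP ek /eqP ek'; apply/eqP; move: (hn k); rewrite negb_exists => /forallP/(_ k').
  by rewrite ek ek' /= negbK.
(* The edges used at [v] are those at the two ends of the pass, so the new step avoids what the pass
   avoids. *)
have vstep d' d : below d' d -> all (avoids d) (x :: s) -> avoids d' ((v, j), i).
  case=> [->|[k -> ek]] /allP h.
    have : w d.1 != v by rewrite -codom_w codom_f.
    by rewrite /avoids /= eq_sym => /negbTE ->.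
  rewrite /avoids eqxx /=; apply/andP; split; apply/eqP => kij.
    have := h _ (mem_last _ _); rewrite /avoids ek kij -hj !eqxx andbF //.
  by have := h x (mem_head _ _); rewrite /avoids ek kij hi !eqxx.
exists ((v, j), i), (up x :: [seq up y | y <- s]); split.
- case/and3P: (walk_up ws) => p1 p2 p3; apply/and3P; split.
  + by rewrite /= p1 andbT; apply/eqP; rewrite /= nxt_v -hi.
  + rewrite map_cons cons_uniq p2 andbT; apply/mapP => -[y].
    by rewrite -(map_cons up) => /mapP[z _ ->] /= e; have := up_neq z; rewrite /= -e eqxx.
  + by rewrite /= eq_sym ij.
- rewrite last_cons last_map /=; apply: nxt'_sym; rewrite nxt_v -hj //.
- by rewrite /= size_map.
- by apply/andP; split; [exact: vstep h1 a1 | exact: (avoids_up h1 a1)].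
- by apply/andP; split; [exact: vstep h2 a2 | exact: (avoids_up h2 a2)].
Qed.

Lemma closed_avoid2 (x y : B' * Q) : exists c, [/\ cycle (cadj adjQ term nxt') c, uniq c,
  size c = #|B| * t & ~~ has (pred2 x y) c].
Proof.
have fin d1 d2 : (forall x0 s, walk nxt' x0 s -> all (avoids d1) (x0 :: s) -> all (avoids d2) (x0 :: s) ->
    (x.1 = y.1 -> x <> y -> all (avoids (x.1, ord0)) (x0 :: s) /\ all (avoids (x.1, inord 1)) (x0 :: s)) /\
    (x.1 <> y.1 \/ x = y -> all (avoids (x.1, tau x.2)) (x0 :: s) /\ all (avoids (y.1, tau y.2)) (x0 :: s))) ->
    exists c, [/\ cycle (cadj adjQ term nxt') c, uniq c, size c = #|B| * t & ~~ has (pred2 x y) c].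
  move=> h; have [x0 [s [ws cs ss a1 a2]]] := closed_walk d1 d2.
  have [r1 r2] := h _ _ ws a1 a2.
  have hr := walk_routed tau_pass tau_surj ws r1 r2.
  have [p [pp uq lp [sp bp] _]] := expand_walk ws hr.
  exists ((x0.1.1, term x0.1.2) :: p); split=> //.
    by rewrite /= rcons_path pp lp; apply: link_cadj; rewrite cs -surjective_pairing.
  by rewrite /= sp ss.
have [/andP[/eqP xy ne]|nd] := boolP ((x.1 == y.1) && (x != y)).
  apply: (fin (x.1, ord0) (x.1, inord 1)) => x0 s ws a1 a2; split=> // -[//|e].
  by rewrite e eqxx in ne.
apply: (fin (x.1, tau x.2) (y.1, tau y.2)) => x0 s ws a1 a2; split=> // exy ne.
by case/negP: nd; rewrite exy eqxx; apply/eqP.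
Qed.

End ClosedWalks.

(** * Walks in tables *)

Section TableWalks.

(* [tab] describes a cubic graph on [n.+2] blocks; the last one is deleted. *)
Variables (n : nat) (tab : seq nat).
Let N := 3 * n.+1.
Let nb c := nth (3 * n.+1) tab c.

Definition text (k : 'I_3) : 'I_n.+1 * 'I_3 := code_dart n (nb (3 * n.+1 + k)).

Definition ext_codes : seq nat := [:: nb (3 * n.+1); nb (3 * n.+1 + 1); nb (3 * n.+1 + 2)].

(* The binary digits below the leading one, from the right. *)
Fixpoint turns (p : positive) : seq bool :=
  match p with xH => [::] | xO q => false :: turns q | xI q => true :: turns q end.

(* Entering a block at port [i], turn to port [i + 1] or [i + 2]. *)
Fixpoint run (b : seq bool) (c : nat) : seq (nat * nat) :=
  if b is x :: b' then
    let o := 3 * (c %/ 3) + (c %% 3 + 1 + x) %% 3 in (c, o) :: run b' (nb o)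
  else [::].

Definition stp (y : nat * nat) : step 'I_n.+1 := (code_dart n y.1, inord (y.2 %% 3)).

Definition step_ok (y : nat * nat) : bool :=
  [&& y.1 < 3 * n.+1, y.2 < 3 * n.+1, y.1 != y.2 & y.1 %/ 3 == y.2 %/ 3].

Definition walk_ok (L : seq (nat * nat)) : bool :=
  [&& all step_ok L, sorted (fun y z => nb y.2 == z.1) L & uniq [seq y.1 %/ 3 | y <- L]].

Lemma step_out y : step_ok y -> ((stp y).1.1, (stp y).2) = code_dart n y.2.
Proof. by case: y => c o /and4P[_ _ _ /eqP /= e]; rewrite /stp /code_dart /= e. Qed.

Lemma val_block y : step_ok y -> val (stp y).1.1 = y.1 %/ 3.
Proof. by case: y => c o /and4P[/= h _ _ _]; rewrite inordK // ltn_divLR // mulnC. Qed.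

Lemma stp_link y z : step_ok y -> step_ok z -> nb y.2 == z.1 -> wlink (@tnxt n tab) (stp y) (stp z).
Proof.
move=> hy hz /eqP e; apply/eqP; rewrite (step_out hy); apply/tnxtP.
case/and4P: hy => _ h _ _; case/and4P: hz => h' _ _ _.
by rewrite !code_dartK //; apply/eqP.
Qed.

Lemma walk_okP y L : walk_ok (y :: L) -> walk (@tnxt n tab) (stp y) [seq stp z | z <- L].
Proof.
case/and3P=> /allP hs hp hu; apply/and3P; split.
- rewrite path_map; elim: L y hs hp {hu} => //= z L IH y hs /andP[yz hp].
  rewrite (stp_link (hs y _) (hs z _)) ?inE ?eqxx ?orbT //=; apply: IH hp => x xL.
  by apply: hs; rewrite inE xL orbT.
- rewrite -(map_cons stp) -map_comp -(map_inj_uniq val_inj) -map_comp.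
  by congr (uniq _): hu; apply/eq_in_map => z /hs /val_block.
- rewrite -(map_cons stp) all_map; apply/allP => z /hs hz /=.
  case/and4P: (hz) => h h' ne /eqP e; apply: contra ne => /eqP e2.
  have /(congr1 (@dart_code n)) : code_dart n z.1 = code_dart n z.2.
    by rewrite -(step_out hz) [LHS]surjective_pairing; congr (_, _).
  by rewrite !code_dartK // => ->.
Qed.

Definition key (c : nat) : positive := Pos.of_succ_nat c.

Definition used (L : seq (nat * nat)) : PM.t unit :=
  foldr (fun y m => PM.add (key y.1) tt (PM.add (key y.2) tt m)) (PM.empty _) L.

Lemma usedP L c : ~~ PM.mem (key c) (used L) ->
  all (fun y => (y.1 != c) && (y.2 != c)) L.
Proof.
elim: L => //= y L IH; rewrite !PositiveMap.mem_find.
have kI : injective key by exact: SuccNat2Pos.inj.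
have [<-|n1] := eqVneq y.1 c; first by rewrite PositiveMap.gss.
have [<-|n2] := eqVneq y.2 c.
  by have [e|ne] := eqVneq (key y.1) (key y.2); rewrite ?e ?PositiveMap.gss // PositiveMap.gso ?PositiveMap.gss // => h; rewrite h eqxx in ne.
have g1 : key c <> key y.1 by move/kI => e; rewrite e eqxx in n1.
have g2 : key c <> key y.2 by move/kI => e; rewrite e eqxx in n2.
by rewrite !PositiveMap.gso // -PositiveMap.mem_find.
Qed.

Lemma used_avoids L d : all step_ok L -> ~~ PM.mem (key (dart_code d)) (used L) ->
  all (avoids d) [seq stp y | y <- L].
Proof.
move=> /allP hs /usedP /allP h; rewrite all_map; apply/allP => y yL /=.
have /andP[n1 n2] := h _ yL; have hy := hs _ yL; have eo := step_out hy.
case/and4P: hy => h1 h2 _ _; rewrite /avoids; apply/implyP => /eqP e.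
apply/andP; split; [apply: contra n1 | apply: contra n2] => /eqP e2.
  have -> : d = code_dart n y.1 by rewrite [d]surjective_pairing -e e2.
  by rewrite code_dartK.
have -> : d = code_dart n y.2 by rewrite [d]surjective_pairing -e e2 -eo.
by rewrite code_dartK.
Qed.

Definition first_in (L : seq (nat * nat)) : nat := (head (0, 0) L).1.
Definition last_out (L : seq (nat * nat)) : nat := (last (0, 0) L).2.

Definition pass_ok (L : seq (nat * nat)) : bool :=
  [&& walk_ok L, size L == n, first_in L != last_out L,
      first_in L \in ext_codes & last_out L \in ext_codes].

Definition end_ok (k : nat) (L : seq (nat * nat)) : bool :=
  let d := nb (last_out L) in
  [&& walk_ok L, size L == n, first_in L == nth 0 ext_codes k, d < 3 * n.+1,
      d %/ 3 \notin [seq y.1 %/ 3 | y <- L] &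
      all (fun j => (j == k) || (nth 0 ext_codes j %/ 3 != d %/ 3) &&
         ~~ PM.mem (key (nth 0 ext_codes j)) (used L)) (iota 0 3)].

Definition skip_ok (L : seq (nat * nat)) : bool :=
  [&& walk_ok L, size L == n.+1, nb (last_out L) == first_in L &
      all (fun c => ~~ PM.mem (key c) (used L)) ext_codes].

(** Pairs of different open ports are exempt, since a walk between two of the three exits can avoid
    only the third. *)
Definition cover_ok (Ls : seq (seq (nat * nat))) : bool :=
  let us := map used Ls in
  let ks := map key (iota 0 (3 * n.+1)) in
  let es := map key ext_codes in
  all (fun k => let us' := filter (fun u => ~~ PM.mem k u) us in
    all (fun k' => has (fun u => ~~ PM.mem k' u) us' || [&& k \in es, k' \in es & k != k']) ks) ks.

Definition exts_ok : bool :=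
  all (fun c => c < 3 * n.+1) ext_codes && uniq [seq c %/ 3 | c <- ext_codes].

Hypotheses (n_gt0 : 0 < n) (hx : exts_ok).

Lemma ext_codesE (k : 'I_3) : nb (3 * n.+1 + k) = nth 0 ext_codes k.
Proof. by case: k => [[|[|[|//]]] ?] /=; rewrite ?addn0. Qed.

Lemma text_code k : dart_code (text k) = nth 0 ext_codes k.
Proof.
rewrite /text ext_codesE code_dartK //; case/andP: hx => /allP h _.
by apply: h; rewrite mem_nth.
Qed.

Lemma ext_index c : c \in ext_codes -> exists k : 'I_3, text k = code_dart n c.
Proof.
move=> hc; have h3 : index c ext_codes < 3 by rewrite -[3]/(size ext_codes) index_mem.
exists (Ordinal h3); rewrite -[LHS]dart_codeK text_code /= nth_index //.
Qed.

Lemma text_block : injective (fun k => (text k).1).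
Proof.
move=> k k' e0; have e : (text k).1 = (text k').1 := e0; have : nth 0 ext_codes k %/ 3 = nth 0 ext_codes k' %/ 3.
  by rewrite -!text_code !dart_code_div e.
case/andP: hx => _ u; rewrite -!(nth_map 0 0 (fun c => c %/ 3)) // => /eqP.
by rewrite nth_uniq // => /eqP /val_inj.
Qed.

Lemma pass_okP Ls : all pass_ok Ls -> cover_ok Ls ->
  forall d d', (forall k k', d = text k -> d' = text k' -> k = k') ->
  exists i j x w, [/\ i != j, base_pass (@tnxt n tab) text i j x w,
    all (avoids d) (x :: w) & all (avoids d') (x :: w)].
Proof.
move=> /allP hp /allP hc d d' hd; have kI : injective key by exact: SuccNat2Pos.inj.
have mk c : c < 3 * n.+1 -> key c \in map key (iota 0 (3 * n.+1)) by move=> h; rewrite map_f // mem_iota.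
have /allP := hc _ (mk _ (dart_code_lt d)); move/(_ _ (mk _ (dart_code_lt d'))).
rewrite filter_map has_map => /orP [/hasP [L hu nd']|/and3P[]]; last first.
  rewrite !(mem_map kI) => /ext_index[k ek] /ext_index[k' ek']; rewrite !dart_codeK in ek ek'.
  by rewrite -ek -ek' (hd _ _ (esym ek) (esym ek')) eqxx.
move: hu; rewrite mem_filter => /andP[nd LLs].
have /and5P[hw /eqP hs ne fi lo] := hp _ LLs.
rewrite /= in nd nd'; case: L hw hs ne fi lo nd nd' {LLs} => [|y L] //.
move=> hw hs ne /ext_index[i ei] /ext_index[j ej] nd nd'.
have hst : all step_ok (y :: L) by case/and3P: hw.
have ly : step_ok (last y L) by apply: (allP hst); exact: mem_last.
exists i, j, (stp y), [seq stp z | z <- L]; split.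
- apply: contra ne => /eqP ij; move: ei; rewrite ij ej => /(congr1 (@dart_code n)).
  rewrite !code_dartK => [->//||]; last by case/and4P: ly.
  by case/andP: hst => /and4P[].
- split; [exact: walk_okP| exact: esym ei | | by rewrite size_map card_ord -hs].
  by rewrite last_map (step_out ly) -ej.
- exact: (used_avoids hst nd).
- exact: (used_avoids hst nd').
Qed.

Lemma end_okP (f : nat -> seq (nat * nat)) : all (fun k => end_ok k (f k)) (iota 0 3) ->
  forall i, exists x w d,
     [/\ walk (@tnxt n tab) x w, x.1 = text i, tnxt tab ((last x w).1.1, (last x w).2) = Some d,
       d.1 \notin [seq y.1.1 | y <- x :: w] /\ (size w).+2 = #|'I_n.+1| &
       forall j, j != i -> (text j).1 != d.1 /\ all (avoids (text j)) (x :: w)].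
Proof.
move=> /allP h i; have := h i; rewrite mem_iota ltn_ord => /(_ isT); move: (f i) => L.
set d := nb (last_out L); rewrite /end_ok -/d => /and5P[hw /eqP hs /eqP hf dn /andP[db /allP ha]].
case: L hw hs hf @d dn db ha => [_ n0|y L]; first by exfalso; move: n_gt0 n0 => /=; clear; lia.
move=> hw hs hf d dn db ha; have hst : all step_ok (y :: L) by case/and3P: hw.
have ly : step_ok (last y L) by apply: (allP hst); exact: mem_last.
exists (stp y), [seq stp z | z <- L], (code_dart n d); split.
- exact: walk_okP.
- by rewrite -[RHS]dart_codeK text_code -hf.
- rewrite last_map (step_out ly); apply/tnxtP; rewrite !code_dartK //.
  by case/and4P: ly.
- split; last by rewrite size_map card_ord -hs.
  apply: contra db => /mapP[z]; rewrite -(map_cons stp) => /mapP[z' z'L ->] /(congr1 val).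
  rewrite val_block ?(allP hst) // /= inordK; last by rewrite ltn_divLR // mulnC.
  by move=> ->; exact: (map_f (fun y => y.1 %/ 3) z'L).
- move=> j ji; have := ha j; rewrite mem_iota ltn_ord => /(_ isT).
  rewrite (val_eqE j i) (negbTE ji) /= => /andP[ne nu]; split.
    apply: contra ne => /eqP /(congr1 val) e; rewrite -text_code dart_code_div e /= inordK //.
    by rewrite ltn_divLR // mulnC.
  by apply: (used_avoids hst); rewrite text_code.
Qed.

Lemma skip_okP L : skip_ok L -> exists x s, [/\ walk (@tnxt n tab) x s,
  tnxt tab ((last x s).1.1, (last x s).2) = Some x.1,
  (size s).+1 = #|'I_n.+1| & forall k, all (avoids (text k)) (x :: s)].
Proof.
case/and4P=> hw /eqP hs /eqP hc /allP hu; case: L hw hs hc hu => // y L hw hs hc hu.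
have hst : all step_ok (y :: L) by case/and3P: hw.
have ly : step_ok (last y L) by apply: (allP hst); exact: mem_last.
exists (stp y), [seq stp z | z <- L]; split.
- exact: walk_okP.
- rewrite last_map (step_out ly); apply/tnxtP; rewrite !code_dartK ?(eqP hc) //.
  + by apply/eqP.
  + by case/andP: hst => /and4P[].
  + by case/and4P: ly.
- by rewrite size_map card_ord -hs.
- by move=> k; apply: (used_avoids hst); apply: hu; rewrite text_code mem_nth.
Qed.

Definition up_block : 'I_n.+1 -> 'I_n.+2 := widen_ord (leqnSn n.+1).

Lemma up_inj : injective up_block.
Proof. by move=> i j e; apply: val_inj; exact: (congr1 val e). Qed.

Lemma codom_up u : (u \in codom up_block) = (u != ord_max).
Proof.
apply/codomP/idP => [[u0 ->]|un].
  by rewrite -val_eqE /= ltn_eqF.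
have ul : u < n.+1 by rewrite ltn_neqAle -ltnS ltn_ord andbT; move: un; rewrite -val_eqE.
by exists (Ordinal ul); apply: val_inj.
Qed.

Lemma code_up (d : 'I_n.+1 * 'I_3) : dart_code (up_block d.1, d.2) = dart_code d.
Proof. by []. Qed.

Hypothesis htab : size tab = 3 * n.+2.

Lemma tnxt_up d d' : tnxt tab (up_block d.1, d.2) = Some (up_block d'.1, d'.2) <-> tnxt tab d = Some d'.
Proof using htab.
(* The two readings of the table differ only in the default value of [nth], the code of a missing
   edge. *)
have e : nth (3 * n.+2) tab (dart_code d) = nth (3 * n.+1) tab (dart_code d).
  by apply: set_nth_default; rewrite htab (ltn_trans (dart_code_lt d)) // ltn_pmul2l.
by split=> /tnxtP h; apply/tnxtP; move: h; rewrite !code_up e.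
Qed.

Lemma tnxt_last k : @tnxt n.+1 tab (ord_max, k) = Some (up_block (text k).1, (text k).2).
Proof using htab hx.
apply/tnxtP; rewrite code_up text_code -ext_codesE; apply/eqP; apply: set_nth_default.
by rewrite htab /dart_code /= [3 * n.+2]mulnS [ltnLHS]addnC ltn_add2r.
Qed.

End TableWalks.

Definition table_edges (n : nat) (tab : seq nat) : seq (nat * nat) :=
  [seq (c %/ 3, nth (3 * n.+1) tab c %/ 3) | c <- iota 0 (3 * n.+1) & c < nth (3 * n.+1) tab c].

Lemma tnxt_erel n tab (d d' : 'I_n.+1 * 'I_3) : table_ok n tab -> tnxt tab d = Some d' ->
  erel (table_edges n tab) d.1 d'.1.
Proof.
move=> /table_okP[sy ne] h; have half (e e' : 'I_n.+1 * 'I_3) : tnxt tab e = Some e' -> dart_code e < dart_code e' ->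
    (val e.1, val e'.1) \in table_edges n tab.
  move=> /tnxtP /eqP he lt; apply/mapP; exists (dart_code e).
    by rewrite mem_filter he lt mem_iota add0n dart_code_lt.
  by rewrite he !dart_code_div.
have : (dart_code d < dart_code d') || (dart_code d' < dart_code d).
  by rewrite -neq_ltn (can_eq (@dart_codeK n)); apply: contraNneq (ne _ _ h) => ->.
by rewrite /erel => /orP[/(half _ _ h) ->|/(half _ _ (sy _ _ h)) ->]; rewrite ?orbT.
Qed.

(** Such a path, closed through the deleted block [n.+1], would be a Hamiltonian cycle of the whole
    table. *)
Lemma table_no_spanning_pass n tab o : 0 < n -> exts_ok n tab -> table_ok n.+1 tab ->
  size tab = 3 * n.+2 -> list_nonham (table_edges n.+1 tab) o -> perm_eq o (iota 0 n.+2) ->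
  no_spanning_pass (@tnxt n tab) (text n tab).
Proof.
move=> n0 hx hok hs hn po i j b bs ij eb el pb ub; apply/negP => /eqP; rewrite card_ord => sz.
have lastE k : erel (table_edges n.+1 tab) n.+1 (text n tab k).1.
  exact: (tnxt_erel hok (tnxt_last hx hs k)).
have hl : last n.+1 [seq val u | u <- b :: bs] = last b bs by rewrite /= last_map.
apply: (list_nonham_path (l := [seq val u | u <- b :: bs]) hn po).
- by rewrite ltnS.
- by rewrite (map_inj_uniq val_inj).
- by rewrite size_map.
- by apply/allP => x /mapP[u _ ->]; exact: ltn_ord.
- rewrite /= path_map; apply: sub_path pb => u u' /existsP[a /existsP[a' /eqP h]].
  have := (tnxt_up hs (u, a) (u', a')).2 h.
  by move/(tnxt_erel hok).
- by rewrite /= eb; exact: lastE.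
- by rewrite hl el; exact: lastE.
Qed.

Definition neighbours (E : seq (nat * nat)) (x : nat) : seq nat :=
  flatten [seq if e.1 == x then [:: e.2] else if e.2 == x then [:: e.1] else [::] | e <- E].

(* The digits of [m], in the mixed radix given by the degrees, are the positions
   of the successive vertices in the neighbour lists. *)
Fixpoint trail (E : seq (nat * nat)) (k : nat) (m : N) (x : nat) : seq nat :=
  if k is k'.+1 then
    let nb := neighbours E x in
    let: (q, r) := N.div_eucl m (N.of_nat (size nb)) in
    x :: trail E k' q (nth 0 nb (N.to_nat r))
  else [::].

Section LiftList.

Variables (n : nat) (E : seq (nat * nat)).

Definition ords (p : seq nat) : seq 'I_n.+1 := map inord p.

Lemma val_ords p : all (fun x => x < n.+1) p -> map val (ords p) = p.
Proof.
by move=> /allP h; rewrite -map_comp -[RHS]map_id; apply/eq_in_map => x /h /= ?; rewrite inordK.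
Qed.

Lemma uniq_ords p : all (fun x => x < n.+1) p -> uniq p -> uniq (ords p).
Proof. by move=> h; rewrite -{1}(val_ords h); exact: map_uniq. Qed.

Lemma path_ords a s : all (fun x => x < n.+1) (a :: s) -> path (erel E) a s ->
  path (@lgraph n.+1 E) (inord a) (ords s).
Proof.
move=> h; have := val_ords h; rewrite [ords _]/= [map _ _]/= => -[ea es].
by rewrite -[X in path _ X _]ea -[X in path _ _ X]es path_map.
Qed.

Lemma mem_ords (x : 'I_n.+1) p : all (fun x => x < n.+1) p -> (x \in ords p) = (val x \in p).
Proof. by move=> h; rewrite -[in RHS](val_ords h) (mem_map val_inj). Qed.

End LiftList.

Section DeletedDrawing.

Variables (F : realFieldType) (D : Z) (n : nat) (tab : seq nat) (pos : seq pointZ).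

Lemma deleted_drawing : size tab = 3 * n.+2 ->
  base_drawing (@tnxt n.+1 tab) (tpos (n := n.+1) pos F D) ->
  base_drawing (@tnxt n tab) (tpos (n := n) pos F D).
Proof.
move=> hs [h1 h2 h3 h4]; pose w := @up_block n.
have tw (d : 'I_n.+1 * 'I_3) : tpos pos F D d = tpos (n := n.+1) pos F D (w d.1, d.2) by [].
have inj (d c : 'I_n.+1 * 'I_3) : (w d.1, d.2) = (w c.1, c.2) -> d = c.
  move=> e; rewrite [d]surjective_pairing [c]surjective_pairing; congr (_, _).
    exact: up_inj (congr1 fst e).
  exact: (congr1 snd e).
split.
- by move=> u; exact: (h1 (w u)).
- by move=> u u' z uu; apply: (h2 (w u) (w u')); rewrite (inj_eq (@up_inj n)).
- move=> d d' u z e hu hz.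
  by have [[/up_inj ? ?]|[/up_inj ? ?]] := h3 _ _ (w u) z ((tnxt_up hs d d').2 e) hu hz; [left|right].
- move=> d d' c c' z e e' n1 n2; apply: (h4 _ _ _ _ _ ((tnxt_up hs d d').2 e) ((tnxt_up hs c c').2 e')).
    by move/inj.
  by move/inj.
Qed.

End DeletedDrawing.

From mathcomp Require Import all_classical all_reals all_analysis.
Import numFieldNormedType.Exports.

Local Open Scope classical_set_scope.
Local Open Scope ring_scope.

(** * Planarity *)

Lemma straight_planar (R : realType) (G : sgraph) (pos : G -> R * R) :
  straight (@adj G) pos -> (forall x : G, exists y, adj x y) -> planar R G.
Proof.
move=> hs iso; have [pI he] := hs.
pose draw (S : {set G}) : set (R * R) :=
  [set z | exists u v, S = [set u; v]%SET /\ seg (pos u) (pos v) z].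
have set2 (u v x y : G) : [set u; v]%SET = [set x; y]%SET -> (u, v) = (x, y) \/ (u, v) = (y, x).
  move=> e; have : u \in [set x; y]%SET by rewrite -e finset.set21.
  have : v \in [set x; y]%SET by rewrite -e finset.set22.
  have : x \in [set u; v]%SET by rewrite e finset.set21.
  have : y \in [set u; v]%SET by rewrite e finset.set22.
  rewrite !finset.in_set2 => /pred2P hy /pred2P hx /pred2P hv /pred2P hu.
  by case: hu => eu; case: hv => ev; case: hx => ex; case: hy => ey;
    (left; congruence) || (right; congruence).
have drawP u v z : draw [set u; v]%SET z <-> seg (pos u) (pos v) z.
  split=> [[x [y [/set2 [[-> ->]|[-> ->]]]]] //|]; first exact: seg_sym.
  by exists u, v.
exists pos, draw; split=> //.
- move=> u v uv; have nuv : pos u != pos v.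
    by rewrite (inj_eq pI); apply/eqP => e; move: uv; rewrite e adj_irrefl.
  exists (between (pos u) (pos v)); split.
  + have aff (a b : R) : continuous (fun t : R => a + t * b).
      by move=> t; apply: cvgD; [exact: cvg_cst | apply: cvgM; [exact: cvg_id | exact: cvg_cst]].
    by apply: continuous_subspaceT => t; exact: (cvg_pair (aff _ _ t) (aff _ _ t)).
  + move=> s t _ _ [/addrI e1 /addrI e2]; apply: contraNeq nuv => st.
    have h a b : s * (a - b) = t * (a - b) -> a = b.
      move/eqP; rewrite -subr_eq0 -mulrBl mulf_eq0 subr_eq0 (negbTE st) subr_eq0 /=.
      by move/eqP.
    by rewrite [pos u]surjective_pairing [pos v]surjective_pairing (h _ _ e1) (h _ _ e2).
  + by rewrite /between !mul0r !addr0 -surjective_pairing.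
  + by rewrite /between !mul1r !subrKC -surjective_pairing.
  + apply/seteqP; split=> z /=.
      by move/drawP=> [t t01 ->]; exists t; rewrite // in_itv.
    by case=> t; rewrite /= in_itv /= => t01 <-; apply/drawP; exists t.
- move=> u v w uv [/drawP s]; apply.
  by case: (straight_vertex hs iso uv s) => ->; [left|right].
- move=> u v x y uv xy ne; apply/seteqP; split=> z //= [[/drawP s1 n] /drawP s2].
  apply: n; have [n1 n2] : (u, v) <> (x, y) /\ (u, v) <> (y, x).
    by split=> -[e1 e2]; apply: ne; rewrite e1 e2 // finset.setUC.
  by case: (he _ _ _ _ _ uv xy n1 n2 s1 s2) => ->; [left|right].
Qed.

Local Close Scope ring_scope.
Local Close Scope classical_set_scope.
Delimit Scope Z_scope with bZ.

(** * Combinatorial data *)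

(* A planar hypohamiltonian graph; [g40_cycle_codes] describes cycles of length 39
   missing each of the vertices in turn. *)
Definition g40_edges : seq (nat * nat) :=
  [::
   (0, 1); (0, 7); (1, 2); (1, 8); (1, 11); (2, 3); (3, 4); (3, 10); (3, 16); (4, 5); (4, 14);
   (5, 6); (5, 19); (5, 22); (6, 7); (7, 9); (7, 21); (8, 9); (8, 13); (9, 25); (10, 11);
   (10, 18); (11, 12); (12, 13); (12, 28); (13, 27); (14, 15); (14, 20); (15, 16); (15, 31);
   (16, 17); (17, 18); (17, 32); (18, 28); (19, 20); (19, 24); (20, 30); (21, 22); (21, 26);
   (22, 23); (23, 24); (23, 34); (24, 33); (25, 26); (25, 27); (26, 34); (26, 36); (27, 29);
   (28, 29); (29, 32); (29, 36); (30, 31); (30, 33); (31, 32); (31, 37); (33, 35); (34, 35);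
   (35, 37); (36, 37); (38, 0); (38, 2); (38, 4); (39, 0); (39, 4); (39, 6)].

Definition g40_order : seq nat :=
  [::
   35; 37; 34; 33; 36; 31; 26; 23; 30; 24; 29; 32; 15; 25; 21; 22; 20; 19; 28; 27; 17; 16; 14;
   9; 7; 5; 18; 12; 13; 3; 4; 8; 6; 0; 10; 11; 2; 39; 38; 1].

Definition g40_pos : seq pointZ :=
  [::
   (159, 396); (218, 262); (287, 210); (247, 128); (241, 4); (186, 111); (117, 172); (161, 247);
   (204, 232); (187, 226); (231, 168); (221, 210); (215, 199); (208, 208); (225, 74);
   (223, 113); (231, 130); (223, 150); (223, 166); (198, 116); (211, 105); (180, 192);
   (187, 150); (194, 147); (198, 133); (195, 200); (194, 179); (204, 194); (216, 179);
   (210, 174); (209, 125); (214, 136); (216, 153); (203, 135); (197, 158); (202, 148);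
   (203, 168); (206, 150); (396, 241); (4, 159)]%bZ.

Definition g40_cycle_codes : seq N :=
  [::
   6736612319142780090; 13572074795856778602; 16122681589163019928; 12943534785425521710;
   10197608535102685074; 12816242016019575672; 18242882313488307438; 12830406532931285374;
   16997069218157902534; 16934941255685725421; 11204363174661530204; 17247594061722341454;
   17247594059115885630; 16934927741786895432; 16141688230379175668; 17256496347261506706;
   19166795745188425170; 16934927951816157768; 16995919916160974854; 17105820184634891321;
   16996014211427624580; 17093451321022836660; 17118115058359867533; 22013807516281928789;
   16969452813059724094; 15041733608086787977; 12942240622859640762; 21992273586985853752;
   15218082385770982440; 12942143892094584762; 17255803299428342706; 12924979734806737210;
   21997679992478469989; 17093846276577456476; 16918429158736897506; 2009066129287937988;
   15306084383786921500; 17187654645223483773; 18099156685471211252; 15098808329931368213]%num.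

(* With a vertex 35 joined to the terminals 0, 1, 2 this is a planar nonhamiltonian
   graph in which every other vertex [x] is missed by a cycle on 35 vertices. Such a
   cycle leaves the edge from 35 to [q_tau`_x] unused; [q_path_codes] describes its
   part in the piece and [q_full_codes] hamiltonian paths starting at the terminals. *)
Definition q_edges : seq (nat * nat) :=
  [::
   (0, 3); (0, 5); (3, 4); (3, 6); (3, 10); (4, 5); (4, 8); (4, 15); (5, 7); (5, 13); (1, 6);
   (6, 12); (1, 21); (2, 7); (2, 22); (7, 18); (8, 9); (8, 17); (9, 10); (9, 25); (10, 11);
   (11, 12); (11, 26); (12, 20); (13, 14); (13, 19); (14, 15); (14, 29); (15, 16); (16, 17);
   (16, 30); (17, 24); (18, 19); (18, 23); (19, 28); (20, 21); (20, 27); (21, 22); (22, 23);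
   (22, 33); (23, 32); (24, 25); (24, 31); (25, 26); (26, 27); (27, 33); (27, 31); (28, 29);
   (28, 32); (29, 30); (30, 31); (30, 34); (32, 34); (33, 34)].

Definition q_order : seq nat :=
  [::
   18; 23; 19; 7; 32; 22; 28; 13; 2; 5; 34; 33; 21; 29; 14; 35; 4; 0; 30; 27; 20; 1; 15; 8; 3;
   31; 16; 26; 12; 6; 17; 9; 10; 24; 25; 11].

Definition q_pos : seq pointZ :=
  [::
   (0, 0); (100, 0); (0, 100); (29, 15); (24, 26); (13, 31); (60, 12); (10, 61); (28, 27);
   (32, 25); (34, 21); (40, 23); (49, 21); (19, 36); (23, 35); (25, 31); (27, 32); (29, 30);
   (18, 51); (20, 43); (49, 27); (59, 27); (29, 55); (24, 50); (32, 30); (33, 28); (37, 28);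
   (37, 33); (23, 42); (25, 37); (28, 36); (32, 33); (25, 44); (31, 43); (28, 41)]%bZ.

Definition q_tau : seq nat :=
  [::
   0; 1; 2; 1; 0; 1; 2; 1; 0; 0; 0; 1; 0; 0; 0; 0; 0; 0; 0; 1; 1; 0; 0; 0; 0; 0; 0; 0; 0; 0; 0;
   0; 1; 1; 0].

Definition q_path_codes : seq N :=
  [::
   1731717663606357; 7110969256115927; 2480775303358724; 3555791797317555; 3913055346823995;
   3695308585885092; 2765319767894005; 3088440671962218; 4927078239869019; 5248593308746834;
   4740941916558984; 4741058386123127; 4986747927371400; 1398550340789355; 5634281935621258;
   5248588836769234; 4740651578616418; 4740646202290720; 7521836614869346; 4998785432957422;
   7238135704837582; 5248593764312560; 3552532803293979; 5236361745062770; 4740980695999176;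
   5248588185603106; 2763492113104156; 3695308502592603; 5634384857441170; 4996781447884680;
   5643348123486346; 5494604583625462; 6966686630909850; 5248214809872982; 4792703111412360]%num.

Definition q_full_codes : seq N :=
  [::
   16812391788531795; 13394000299218190; 24067727942045542]%num.

(* A cubic planar hypohamiltonian graph on 70 vertices. Position [3 u + i] holds
   [3 w + j] when port [i] of [u] is joined to port [j] of [w]. *)
Definition h_table : seq nat :=
  [::
   3; 6; 207; 0; 9; 12; 1; 13; 15; 4; 18; 21; 5; 7; 24; 8; 27; 30; 10; 33; 36; 11; 39; 42; 14;
   45; 48; 16; 51; 54; 17; 57; 60; 19; 63; 66; 20; 69; 72; 22; 75; 78; 23; 46; 81; 25; 43; 84;
   26; 61; 87; 28; 90; 93; 29; 96; 99; 31; 102; 105; 32; 49; 108; 34; 111; 208; 35; 70; 114; 37;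
   67; 117; 38; 120; 123; 40; 82; 126; 41; 124; 129; 44; 76; 132; 47; 88; 133; 50; 85; 135; 52;
   138; 209; 53; 97; 141; 55; 94; 144; 56; 147; 150; 58; 151; 153; 59; 109; 156; 62; 106; 136;
   64; 115; 139; 68; 112; 159; 71; 121; 160; 73; 118; 162; 74; 79; 165; 77; 130; 168; 80; 127;
   171; 83; 86; 174; 89; 110; 175; 91; 113; 142; 95; 140; 161; 98; 148; 177; 100; 145; 180; 101;
   103; 183; 104; 157; 186; 107; 154; 176; 116; 119; 143; 122; 166; 189; 125; 163; 172; 128;
   192; 195; 131; 167; 196; 134; 137; 158; 146; 198; 201; 149; 184; 199; 152; 181; 187; 155;
   185; 204; 164; 197; 202; 169; 203; 205; 170; 173; 190; 178; 182; 206; 179; 191; 193; 188;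
   194; 200; 2; 65; 92].

Definition h_order : seq nat :=
  [::
   40; 24; 39; 54; 12; 41; 23; 53; 55; 63; 6; 26; 22; 38; 47; 57; 65; 67; 3; 11; 13; 43; 37; 31;
   46; 56; 59; 64; 1; 7; 21; 25; 42; 17; 32; 30; 48; 66; 68; 0; 4; 14; 69; 27; 9; 18; 49; 60;
   62; 2; 8; 15; 44; 5; 33; 61; 51; 16; 28; 58; 10; 50; 34; 52; 20; 29; 45; 19; 35; 36].

(* A flow chosen so that its absolute values on the 105 edges are distinct. *)
Definition h_flow : seq Z :=
  [::
   8128; (-12970); 4842; (-8128); (-3752); 11880; 12970; (-2085); (-10885); 3752; (-8892); 5140;
   (-11880); 2085; 9795; 10885; (-4909); (-5976); 8892; 1508; (-10400); (-5140); 2843; 2297;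
   (-9795); 1223; 8572; 4909; (-128); (-4781); 5976; (-2508); (-3468); (-1508); (-8990); 10498;
   10400; (-8676); (-1724); (-2843); 3939; (-1096); (-2297); 672; 1625; (-1223); (-672); 1895;
   (-8572); 3247; 5325; 128; (-2258); 2130; 4781; (-6622); 1841; 2508; 5592; (-8100); 3468;
   (-3247); (-221); 8990; (-7511); (-1479); (-10498); 2465; 8033; 8676; (-2465); (-6211); 1724;
   (-2606); 882; (-3939); (-2264); 6203; 1096; (-793); (-303); (-1625); 2264; (-639); (-1895);
   1100; 795; (-5325); (-1100); 6425; 2258; 1105; (-3363); (-2130); 630; 1500; 6622; (-630);
   (-5992); (-1841); 5783; (-3942); (-5592); 3461; 2131; 8100; (-2595); (-5505); 221; 2595;
   (-2816); 7511; (-3731); (-3780); (-8033); 3731; 4302; 6211; (-3084); (-3127); 2606; 3084;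
   (-5690); (-882); 793; 89; (-6203); 1095; 5108; 303; (-1095); 792; 639; (-795); 156; (-6425);
   2816; 3609; (-1105); 3780; (-2675); (-1500); 2675; (-1175); 5992; (-2839); (-3153); (-5783);
   2839; 2944; 3942; (-3461); (-481); (-2131); 1740; 391; 5505; (-1740); (-3765); (-4302); 3127;
   1175; 5690; (-3748); (-1942); (-89); 3748; (-3659); (-5108); (-1410); 6518; (-792); 3659;
   (-2867); (-156); (-3609); 3765; 3153; (-4889); 1736; (-2944); 1673; 1271; 481; (-1673); 1192;
   (-391); (-1192); 1583; 1942; (-3651); 1709; 1410; (-3445); 2035; (-6518); 2867; 3651; 4889;
   (-1271); (-3618); (-1736); (-1709); 3445; (-1583); (-2035); 3618; (-4842); 1479; 3363]%bZ.

(* The ports of the vertices below 69 lie in a right triangle with legs 2000; the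
   last three points lie outside and see its corners. *)
Definition h_pos : seq pointZ :=
  [::
   (139, 132); (121, 148); (0, 0); (297, 248); (403, 308); (348, 304); (224, 311); (275, 367);
   (276, 418); (565, 372); (679, 399); (613, 410); (344, 355); (325, 371); (357, 391);
   (329, 577); (353, 687); (359, 627); (859, 416); (986, 409); (912, 439); (595, 458);
   (593, 484); (578, 479); (403, 447); (430, 472); (422, 478); (370, 857); (368, 978);
   (389, 905); (395, 616); (414, 617); (411, 605); (1187, 371); (1358, 315); (1218, 389);
   (891, 493); (895, 519); (867, 521); (607, 516); (607, 530); (620, 533); (546, 495);
   (524, 500); (537, 507); (466, 492); (489, 499); (478, 504); (432, 515); (435, 537);
   (440, 530); (345, 1174); (298, 1344); (368, 1198); (429, 879); (450, 878); (449, 856);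
   (435, 629); (447, 641); (445, 628); (425, 582); (431, 565); (434, 576); (1668, 185);
   (1647, 239); (2000, 0); (1108, 482); (1045, 521); (1062, 536); (927, 544); (965, 544);
   (922, 568); (814, 551); (794, 569); (780, 563); (593, 542); (579, 543); (594, 554);
   (648, 552); (668, 561); (654, 563); (540, 525); (551, 534); (533, 534); (478, 522);
   (474, 530); (482, 531); (454, 538); (462, 538); (459, 546); (180, 1660); (243, 1637);
   (0, 2000); (463, 1077); (491, 1011); (528, 1023); (473, 898); (483, 932); (486, 886);
   (466, 810); (476, 792); (473, 781); (462, 666); (470, 686); (470, 672); (452, 615);
   (453, 606); (457, 612); (445, 582); (449, 589); (451, 581); (1274, 532); (1124, 630);
   (1049, 728); (1033, 605); (1048, 629); (988, 651); (874, 616); (844, 625); (856, 654);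
   (789, 593); (802, 607); (772, 602); (732, 569); (704, 568); (711, 575); (609, 575);
   (620, 582); (613, 590); (646, 575); (637, 580); (646, 583); (507, 542); (495, 541);
   (494, 551); (461, 562); (459, 570); (464, 569); (550, 1250); (751, 1023); (654, 1090);
   (631, 981); (662, 997); (702, 922); (500, 828); (503, 803); (512, 794); (490, 784);
   (497, 787); (497, 774); (477, 743); (476, 719); (482, 728); (478, 664); (479, 652);
   (486, 667); (467, 615); (473, 625); (472, 608); (884, 719); (851, 720); (812, 787);
   (725, 608); (706, 606); (696, 615); (699, 588); (697, 596); (687, 593); (611, 614);
   (604, 631); (615, 621); (655, 593); (665, 596); (654, 601); (481, 570); (474, 574);
   (475, 584); (533, 752); (538, 735); (550, 726); (504, 751); (504, 739); (511, 739);
   (493, 723); (498, 726); (498, 716); (500, 686); (503, 698); (511, 693); (658, 630);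
   (643, 632); (633, 644); (584, 656); (580, 668); (570, 671); (632, 619); (642, 614);
   (639, 622); (530, 727); (523, 728); (530, 719); (578, 691); (599, 671); (586, 677);
   (530, 694); (545, 688); (535, 700); (-1000, 5000); (-100, 5000); (-500, 4500)]%bZ.

(* Cycles of length 69 through the vertex 69: any two edges of the graph that are
   not both incident with 69 are missed by one of them. *)
Definition h_pass_starts : seq nat :=
  [::
   65; 2; 65; 2; 65; 2; 2; 65; 2; 2; 2; 2; 2; 65; 2; 65; 2; 65; 2; 65; 2; 65; 2; 2; 2; 65; 2; 2;
   2; 2; 2; 2; 2; 65; 65; 2; 2; 2; 65; 2; 65; 2; 65; 2; 65; 65; 2; 2; 2; 2; 2; 2; 2; 2; 2; 65;
   2; 65; 2; 2; 65; 2; 2; 2; 2; 65; 2; 2; 2].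

Definition h_pass_turns : seq positive :=
  [::
   589070876220619723779; 454474826859373786839; 325251595502843255393; 513193042153839288050;
   580730794052433159300; 333053335157570276691; 416172446977100566696; 310134526297252686433;
   515432621848757959743; 347754878283939103181; 540918132399204027042; 583143917522948670390;
   412533157054976451724; 561262003477325093890; 311638413919806507739; 452072087675683434555;
   339950574498895799154; 330658989199129397009; 411564619642895451933; 538619682471215618264;
   325763932435239632909; 375828596855533045674; 403913009501146360844; 352680016822987430739;
   490822092068890017373; 589500976078873763763; 545455968203002901922; 408991335023621927314;
   502557632965721231183; 513261243329281224957; 538460532343651111595; 333058022376838485049;
   372529642429709740834; 580731985671025333251; 589940244107697083395; 416173256939905743303;
   416077722094025120936; 398076076940933687131; 462188784431019034554; 582919467640497391680;
   538696219781472758808; 344814022659828752659; 583208232536417113091; 410739498507370493439;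
   396362898043978126016; 560447582330098658306; 352776723777874632888; 410739479825290565759;
   590224787342452135175; 323543451322341175496; 492733924788184075139; 411378206065404814527;
   412493754146796054301; 576681587727384597083; 416070745688982562984; 488508567341556172400;
   410548445366260027132; 589111417635361545218; 486331985487322812764; 352739059504210316627;
   452072104180236644411; 410675644242903496615; 490833580282335117204; 410675641872860239999;
   398122627400875923355; 323986857083072586577; 398121143368984532219; 398122162909572414427;
   558752699209489762828]%positive.

(* Hamiltonian paths of the graph minus 69 from each neighbour of 69, ending at a
   vertex that is not such a neighbour. *)
Definition h_end_turns : seq positive :=
  [::
   460933922258323340526; 404944854406471690717; 466852563414602347008]%positive.

Definition h_skip_start : nat :=
  1.

Definition h_skip_turns : positive :=
  756081827437676166383%positive.

Definition k4_table : seq nat :=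
  [::
   3; 6; 9; 0; 7; 10; 1; 4; 11; 2; 5; 8].

(** The six edges carry the absolute values 1 to 6. *)
Definition k4_flow : seq Z :=
  [::
   (-5); 3; 2; 5; 1; (-6); (-3); (-1); 4; (-2); 6; (-4)]%bZ.

Definition k4_pos : seq pointZ :=
  [::
   (60, 0); (0, 60); (45, 50); (240, 0); (240, 60); (195, 50); (0, 240); (60, 240); (45, 200);
   (72, 80); (132, 80); (72, 140)]%bZ.

Lemma lgraph_sym n E : symmetric (@lgraph n E).
Proof. by move=> x y; exact: erel_sym. Qed.

Lemma lgraph_irr n E : all (fun e => e.1 != e.2) E -> irreflexive (@lgraph n E).
Proof.
move=> /allP h x; apply/negP; rewrite /lgraph /erel orbb => /h /=.
by rewrite eqxx.
Qed.

Definition cornerZ (D : Z) (k : 'I_3) : pointZ :=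
  if val k is 0 then (Z0, Z0) else if val k is 1 then (D, Z0) else (Z0, D).

Lemma pt_corner (F : realFieldType) D k : Z.lt Z0 D -> pt F D (cornerZ D k) = corner F k.
Proof.
move=> D0; have h : (zr F D / zr F D = 1)%R by rewrite divff // gt_eqF // zrD_gt0.
have h0 : (zr F Z0 / zr F D = 0)%R by rewrite /zr /= mul0r.
by case: k => [[|[|[|//]]] ?]; rewrite /pt /cornerZ /corner /= ?h ?h0.
Qed.

Lemma erel_cat E E' x y : erel E x y -> erel (E ++ E') x y.
Proof. by rewrite /erel !mem_cat => /orP[] ->; rewrite ?orbT. Qed.

Lemma lterm_inord n (h : 3 <= n.+1) (k : 'I_3) : lterm h k = inord k.
Proof. by apply: val_inj; rewrite /= inordK // (leq_trans (ltn_ord k) h). Qed.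

(** * The piece on 35 vertices *)

Definition adjQ : rel 'I_35 := @lgraph 35 q_edges.
Definition termQ : 'I_3 -> 'I_35 := @lterm 35 isT.
Notation q_apex_edges := (q_edges ++ [:: (0, 35); (1, 35); (2, 35)]).
Definition q_port (x : 'I_35) : 'I_3 := inord (nth 0 q_tau x).

Lemma Q_sym : symmetric adjQ. Proof. exact: lgraph_sym. Qed.
Lemma termQ_inj : injective termQ. Proof. exact: lterm_inj. Qed.

Lemma q_lt : all (fun e => (e.1 < 35) && (e.2 < 35)) q_edges. Proof. by vm_compute. Qed.

Lemma Q_irr : irreflexive adjQ. Proof. by apply: lgraph_irr; vm_compute. Qed.

Lemma Q_iso x : exists y, adjQ x y. Proof. by apply: list_isoP x; vm_compute. Qed.

Lemma q_conn3 : conn3 36 q_apex_edges. Proof. by vm_cast_no_check (erefl true). Qed.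

Lemma Q_conn1 : conn1 adjQ. Proof. exact: (@apex_conn1 35 q_edges isT q_lt q_conn3). Qed.

Lemma Q_conn2 : conn2_to adjQ termQ. Proof. exact: (@apex_conn2_to 35 q_edges isT q_lt q_conn3). Qed.

Lemma q_nonham : list_nonham q_apex_edges q_order. Proof. by vm_cast_no_check (erefl true). Qed.

(** A pass through all 35 vertices would close through the additional vertex 35 to a Hamiltonian
    cycle of [q_apex_edges]. *)
Lemma Q_bound : pass_bound adjQ termQ 34.
Proof.
move=> a s ps us /codomP[i ai] /codomP[j lj] ne.
have s35 : size (a :: s) <= 35.
  by have := max_card (mem (a :: s)); rewrite (card_uniqP us) card_ord.
rewrite leqNgt; apply/negP => s34.
have es : size (a :: s) = 35 by apply/eqP; rewrite eqn_leq s35.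
have apexE (k : 'I_3) : erel q_apex_edges 35 (val (termQ k)).
  have /allP/(_ (val k)) : all (erel q_apex_edges 35) (iota 0 3) by vm_compute.
  by rewrite mem_iota ltn_ord; apply.
apply: (@list_nonham_path _ _ 35 [seq val u | u <- a :: s] q_nonham).
- by vm_compute.
- by [].
- by rewrite (map_inj_uniq val_inj).
- by rewrite size_map.
- by apply/allP => x /mapP[u _ ->]; exact: ltn_ord.
- by rewrite [sorted _ _]path_map; apply: sub_path ps => x y; exact: erel_cat.
- by rewrite /= ai; exact: apexE.
- by rewrite /= last_map lj; exact: apexE.
Qed.

Definition q_path_ok (x : nat) (p : seq nat) : bool :=
  let k := nth 0 q_tau x in
  [&& all (fun y => y < 35) p, sorted (erel q_edges) p, uniq p, size p == 34 &
   [&& x \notin p, head 0 p < 3, last 0 p < 3, k < 3 & [&& head 0 p != last 0 p, head 0 p != k & last 0 p != k]]].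

(** The coerced boolean is the start of the trail: the smallest terminal other than the one that
    [q_tau] assigns to [x]. *)
Definition q_path (x : nat) : seq nat :=
  trail q_edges 34 (nth N0 q_path_codes x) (nth 0 q_tau x == 0).

Lemma q_paths_ok : all (fun x => q_path_ok x (q_path x)) (iota 0 35).
Proof. by vm_compute. Qed.

Lemma Q_pass x : has_pass adjQ termQ 34 (pred1 x) (q_port x).
Proof.
have /allP/(_ (val x)) := q_paths_ok; rewrite mem_iota ltn_ord => /(_ isT).
case: (q_path x) => [|a s]; first by rewrite /q_path_ok.
case/and5P=> pl ps pu /eqP sz /and5P[xp a3 l3 k3 /and3P[al ak lk]].
rewrite [head _ _]/= [last _ _]/= in a3 l3 al ak lk.
have termE c (h : c < 3) : termQ (Ordinal h) = inord c by exact: lterm_inord.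
apply: (has_pass_intro Q_sym (i := Ordinal a3) (j := Ordinal l3) (s := ords 34 s)) => //.
- by rewrite -val_eqE /= inordK.
- by rewrite -val_eqE /= inordK.
- rewrite /is_pass !termE; split.
  + exact: path_ords.
  + exact: (@uniq_ords 34 (a :: s)).
  + by rewrite last_map.
  + by rewrite size_map.
- by rewrite termE has_pred1 -[_ :: _]/(ords 34 (a :: s)) mem_ords.
Qed.

Lemma Q_port_surj k : exists x, q_port x = k.
Proof.
have /allP/(_ (val k)) : all (fun k => has (fun x => nth 0 q_tau x == k) (iota 0 35)) (iota 0 3) by vm_compute.
rewrite mem_iota ltn_ord => /(_ isT) /hasP[x]; rewrite mem_iota => /= x35 /eqP e.
by exists (Ordinal x35); apply: val_inj; rewrite /= inordK e.
Qed.

Definition q_full_ok (k : nat) (p : seq nat) : bool :=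
  [&& all (fun y => y < 35) p, sorted (erel q_edges) p, uniq p, size p == 35 & head 0 p == k].

Lemma Q_end i : has_end adjQ termQ 35 pred0 i.
Proof.
have /allP/(_ (val i)) : all (fun k => q_full_ok k (trail q_edges 35 (nth N0 q_full_codes k) k)) (iota 0 3).
  by vm_compute.
rewrite mem_iota ltn_ord => /(_ isT).
case: (trail _ _ _ _) => [|a s]; first by rewrite /q_full_ok.
case/and5P=> pl ps pu /eqP sz /eqP /= ai.
have termE : termQ i = inord a by rewrite ai; exact: lterm_inord.
exists (ords 34 s); rewrite termE; split.
- exact: path_ords.
- exact: (@uniq_ords 34 (a :: s)).
- by rewrite size_map.
- by rewrite has_pred0.
Qed.

Lemma q_straight : list_straight 35 q_edges q_pos. Proof. by vm_cast_no_check (erefl true). Qed.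

(** The denominator 100 brings the terminals to the corners of the standard triangle. *)
Definition posQ (F : realFieldType) (x : 'I_35) : F * F := pt F 100%bZ (place q_pos x).

Lemma Q_drawing (F : realFieldType) : piece_drawing adjQ termQ (@posQ F).
Proof.
split.
- exact: (list_straightP F (D := 100%bZ) (erefl _) q_straight).
- move=> x; apply: std_pt => //.
  have /allP/(_ (val x)) : all (fun x => stdZ 100%bZ (place q_pos x)) (iota 0 35) by vm_compute.
  by rewrite mem_iota ltn_ord; apply.
- by move=> k; rewrite -(pt_corner F k (D := 100%bZ)) //; congr pt; case: k => [[|[|[|//]]] ?].
Qed.

(** * The composite piece *)

Definition nxtH := @tnxt 69 h_table.
Definition nxtR := @tnxt 68 h_table.
Definition extR := text 68 h_table.
Definition adjR := cadj adjQ termQ nxtR.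
Definition termR := cterm termQ extR.

Lemma h_size : size h_table = 3 * 70. Proof. by []. Qed.

Lemma h_ok : [&& table_ok 69 h_table, table_closed 69 h_table, table_conn 69 h_table & flow_ok 69 h_table h_flow].
Proof. by vm_cast_no_check (erefl true). Qed.

Lemma h_table_ok : table_ok 69 h_table. Proof. by case/and4P: h_ok. Qed.

Lemma h_exts : exts_ok 68 h_table. Proof. by vm_compute. Qed.

Lemma H_sym d d' : nxtH d = Some d' -> nxtH d' = Some d. Proof. exact: (table_okP h_table_ok).1. Qed.

Lemma H_neq d d' : nxtH d = Some d' -> d.1 != d'.1. Proof. exact: (table_okP h_table_ok).2. Qed.

Lemma H_closed d : nxtH d. Proof. by apply: table_closedP; case/and4P: h_ok. Qed.

Lemma H_cut3 (X : {set 'I_70}) : X != finset.set0 -> X != [set: 'I_70]%SET -> 3 <= #|outset nxtH X|.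
Proof. exact: table_cut3 h_ok X. Qed.

Definition R_up := tnxt_up (n := 68) h_size.
Definition R_last := tnxt_last h_exts h_size.

Lemma R_sym d d' : nxtR d = Some d' -> nxtR d' = Some d.
Proof. exact: (deletion_sym H_sym R_up). Qed.

Lemma R_neq d d' : nxtR d = Some d' -> d.1 != d'.1.
Proof. exact: (deletion_neq (@up_inj 68) H_neq R_up). Qed.

Lemma R_cut3 (X : {set 'I_69}) : X != finset.set0 -> X != [set: 'I_69]%SET -> 3 <= #|outset nxtR X|.
Proof. exact: (deletion_cut3 (@up_inj 68) (@codom_up 68) R_up H_cut3). Qed.

Lemma R_None d : nxtR d = None <-> exists k, extR k = d.
Proof. exact: (nxt_None (@up_inj 68) (@codom_up 68) H_sym H_closed R_up R_last). Qed.

Lemma ext_block : injective (fun k => (extR k).1). Proof. exact: text_block. Qed.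

Lemma ext_inj : injective extR. Proof. by move=> k k' e; apply: ext_block; exact: (congr1 fst e). Qed.

Lemma termR_inj : injective termR. Proof. exact: cterm_inj termQ_inj ext_inj. Qed.

Lemma adjR_sym : symmetric adjR. Proof. exact: cadj_sym Q_sym R_sym. Qed.

Lemma adjR_irr : irreflexive adjR. Proof. exact: cadj_irr R_neq Q_irr. Qed.

Lemma h_nonham : list_nonham (table_edges 69 h_table) h_order.
Proof. by vm_cast_no_check (erefl true). Qed.

Lemma R_bound : pass_bound adjR termR (68 * 34).
Proof.
have hn : no_spanning_pass nxtR extR.
  by apply: (table_no_spanning_pass _ h_exts h_table_ok h_size h_nonham); vm_compute.
have ext_None k : nxtR (extR k) = None by apply/R_None; exists k.
have := cadj_pass_bound Q_sym termQ_inj R_sym R_neq ext_None ext_inj Q_bound hn.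
by rewrite card_ord.
Qed.

Definition h_passes : seq (seq (nat * nat)) :=
  [seq run 68 h_table (turns p.2) p.1 | p <- zip h_pass_starts h_pass_turns].

Definition h_end (k : nat) : seq (nat * nat) :=
  run 68 h_table (turns (nth xH h_end_turns k)) (nth 0 (ext_codes 68 h_table) k).

Lemma h_passes_ok : all (pass_ok 68 h_table) h_passes && cover_ok 68 h_table h_passes.
Proof. by vm_cast_no_check (erefl true). Qed.

Lemma H_passes d d' : (forall k k', d = extR k -> d' = extR k' -> k = k') ->
  exists i j x w, [/\ i != j, base_pass nxtR extR i j x w,
    all (avoids d) (x :: w) & all (avoids d') (x :: w)].
Proof. by case/andP: h_passes_ok => h1 h2; exact: (pass_okP h_exts h1 h2). Qed.

Lemma H_ends i : exists x w d,
  [/\ walk nxtR x w, x.1 = extR i, nxtR ((last x w).1.1, (last x w).2) = Some d,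
    d.1 \notin [seq y.1.1 | y <- x :: w] /\ (size w).+2 = #|'I_69| &
    forall j, j != i -> (extR j).1 != d.1 /\ all (avoids (extR j)) (x :: w)].
Proof. by apply: (end_okP (f := h_end) _ h_exts) i; vm_compute. Qed.

Lemma H_skip : exists x s, [/\ walk nxtR x s, nxtR ((last x s).1.1, (last x s).2) = Some x.1,
  (size s).+1 = #|'I_69| & forall k, all (avoids (extR k)) (x :: s)].
Proof.
by apply: (skip_okP h_exts (L := run 68 h_table (turns h_skip_turns) h_skip_start)); vm_compute.
Qed.

Lemma R_exits : #|[set d | nxtR d == None]| <= 3.
Proof.
apply: (@leq_trans #|[set extR k | k : 'I_3]%SET|); last first.
  by apply: leq_trans (leq_imset_card _ _) _; rewrite card_ord.
apply: subset_leq_card; apply/fintype.subsetP => d; rewrite finset.inE => /eqP /R_None[k <-].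
exact: imset_f.
Qed.

Lemma R_conn1 : conn1 adjR.
Proof. exact: (comp_conn1 termQ_inj R_sym R_neq Q_conn1 R_cut3 R_exits). Qed.

Lemma R_conn2 : conn2_to adjR termR.
Proof.
move=> p q x pq xpq.
case: (comp_reach Q_sym termQ_inj R_sym R_neq Q_conn1 Q_conn2 R_cut3 pq xpq) => [[d [h1 h2 h3]]|h].
  by have [k ek] := (R_None d).1 h1; exists k; rewrite /termR /cterm ek.
have [k /andP[kp kq]] := avoid2 p q termR_inj.
have hk : termR k \notin [set p; q]%SET by rewrite !finset.inE negb_or kp.
by exists k => //; exact: h.
Qed.

Lemma R_iso (x : 'I_69 * 'I_35) : exists y, adjR x y.
Proof. by have [y h] := Q_iso x.2; exists (x.1, y); rewrite /adjR /cadj eqxx h. Qed.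

Lemma h_drawing : table_drawing 69 h_table h_pos.
Proof. by vm_cast_no_check (erefl true). Qed.

Section Drawings.

Variable F : realFieldType.

Definition posH : 'I_70 * 'I_3 -> F * F := tpos h_pos F 2000%bZ.

Lemma H_drawing : base_drawing nxtH posH.
Proof. exact: (table_drawingP F (D := 2000%bZ) (erefl _) h_table_ok h_drawing). Qed.

Definition posHR : 'I_69 * 'I_3 -> F * F := tpos h_pos F 2000%bZ.

Lemma HR_drawing : base_drawing nxtR posHR.
Proof. exact: deleted_drawing h_size H_drawing. Qed.

Definition posR : 'I_69 * 'I_35 -> F * F := cpos (@posQ F) posHR.

Lemma h_std : all (fun c => stdZ 2000%bZ (place h_pos c)) (iota 0 207).
Proof. by vm_compute. Qed.

Lemma h_corner : all (fun k => let p := place h_pos (nth 0 (ext_codes 68 h_table) k) in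
  let q := nth (Z0, Z0) [:: (Z0, Z0); (2000%bZ, Z0); (Z0, 2000%bZ)] k in
  Z.eqb p.1 q.1 && Z.eqb p.2 q.2) (iota 0 3).
Proof. by vm_compute. Qed.

Lemma R_drawing : piece_drawing adjR termR posR.
Proof.
apply: (composite_piece R_sym R_neq Q_iso (Q_drawing F) HR_drawing) => [d|k].
  apply: std_pt => //; have /allP := h_std; apply.
  by rewrite mem_iota add0n; exact: dart_code_lt.
rewrite -(pt_corner F k (D := 2000%bZ)) // /posHR /tpos (text_code h_exts).
have /allP/(_ (val k)) := h_corner; rewrite mem_iota ltn_ord => /(_ isT) /andP[/Z.eqb_eq e1 /Z.eqb_eq e2].
by congr pt; rewrite [LHS]surjective_pairing e1 e2; case: k {e1 e2} => [[|[|[|//]]] ?].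
Qed.

End Drawings.

(** * The complete graph on four blocks *)

Definition nxtK := @tnxt 3 k4_table.

Lemma k4_ok : [&& table_ok 3 k4_table, table_closed 3 k4_table, table_conn 3 k4_table & flow_ok 3 k4_table k4_flow].
Proof. by vm_compute. Qed.

Lemma k4_table_ok : table_ok 3 k4_table. Proof. by case/and4P: k4_ok. Qed.

Lemma K_sym d d' : nxtK d = Some d' -> nxtK d' = Some d. Proof. exact: (table_okP k4_table_ok).1. Qed.

Lemma K_neq d d' : nxtK d = Some d' -> d.1 != d'.1. Proof. exact: (table_okP k4_table_ok).2. Qed.

Lemma K_closed d : nxtK d. Proof. by apply: table_closedP; case/and4P: k4_ok. Qed.

Lemma K_cut3 (X : {set 'I_4}) : X != finset.set0 -> X != [set: 'I_4]%SET -> 3 <= #|outset nxtK X|.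
Proof. exact: table_cut3 k4_ok X. Qed.

Lemma K_target (k l : 'I_4) i : (exists j, nxtK (k, i) = Some (l, j)) <->
  nth 12 k4_table (3 * k + i) %/ 3 = l.
Proof.
split=> [[j /tnxtP /eqP e]|e].
  by rewrite -[in RHS](dart_code_div (l, j)) -e.
case E: (nxtK (k, i)) (K_closed (k, i)) => [[l' j]|] // _; exists j.
move/tnxtP/eqP: E => E'; congr (Some (_, _)); apply: val_inj => /=.
by rewrite -e -[LHS](dart_code_div (l', j)) -E'.
Qed.

Lemma K_linked k l : k != l -> exists i j, nxtK (k, i) = Some (l, j).
Proof.
move=> kl; have /allP/(_ (val k)) : all (fun k => all (fun l => (k == l) ||
    has (fun i => nth 12 k4_table (3 * k + i) %/ 3 == l) (iota 0 3)) (iota 0 4)) (iota 0 4).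
  by vm_compute.
rewrite mem_iota ltn_ord => /(_ isT) /allP/(_ (val l)); rewrite mem_iota ltn_ord => /(_ isT).
rewrite (val_eqE k l) (negbTE kl) => /hasP[i]; rewrite mem_iota => i3 /eqP e.
by exists (Ordinal (i3 : i < 3)); apply/K_target.
Qed.

Lemma K_simple k l i i' j j' : nxtK (k, i) = Some (l, j) -> nxtK (k, i') = Some (l, j') -> i = i'.
Proof.
move=> e e'; have /K_target h : exists j, nxtK (k, i) = Some (l, j) by exists j.
have /K_target h' : exists j, nxtK (k, i') = Some (l, j) by exists j'.
have /allP/(_ (val k)) : all (fun k => uniq [seq nth 12 k4_table (3 * k + i) %/ 3 | i <- iota 0 3]) (iota 0 4).
  by vm_compute.
rewrite mem_iota ltn_ord => /(_ isT) u; apply: val_inj; apply/eqP.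
have := nth_uniq 0 _ _ u; rewrite size_map size_iota => /(_ _ _ (ltn_ord i) (ltn_ord i')).
by rewrite !(nth_map 0) ?size_iota // !nth_iota // !add0n h h' eqxx => <-.
Qed.

Lemma K_drawing F : base_drawing nxtK (tpos k4_pos F 1%bZ).
Proof. by apply: (table_drawingP F (D := 1%bZ) _ k4_table_ok) => //; vm_compute. Qed.

Section CompositeGraph.

Variables (B Q : finType) (e : rel Q) (term : 'I_3 -> Q) (nxt : B * 'I_3 -> option (B * 'I_3)).
Hypotheses (e_sym : symmetric e) (e_irr : irreflexive e) (term_inj : injective term)
  (nxt_sym : forall d d', nxt d = Some d' -> nxt d' = Some d)
  (nxt_neq : forall d d', nxt d = Some d' -> d.1 != d'.1).

Definition composite : sgraph :=
  SGraph (cadj_sym term e_sym nxt_sym) (cadj_irr term nxt_neq e_irr).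

Lemma composite_k_connected : 3 < #|{: B * Q}| -> conn1 e -> conn2_to e term -> (forall d, nxt d) ->
  (forall X : {set B}, X != finset.set0 -> X != [set: B]%SET -> 3 <= #|outset nxt X|) ->
  k_connected 3 composite.
Proof.
move=> c3 h1 h2 cl cut; apply: k_connected3 => // p q x y pq xpq ypq.
case: (comp_reach e_sym term_inj nxt_sym nxt_neq h1 h2 cut pq xpq) => [[d [hd _ _]]|h].
  by have := cl d; rewrite hd.
exact: h.
Qed.

Lemma composite_planar (R : realType) (posQ : Q -> R * R) (P : B * 'I_3 -> R * R) : (forall x, exists y, e x y) ->
  piece_drawing e term posQ -> base_drawing nxt P -> planar R composite.
Proof.
move=> iso hQ hB; apply: (@straight_planar R composite (cpos posQ P)).
  exact: (composite_straight nxt_sym nxt_neq iso hQ hB).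
by move=> x; have [y h] := iso x.2; exists (x.1, y); rewrite /= /cadj eqxx h.
Qed.

End CompositeGraph.

Lemma cycles_avoidI (G : sgraph) i t : (forall c : seq G, is_cycle c -> size c <= t) ->
  (forall S : {set G}, #|S| = i -> exists c : seq G, [/\ is_cycle c, size c = t & {in S, forall v, v \notin c}]) ->
  cycles_avoid i G.
Proof. by move=> hb h S /h[c [cc sc cS]]; exists c; do !split=> //; rewrite sc. Qed.

Lemma paths_avoidI (G : sgraph) i t : (forall p : seq G, is_path p -> size p <= t) ->
  (forall S : {set G}, #|S| = i -> exists p : seq G, [/\ is_path p, size p = t & {in S, forall v, v \notin p}]) ->
  paths_avoid i G.
Proof. by move=> hb h S /h[c [cc sc cS]]; exists c; do !split=> //; rewrite sc. Qed.

(** Orders are natural numbers, so a least one exists as soon as some graph has the property. *)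
Lemma smallest_order_le (P : sgraph -> Prop) (G : sgraph) N : P G -> gorder G <= N ->
  exists n, smallest_order P n /\ n <= N.
Proof.
move=> hG GN; have ex : exists n, `[< exists G : sgraph, P G /\ gorder G = n >].
  by exists (gorder G); apply/asboolP; exists G.
case: (ex_minnP ex) => n /asboolP hn hmin; exists n; split; last first.
  by apply: leq_trans GN; apply: hmin; apply/asboolP; exists G.
by split=> // G' hG'; apply: hmin; apply/asboolP; exists G'.
Qed.

Lemma pred2_notin (T : finType) (x y : T) s : ~~ has (pred2 x y) s ->
  {in [set x; y]%SET, forall v, v \notin s}.
Proof.
move=> /hasPn h v; rewrite finset.in_set2 => hv; apply/negP => /h.
by rewrite /= hv.
Qed.

(** * The four graphs *)

Definition graph_C2 : sgraph := composite termQ Q_sym Q_irr H_sym H_neq.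

Lemma graph_C2_cycles : cycles_avoid 2 graph_C2.
Proof.
have c69 : #|'I_69| = 69 by rewrite card_ord.
apply: (@cycles_avoidI _ _ (69 * 34)) => [c /andP[c3 /andP[cc uc]]|S /eqP/cards2P[x [y [_ ->]]]].
  have hR : pass_bound adjR termR (#|'I_69|.-1 * 34) by rewrite c69; exact: R_bound.
  have := cycle_bound (v := ord_max) Q_sym termQ_inj H_sym H_neq Q_bound hR
    (deletion_embedded adjQ (@up_inj 68) (@codom_up 68) termQ_inj H_sym R_up R_last) _ _ _ _ cc uc c3.
  rewrite !card_ord; apply=> // -[u q]; rewrite /= -codom_up.
  apply/codomP/codomP => [[[u' q'] [-> _]]|[u' ->]]; first by exists u'.
  by exists (u', q).
have [c [cc uc sc bc]] := closed_avoid2 (@up_inj 68) (@codom_up 68) H_sym R_up R_last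
  Q_pass Q_port_surj H_passes H_skip x y.
rewrite c69 in sc; exists c; split=> //; last exact: pred2_notin.
by rewrite /is_cycle /ucycleb sc uc andbT.
Qed.

Definition graph_P1 : sgraph := composite termQ Q_sym Q_irr K_sym K_neq.

Lemma graph_P1_paths : paths_avoid 1 graph_P1.
Proof.
apply: (@paths_avoidI _ _ (2 * 35 + 2 * 34)) => [p /and3P[p0 up sp]|S /eqP/cards1P[x ->]].
  case: p p0 up sp => // a s _ us ps.
  (* A block has 35 vertices, just one more than the bound 34 on a pass, so an end in it pays for
     the excess. *)
  have := path_bound (D := 0) Q_sym termQ_inj K_sym K_neq Q_bound ps us; rewrite card_ord.
  apply=> k; have := embedded_ends (cadj_sym termQ Q_sym K_sym)
    (pair_embedded adjQ termQ_inj K_sym K_neq k) Q_bound _ ps us.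
  rewrite card_ord => /(_ isT); rewrite addn0.
  by rewrite !(eq_count (a1 := mem (codom (pair k))) (a2 := fun x => x.1 == k)) // => z /=; exact: codom_pair.
have [p [sp up zp xp]] := four_avoid1 Q_sym K_sym K_neq K_closed K_linked K_simple
  Q_pass Q_port_surj Q_end x.
exists p; split=> //; first by apply/and3P; split=> //; rewrite zp.
by move=> v; rewrite finset.in_set1 => /eqP ->.
Qed.

Definition graph_P2 : sgraph := composite termR adjR_sym adjR_irr K_sym K_neq.

Lemma graph_P2_paths : paths_avoid 2 graph_P2.
Proof.
have c69 : #|'I_69| = 69 by rewrite card_ord.
have ext_None k : nxtR (extR k) = None by apply/R_None; exists k.
apply: (@paths_avoidI _ _ (2 * (68 * 34 + 35) + 2 * (68 * 34))) => [p /and3P[p0 up sp]|S /eqP/cards2P[[k x] [[l y] [_ ->]]]].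
  case: p p0 up sp => // a s _ us ps.
  (* In a copy of R, each of the 69 copies of Q contributes at most 34 vertices plus the ends of the
     path in it, and 69 * 34 exceeds the pass bound 68 * 34 by 34. *)
  have := path_bound (D := 34) adjR_sym termR_inj K_sym K_neq R_bound ps us; rewrite card_ord.
  apply=> k; have split_count (q : seq ('I_4 * ('I_69 * 'I_35))) :
      count (fun x => x.1 == k) q = \sum_(u : 'I_69) count (mem (codom (fun q => (k, (u, q)) : 'I_4 * ('I_69 * 'I_35)))) q.
    elim: q => [|[k' [u' q']] q IH] /=; first by rewrite big1.
    rewrite IH big_split /=; congr (_ + _).
    have memE (u : 'I_69) : ((k', (u', q')) \in codom (fun q => (k, (u, q)) : 'I_4 * ('I_69 * 'I_35))) = (k' == k) && (u' == u).
      apply/codomP/andP => [[q0 [-> -> _]]|[/eqP -> /eqP ->]]; first by rewrite !eqxx.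
      by exists q'.
    rewrite (bigD1 u') //= memE eqxx andbT big1 ?addn0 // => u uu.
    by rewrite memE [u' == u]eq_sym (negbTE uu) andbF.
  rewrite !split_count; apply: (@leq_trans (\sum_(u : 'I_69) (34 +
      count (mem (codom (fun q => (k, (u, q)) : 'I_4 * ('I_69 * 'I_35)))) [:: a; last a s]))).
    apply: leq_sum => u _; apply: (embedded_ends (cadj_sym termR adjR_sym K_sym)
      (embedded_block termQ_inj R_sym R_neq ext_None u (pair_embedded adjR termR_inj K_sym K_neq k)) Q_bound _ ps us).
    by rewrite card_ord.
  by rewrite big_split /= sum_nat_const card_ord leq_add2r.
have tied_dec (z : 'I_69 * 'I_35) : (exists2 k, tied q_port extR z k & forall k', tied q_port extR z k' -> k' = k) \/
    forall k, ~ tied q_port extR z k.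
  have [/existsP[i /eqP hi]|/existsPn hn] := boolP [exists i, extR i == (z.1, q_port z.2)].
    by left; exists i => // i' hi'; apply: ext_inj; rewrite hi.
  by right=> i /eqP; apply/negP; exact: hn.
have tied_ex i : exists z, tied q_port extR z i.
  have [q eq] := Q_port_surj (extR i).2; exists ((extR i).1, q).
  by rewrite /tied eq; case: (extR i).
have pass1 z i := composite_pass1 (k := i) (x := z) Q_sym Q_pass Q_port_surj R_sym ext_block H_passes.
have pass2 z z' := composite_pass2 (x := z) (y := z') Q_sym Q_pass Q_port_surj R_sym ext_block H_passes.
have end2 z z' i (h : exists2 j, j != i & tied q_port extR z j) (h' : exists2 j, j != i & tied q_port extR z' j)
    (hz : z = z' \/ exists j j', [/\ tied q_port extR z j, tied q_port extR z' j' & j <> j']) :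
    has_end adjR termR (#|'I_69|.-1 * 34 + 35) (pred2 z z') i.
  apply: (composite_end Q_pass Q_port_surj Q_end H_ends h h') => e.
  case: hz => // -[j [j' [tj tj' []]]]; apply: ext_block.
  exact: etrans (congr1 fst tj) (etrans e (esym (congr1 fst tj'))).
rewrite c69 in pass1 pass2 end2.
have [p [sp up zp bp]] : exists p, [/\ sorted (cadj adjR termR nxtK) p, uniq p,
    size p = 2 * (68 * 34 + 35) + 2 * (68 * 34) & ~~ has (pred2 (k, x) (l, y)) p].
  have [->|kl] := eqVneq k l.
    exact: (four_avoid_same adjR_sym K_sym K_neq K_closed K_linked K_simple tied_dec tied_ex pass1 pass2 end2).
  exact: (four_avoid_distinct adjR_sym K_sym K_neq K_closed K_linked K_simple tied_dec tied_ex pass1 end2).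
exists p; split=> //; last exact: pred2_notin.
by apply/and3P; split=> //; rewrite zp.
Qed.

(** * The hypohamiltonian graph on 40 vertices *)

Lemma g40_irr : irreflexive (@lgraph 40 g40_edges).
Proof. by apply: lgraph_irr; vm_compute. Qed.

Definition graph_C1 : sgraph := SGraph (@lgraph_sym 40 g40_edges) g40_irr.

Lemma g40_lt : all (fun e => (e.1 < 40) && (e.2 < 40)) g40_edges.
Proof. by vm_compute. Qed.

Lemma g40_nonham : list_nonham g40_edges g40_order.
Proof. by vm_cast_no_check (erefl true). Qed.

Lemma g40_conn3 : conn3 40 g40_edges.
Proof. by vm_cast_no_check (erefl true). Qed.

Lemma g40_straight : list_straight 40 g40_edges g40_pos.
Proof. by vm_cast_no_check (erefl true). Qed.

Definition g40_cycle_ok (x : nat) (p : seq nat) : bool :=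
  [&& all (fun y => y < 40) p, cycle (erel g40_edges) p, uniq p, size p == 39 & x \notin p].

(** The trail starts at vertex 0, or at vertex 1 when 0 is the vertex to be missed. *)
Lemma g40_cycles_ok : all (fun x => g40_cycle_ok x
  (trail g40_edges 39 (nth N0 g40_cycle_codes x) (x == 0))) (iota 0 40).
Proof. by vm_cast_no_check (erefl true). Qed.

Lemma cycle_ords n E p : all (fun x => x < n.+1) p -> cycle (erel E) p ->
  cycle (@lgraph n.+1 E) (ords n p).
Proof.
case: p => // a s h c; have := @path_ords n E a (rcons s a); rewrite /ords map_rcons; apply=> //.
by case/andP: h => ha hs; rewrite -rcons_cons all_rcons /= ha.
Qed.

Lemma graph_C1_cycles : cycles_avoid 1 graph_C1.
Proof.
apply: (@cycles_avoidI _ _ 39) => [c /andP[c3 /andP[cc uc]]|S /eqP/cards1P[x ->]].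
  rewrite leqNgt; apply/negP => c39.
  have s40 : size [seq val u | u <- c] = size (iota 0 40).
    apply/eqP; rewrite size_map size_iota eqn_leq c39 andbT.
    by have := max_card (mem c); rewrite (card_uniqP uc) card_ord.
  have uv : uniq [seq val u | u <- c] by rewrite (map_inj_uniq val_inj).
  have sub : {subset [seq val u | u <- c] <= iota 0 40}.
    by move=> y /mapP[u _ ->]; rewrite mem_iota; exact: ltn_ord.
  apply: (list_nonhamP (c := [seq val u | u <- c]) g40_nonham) => //.
  - have po : perm_eq g40_order (iota 0 40) by vm_compute.
    apply: perm_trans po _; rewrite perm_sym; apply: (uniq_perm uv (iota_uniq 0 40)).
    by have [] := uniq_min_size uv sub (eq_leq (esym s40)).
  - by rewrite size_map.
  - by case: (c) cc => //= a s; rewrite -map_rcons path_map.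
have /allP/(_ (val x)) := g40_cycles_ok; rewrite mem_iota ltn_ord => /(_ isT).
set p := trail _ _ _ _; case/and5P=> pl pc pu /eqP ps xp.
exists (ords 39 p); split.
- rewrite /is_cycle /ucycleb size_map ps /=; apply/andP; split; last exact: uniq_ords.
  exact: cycle_ords.
- by rewrite size_map.
- by move=> y; rewrite finset.in_set1 => /eqP ->; rewrite mem_ords.
Qed.

Theorem corollary4p7 (R : realType) :
  (exists n : nat, Cbar R 1 3 n /\ (n <= 40)%N) /\
  (exists n : nat, Cbar R 2 3 n /\ (n <= 2625)%N) /\
  (exists n : nat, Pbar R 1 3 n /\ (n <= 156)%N) /\
  (exists n : nat, Pbar R 2 3 n /\ (n <= 10350)%N).
Proof.
have lt3 a b : 4 <= a -> 0 < b -> 3 < a * b by move=> a4 b0; rewrite (leq_trans a4) // leq_pmulr.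
split; [|split; [|split]].
- apply: (@smallest_order_le _ graph_C1); last by rewrite /gorder card_ord.
  split; last exact: graph_C1_cycles.
  + apply: (@straight_planar R graph_C1 (fun x => pt R 1%bZ (place g40_pos x))).
      exact: (list_straightP R (D := 1%bZ) (erefl _) g40_straight).
    by move=> x; apply: (list_isoP g40_lt _ x); vm_compute.
  + apply: k_connected3; first by rewrite card_ord.
    exact: (conn3P g40_lt g40_conn3).
- apply: (@smallest_order_le _ graph_C2); last by rewrite /gorder card_prod !card_ord.
  split; last exact: graph_C2_cycles.
  + exact: (composite_planar _ _ _ _ Q_iso (Q_drawing R) (H_drawing R)).
  + apply: (composite_k_connected Q_sym Q_irr termQ_inj H_sym H_neq _ Q_conn1 Q_conn2 H_closed H_cut3).
    by rewrite card_prod !card_ord lt3.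
- apply: (@smallest_order_le _ graph_P1); last by rewrite /gorder card_prod !card_ord.
  split; last exact: graph_P1_paths.
  + exact: (composite_planar _ _ _ _ Q_iso (Q_drawing R) (K_drawing R)).
  + apply: (composite_k_connected Q_sym Q_irr termQ_inj K_sym K_neq _ Q_conn1 Q_conn2 K_closed K_cut3).
    by rewrite card_prod !card_ord lt3.
- apply: (@smallest_order_le _ graph_P2); last first.
    rewrite /gorder !card_prod !card_ord.
    by apply: (@leq_trans (4 * (69 * 35))); vm_compute.
  split; last exact: graph_P2_paths.
  + exact: (composite_planar _ _ _ _ R_iso (R_drawing R) (K_drawing R)).
  + apply: (composite_k_connected adjR_sym adjR_irr termR_inj K_sym K_neq _ R_conn1 R_conn2 K_closed K_cut3).
    by rewrite !card_prod !card_ord lt3.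
Qed.
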